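(* Let $H$ be a subgroup of a finite group $G$ and let $\rho$ be a strict $2$-categorical action of $H$ on a $K$-linear strict $2$-category $\mathcal{V}$. Let $\psi$ denote the categorical actions of the centralizers $C_H(u)$ on the $2$-categorical traces $\mathbb{T}r_2\rho_u$ ($u\in H$), and suppose that the categorical trace $\mathbb{T}r\,\psi_h$ is finite dimensional for each $h\in H$ (i.e. for each $u\in H$ and $h\in C_H(u)$, with $\psi_h$ acting on $\mathbb{T}r_2\rho_u$). Then for pairwise commuting $f,g,k\in G$ the $3$-character $\chi_{\mathrm{ind}}$ of the induced strict $2$-categorical action of $G$ is $$\chi_{\mathrm{ind}}(f,g,k)=\frac1{|H|}\sum_{\substack{s\in G\\ s^{-1}(f,g,k)s\in H\times H\times H}}\chi_\rho(s^{-1}fs,\,s^{-1}gs,\,s^{-1}ks).$$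
   Context: $K$ is a field of characteristic $0$ containing all roots of unity. **Conventions.** In a strict $3$-category, $\#_p$ is composition along a common $p$-dimensional boundary, and composing a lower-dimensional arrow with a higher one means whiskering. $\#_1$ and $\#_2$ are written in natural order. For functors, $\rho_h\#_0\rho_g=\rho_h\rho_g$ means $w\mapsto\rho_h(\rho_g(w))$. $C_G(f)$ is the centralizer, $g^*=g^{-1}$. The notation $s^{-1}(f,g,k)s$ means $(s^{-1}fs,s^{-1}gs,s^{-1}ks)$. **Strict $2$-categorical action.** For a strict $2$-category $\mathcal{V}$ let $\mathcal{V}^*$ be the $3$-category with one object $\mathcal{V}$, $1$-arrows the $2$-functors $\mathcal{V}\to\mathcal{V}$, $2$-arrows the pseudonatural transformations, $3$-arrows the modifications (all $K$-linear in the $K$-linear case). A strict $2$-categorical action of a group $H$ on $\mathcal{V}$ is a $3$-representation of $H$ in a strict $3$-subcategory $\mathcal{W}$ of $\mathcal{V}^*$, that is: $1$-isomorphisms $\rho_h:\mathcal{V}\to\mathcal{V}$ (invertible up to $2$-isomorphism in $\mathcal{W}$), $2$-isomorphisms $\phi_{h,g}:\rho_h\rho_g\Rightarrow\rho_{hg}$, $3$-isomorphisms $$\Phi_{g_3,g_2,g_1}:(\rho_{g_3}\#_0\phi_{g_2,g_1})\#_1\phi_{g_3,g_2g_1}\to(\phi_{g_3,g_2}\#_0\rho_{g_1})\#_1\phi_{g_3g_2,g_1},$$ with (standing assumption) $\rho_1=1_{\mathcal{V}}$ and $\phi_{1,g},\phi_{g,1}$ identities, satisfying the $3$-cocycle condition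 $$\{[\rho_{g_4}\#_0\Phi_{g_3,g_2,g_1}]\#_1\phi_{g_4,g_3g_2g_1}\}\#_2\{[\rho_{g_4}\#_0\phi_{g_3,g_2}\#_0\rho_{g_1}]\#_1\Phi_{g_4,g_3g_2,g_1}\}\#_2\{[\Phi_{g_4,g_3,g_2}\#_0\rho_{g_1}]\#_1\phi_{g_4g_3g_2,g_1}\}$$ $$=\{[(\rho_{g_4}\rho_{g_3})\#_0\phi_{g_2,g_1}]\#_1\Phi_{g_4,g_3,g_2g_1}\}\#_2\{[\phi_{g_4,g_3}\#_0(\rho_{g_2}\rho_{g_1})]\#_1\Phi_{g_4g_3,g_2,g_1}\}.$$ **$2$-categorical trace and the centralizer action.** $\mathbb{T}r_2\rho_f$ is the ($K$-linear) category with objects the $2$-arrows $\chi:1_{\mathcal{V}}\Rightarrow\rho_f$ of $\mathcal{W}$ and morphisms the $3$-arrows between them. The centralizer of $f$ acts categorically on it by $\psi=\{\psi_g,\Gamma_{h,g}\}$: with $u_g=\phi_{g,g^*}^{-1}$, $$\psi_g(\omega)=u_g\#_1[\rho_g\#_0\omega\#_0\rho_{g^*}]\#_1[\phi_{g,f}\#_0\rho_{g^*}]\#_1\phi_{gf,g^*}$$ on objects and morphisms $\omega$. For $e\in\{f,1\}$ let $$\begin{aligned} L^e&=[\rho_h\#_0\phi_{g,e}\#_0(\rho_{g^*}\rho_{h^*})]\#_1[\rho_h\#_0\phi_{ge,g^*}\#_0\rho_{h^*}]\#_1[\phi_{h,geg^*}\#_0\rho_{h^*}]\#_1\phi_{hgeg^*,h^*},\\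 R^e&=[\phi_{h,g}\#_0(\rho_e\rho_{g^*}\rho_{h^*})]\#_1[\phi_{hg,e}\#_0(\rho_{g^*}\rho_{h^*})]\#_1[\rho_{hge}\#_0\phi_{g^*,h^*}]\#_1\phi_{hge,g^*h^*}, \end{aligned}$$ and let $\Lambda^e:L^e\to R^e$ be the $\#_2$-composite of $[\rho_h\#_0\phi_{g,e}\#_0(\rho_{g^*}\rho_{h^*})]\#_1[\Phi_{h,ge,g^*}\#_0\rho_{h^*}]\#_1\phi_{hgeg^*,h^*}$, then $[\Phi_{h,g,e}\#_0(\rho_{g^*}\rho_{h^*})]\#_1[\phi_{hge,g^*}\#_0\rho_{h^*}]\#_1\phi_{hgeg^*,h^*}$, then $[\phi_{h,g}\#_0(\rho_e\rho_{g^*}\rho_{h^*})]\#_1[\phi_{hg,e}\#_0(\rho_{g^*}\rho_{h^*})]\#_1\Phi^{-1}_{hge,g^*,h^*}$. Then $\Gamma_{h,g}(\chi)=\big((L^1)^{-1}\#_1(\Lambda^1)^{-1}\#_1(R^1)^{-1}\big)\#_1[(\rho_h\rho_g)\#_0\chi\#_0(\rho_{g^*}\rho_{h^*})]\#_1\Lambda^f:\psi_h\psi_g(\chi)\to\psi_{hg}(\chi)$. A categorical action of a group on a category consists of equivalences $\psi_g$ and natural isomorphisms $\Gamma_{h,g}:\psi_h\circ\psi_g\to\psi_{hg}$ that are associative (the two composites $\psi_k\psi_h\psi_g\to\psi_{khg}$ agree), together with a compatible isomorphism $\psi_1\cong\mathrm{id}$. **$2$-character.** For a categorical action $\{\psi_g,\Gamma_{h,g}\}$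 of a group on a $K$-linear category $\mathcal{U}$ by $K$-linear functors, the categorical trace of $\psi_g$ is the $K$-vector space $\mathbb{T}r\,\psi_g$ of natural transformations $\mathrm{id}_{\mathcal{U}}\to\psi_g$. If $k$ commutes with $g$, then $\psi_k$ induces the linear map on $\mathbb{T}r\,\psi_g$ sending $\theta$ to the composite $$\mathrm{id}_{\mathcal{U}}\to\psi_k\psi_{k^*}\xrightarrow{\psi_k\theta\psi_{k^*}}\psi_k\psi_g\psi_{k^*}\to\psi_{kg}\psi_{k^*}\to\psi_{kgk^*}=\psi_g,$$ the unnamed arrows being the structure isomorphisms (or inverses). The $2$-character (joint trace) $\chi_\psi(g,k)$ is the trace of this linear map, when $\mathbb{T}r\,\psi_g$ is finite dimensional. **$3$-character.** For a strict $2$-categorical action $\rho$ and pairwise commuting $f,g,k$, $\chi_\rho(f,g,k):=\chi_\psi(g,k)$, where $\psi$ is the categorical action of the centralizer of $f$ on $\mathbb{T}r_2\rho_f$. **Induced strict $2$-categorical action.** Let $r_1,\dots,r_m$ be representatives of the left cosets of $H$ in $G$. $\mathrm{Ind}_H^G(\mathcal{V})$ is identified with $\mathcal{V}^m$ (componentwise compositions). Functors on $\mathcal{V}^m$ are $m\times m$ matrices $(a_{jk})$ of functors on $\mathcal{V}$ belonging to $\mathcal{W}$, with at most one nonzero entry in each row and column, acting by $(w_k)_k\mapsto(\sum_ka_{jk}(w_k))_j$ and composed by matrix multiplication. Transformations and modifications between them are matrices of transformations and modifications between the corresponding entries in $\mathcal{W}$, where the only transformation with a zero functor as source or target is zero;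 $1_{\mathcal{V}^m}=\mathrm{diag}(1_{\mathcal{V}},\dots,1_{\mathcal{V}})$. The induced action $\widehat\rho$ of $G$ is: $(\widehat\rho_g)_{ji}=\rho_h$ if $gr_i=r_jh$ with $h\in H$, and $0$ otherwise. If $g_1r_i=r_jh_1$, $g_2r_j=r_kh_2$, $g_3r_k=r_lh_3$ with $h_1,h_2,h_3\in H$, then $(\widehat\phi_{g_2,g_1})_{ki}=\phi_{h_2,h_1}$ and $(\widehat\Phi_{g_3,g_2,g_1})_{li}=\Phi_{h_3,h_2,h_1}$, all other entries being zero. $\chi_{\mathrm{ind}}$ is the $3$-character of $\widehat\rho$, with $\mathbb{T}r_2\widehat\rho_f$ the category of such matrix transformations $1_{\mathcal{V}^m}\Rightarrow\widehat\rho_f$ and modifications between them.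
   Formalization: The K-linear strict 3-subcategory W is assumed to contain a zero transformation between any two of its functors (K-linear categories have zero objects); without this a 2-categorical trace can be empty and the formula can fail. *)

(* Defs.v *)
From HB Require Import structures.
From mathcomp Require Import all_boot all_order all_algebra all_fingroup.
From mathcomp Require Import boolp classical_sets.

Set Implicit Arguments.
Unset Strict Implicit.
Unset Printing Implicit Defensive.

Import GRing.Theory.
Local Open Scope ring_scope.

(* Higher categories are single-sorted: there is one type of arrows in each   *)
(* dimension, with source and target maps, and the compositions are total     *)
(* functions of which only the values on composable arrows matter.  Strict    *)
(* identities, e.g. rho_1 = 1, are then plain equalities without transport.   *)

Definition lmod_on (K : fieldType) (T : Type) (P : T -> Prop)
    (zero : T) (add : T -> T -> T) (scale : K -> T -> T) : Prop :=
  exists (E : lmodType K) (i : E -> T),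
    [/\ injective i,
        forall x, P x <-> exists v, i v = x,
        i 0 = zero,
        forall u v, i (u + v) = add (i u) (i v)
      & forall a u, i (a *: u) = scale a (i u)].

Definition choose_or (T : Type) (x0 : T) (P : T -> Prop) : T :=
  if pselect (exists x, P x) is left e then sval (cid e) else x0.

(* ------------------------------------------------------------------------ *)
(* K-linear strict 2-categories.  All compositions are in diagrammatic order. *)

Record lin2cat (K : fieldType) := Lin2Cat {
  cell0 : Type;
  cell1 : Type;
  cell2 : Type;
  src1 : cell1 -> cell0;
  tgt1 : cell1 -> cell0;
  src2 : cell2 -> cell1;
  tgt2 : cell2 -> cell1;
  id1 : cell0 -> cell1;
  id2 : cell1 -> cell2;
  comp1 : cell1 -> cell1 -> cell1;
  hcomp : cell2 -> cell2 -> cell2;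
  vcomp : cell2 -> cell2 -> cell2;
  zero2 : cell1 -> cell1 -> cell2;
  add2 : cell2 -> cell2 -> cell2;
  scale2 : K -> cell2 -> cell2;

  src1_id : forall x, src1 (id1 x) = x;
  tgt1_id : forall x, tgt1 (id1 x) = x;
  src1_comp : forall f g, tgt1 f = src1 g -> src1 (comp1 f g) = src1 f;
  tgt1_comp : forall f g, tgt1 f = src1 g -> tgt1 (comp1 f g) = tgt1 g;
  comp1A : forall f g h, tgt1 f = src1 g -> tgt1 g = src1 h ->
    comp1 f (comp1 g h) = comp1 (comp1 f g) h;
  comp1_idl : forall f, comp1 (id1 (src1 f)) f = f;
  comp1_idr : forall f, comp1 f (id1 (tgt1 f)) = f;

  src1_glob : forall x, src1 (src2 x) = src1 (tgt2 x);
  tgt1_glob : forall x, tgt1 (src2 x) = tgt1 (tgt2 x);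

  src2_id : forall f, src2 (id2 f) = f;
  tgt2_id : forall f, tgt2 (id2 f) = f;
  src2_vcomp : forall x y, tgt2 x = src2 y -> src2 (vcomp x y) = src2 x;
  tgt2_vcomp : forall x y, tgt2 x = src2 y -> tgt2 (vcomp x y) = tgt2 y;
  vcompA : forall x y z, tgt2 x = src2 y -> tgt2 y = src2 z ->
    vcomp x (vcomp y z) = vcomp (vcomp x y) z;
  vcomp_idl : forall x, vcomp (id2 (src2 x)) x = x;
  vcomp_idr : forall x, vcomp x (id2 (tgt2 x)) = x;

  src2_hcomp : forall x y, tgt1 (src2 x) = src1 (src2 y) ->
    src2 (hcomp x y) = comp1 (src2 x) (src2 y);
  tgt2_hcomp : forall x y, tgt1 (src2 x) = src1 (src2 y) ->
    tgt2 (hcomp x y) = comp1 (tgt2 x) (tgt2 y);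
  hcompA : forall x y z,
    tgt1 (src2 x) = src1 (src2 y) -> tgt1 (src2 y) = src1 (src2 z) ->
    hcomp x (hcomp y z) = hcomp (hcomp x y) z;
  hcomp_idl : forall x, hcomp (id2 (id1 (src1 (src2 x)))) x = x;
  hcomp_idr : forall x, hcomp x (id2 (id1 (tgt1 (src2 x)))) = x;
  hcomp_id2 : forall f g, tgt1 f = src1 g ->
    hcomp (id2 f) (id2 g) = id2 (comp1 f g);
  hv_interchange : forall x x' y y',
    tgt2 x = src2 x' -> tgt2 y = src2 y' -> tgt1 (src2 x) = src1 (src2 y) ->
    vcomp (hcomp x y) (hcomp x' y') = hcomp (vcomp x x') (vcomp y y');

  cell2_lmod : forall f g, src1 f = src1 g -> tgt1 f = tgt1 g ->
    lmod_on (fun x => src2 x = f /\ tgt2 x = g) (zero2 f g) add2 scale2;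
  vcompDl : forall x x' y,
    src2 x = src2 x' -> tgt2 x = tgt2 x' -> tgt2 x = src2 y ->
    vcomp (add2 x x') y = add2 (vcomp x y) (vcomp x' y);
  vcompDr : forall x y y',
    src2 y = src2 y' -> tgt2 y = tgt2 y' -> tgt2 x = src2 y ->
    vcomp x (add2 y y') = add2 (vcomp x y) (vcomp x y');
  vcompZl : forall a x y, tgt2 x = src2 y ->
    vcomp (scale2 a x) y = scale2 a (vcomp x y);
  vcompZr : forall a x y, tgt2 x = src2 y ->
    vcomp x (scale2 a y) = scale2 a (vcomp x y);
  hcompDl : forall x x' y,
    src2 x = src2 x' -> tgt2 x = tgt2 x' -> tgt1 (src2 x) = src1 (src2 y) ->
    hcomp (add2 x x') y = add2 (hcomp x y) (hcomp x' y);
  hcompDr : forall x y y',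
    src2 y = src2 y' -> tgt2 y = tgt2 y' -> tgt1 (src2 x) = src1 (src2 y) ->
    hcomp x (add2 y y') = add2 (hcomp x y) (hcomp x y');
  hcompZl : forall a x y, tgt1 (src2 x) = src1 (src2 y) ->
    hcomp (scale2 a x) y = scale2 a (hcomp x y);
  hcompZr : forall a x y, tgt1 (src2 x) = src1 (src2 y) ->
    hcomp x (scale2 a y) = scale2 a (hcomp x y)
}.

(* ------------------------------------------------------------------------ *)
(* 2-functors V -> V, pseudonatural transformations and modifications: raw    *)
(* data, with separate predicates for the axioms.                             *)

Section Star.

Variables (K : fieldType) (V : lin2cat K).

Record fun2 := Fun2 {
  fob : cell0 V -> cell0 V;
  far : cell1 V -> cell1 V;
  fcell : cell2 V -> cell2 V
}.

Record trans2 := Trans2 {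
  tsrc : fun2;
  ttgt : fun2;
  tob : cell0 V -> cell1 V;
  tar : cell1 V -> cell2 V
}.

Record modif := Modif {
  msrc : trans2;
  mtgt : trans2;
  mob : cell0 V -> cell2 V
}.

Record is_fun2 (F : fun2) : Prop := IsFun2 {
  far_src : forall f, src1 (far F f) = fob F (src1 f);
  far_tgt : forall f, tgt1 (far F f) = fob F (tgt1 f);
  far_id : forall x, far F (id1 x) = id1 (fob F x);
  far_comp : forall f g, tgt1 f = src1 g ->
    far F (comp1 f g) = comp1 (far F f) (far F g);
  fcell_src : forall x, src2 (fcell F x) = far F (src2 x);
  fcell_tgt : forall x, tgt2 (fcell F x) = far F (tgt2 x);
  fcell_id : forall f, fcell F (id2 f) = id2 (far F f);
  fcell_vcomp : forall x y, tgt2 x = src2 y ->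
    fcell F (vcomp x y) = vcomp (fcell F x) (fcell F y);
  fcell_hcomp : forall x y, tgt1 (src2 x) = src1 (src2 y) ->
    fcell F (hcomp x y) = hcomp (fcell F x) (fcell F y);
  fcell_add : forall x y, src2 x = src2 y -> tgt2 x = tgt2 y ->
    fcell F (add2 x y) = add2 (fcell F x) (fcell F y);
  fcell_scale : forall a x, fcell F (scale2 a x) = scale2 a (fcell F x)
}.

Definition invertible2 (x : cell2 V) : Prop :=
  exists y, [/\ src2 y = tgt2 x, tgt2 y = src2 x,
                vcomp x y = id2 (src2 x) & vcomp y x = id2 (tgt2 x)].

(* For a : F => G and f : x -> y, the naturality constraint is the invertible *)
(* 2-cell  tar a f : F f ; a_y => a_x ; G f.                                  *)
Record is_pseudonat (a : trans2) : Prop := IsPseudonat {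
  tsrc_fun2 : is_fun2 (tsrc a);
  ttgt_fun2 : is_fun2 (ttgt a);
  tob_src : forall x, src1 (tob a x) = fob (tsrc a) x;
  tob_tgt : forall x, tgt1 (tob a x) = fob (ttgt a) x;
  tar_src : forall f,
    src2 (tar a f) = comp1 (far (tsrc a) f) (tob a (tgt1 f));
  tar_tgt : forall f,
    tgt2 (tar a f) = comp1 (tob a (src1 f)) (far (ttgt a) f);
  tar_inv : forall f, invertible2 (tar a f);
  tar_nat : forall x,
    vcomp (hcomp (fcell (tsrc a) x) (id2 (tob a (tgt1 (src2 x)))))
          (tar a (tgt2 x)) =
    vcomp (tar a (src2 x))
          (hcomp (id2 (tob a (src1 (src2 x)))) (fcell (ttgt a) x));
  tar_id : forall x, tar a (id1 x) = id2 (tob a x);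
  tar_comp : forall f g, tgt1 f = src1 g ->
    tar a (comp1 f g) = vcomp (hcomp (id2 (far (tsrc a) f)) (tar a g))
                              (hcomp (tar a f) (id2 (far (ttgt a) g)))
}.

Record is_modif (m : modif) : Prop := IsModif {
  msrc_pseudonat : is_pseudonat (msrc m);
  mtgt_pseudonat : is_pseudonat (mtgt m);
  modif_tsrc : tsrc (msrc m) = tsrc (mtgt m);
  modif_ttgt : ttgt (msrc m) = ttgt (mtgt m);
  mob_src : forall x, src2 (mob m x) = tob (msrc m) x;
  mob_tgt : forall x, tgt2 (mob m x) = tob (mtgt m) x;
  mob_nat : forall f,
    vcomp (hcomp (id2 (far (tsrc (msrc m)) f)) (mob m (tgt1 f)))
          (tar (mtgt m) f) =
    vcomp (tar (msrc m) f)
          (hcomp (mob m (src1 f)) (id2 (far (ttgt (msrc m)) f)))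
}.

Definition idF : fun2 := Fun2 id id id.

Definition compF (F G : fun2) : fun2 :=
  Fun2 (fob F \o fob G) (far F \o far G) (fcell F \o fcell G).

Definition idT (F : fun2) : trans2 :=
  Trans2 F F (fun x => id1 (fob F x)) (fun f => id2 (far F f)).

Definition compT (a b : trans2) : trans2 :=
  Trans2 (tsrc a) (ttgt b)
    (fun x => comp1 (tob a x) (tob b x))
    (fun f => vcomp (hcomp (tar a f) (id2 (tob b (tgt1 f))))
                    (hcomp (id2 (tob a (src1 f))) (tar b f))).

Definition whiskFT (F : fun2) (a : trans2) : trans2 :=
  Trans2 (compF F (tsrc a)) (compF F (ttgt a))
    (fun x => far F (tob a x)) (fun f => fcell F (tar a f)).

Definition whiskTF (a : trans2) (F : fun2) : trans2 :=
  Trans2 (compF (tsrc a) F) (compF (ttgt a) F)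
    (fun x => tob a (fob F x)) (fun f => tar a (far F f)).

Definition idM (a : trans2) : modif := Modif a a (fun x => id2 (tob a x)).

Definition hcompM (m n : modif) : modif :=
  Modif (compT (msrc m) (msrc n)) (compT (mtgt m) (mtgt n))
    (fun x => hcomp (mob m x) (mob n x)).

Definition vcompM (m n : modif) : modif :=
  Modif (msrc m) (mtgt n) (fun x => vcomp (mob m x) (mob n x)).

Definition whiskFM (F : fun2) (m : modif) : modif :=
  Modif (whiskFT F (msrc m)) (whiskFT F (mtgt m)) (fun x => fcell F (mob m x)).

Definition whiskMF (m : modif) (F : fun2) : modif :=
  Modif (whiskTF (msrc m) F) (whiskTF (mtgt m) F) (fun x => mob m (fob F x)).

Definition zeroM (a b : trans2) : modif :=
  Modif a b (fun x => zero2 (tob a x) (tob b x)).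

Definition addM (m n : modif) : modif :=
  Modif (msrc m) (mtgt m) (fun x => add2 (mob m x) (mob n x)).

Definition scaleM (c : K) (m : modif) : modif :=
  Modif (msrc m) (mtgt m) (fun x => scale2 c (mob m x)).

End Star.

(* ------------------------------------------------------------------------ *)
(* The arrows and operations of a K-linear 3-category with a single object.   *)
(* In a raw type A_i only the elements satisfying in_i are arrows.            *)

Record cat3 (K : fieldType) := Cat3 {
  A1 : Type;
  A2 : Type;
  A3 : Type;
  in1 : A1 -> Prop;
  in2 : A2 -> Prop;
  in3 : A3 -> Prop;
  s2 : A2 -> A1;
  t2 : A2 -> A1;
  s3 : A3 -> A2;
  t3 : A3 -> A2;
  one1 : A1;
  one2 : A1 -> A2;
  one3 : A2 -> A3;
  op0_11 : A1 -> A1 -> A1;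
  op0_12 : A1 -> A2 -> A2;
  op0_21 : A2 -> A1 -> A2;
  op0_13 : A1 -> A3 -> A3;
  op0_31 : A3 -> A1 -> A3;
  op1_22 : A2 -> A2 -> A2;
  op1_33 : A3 -> A3 -> A3;
  op2_33 : A3 -> A3 -> A3;
  zero3 : A2 -> A2 -> A3;
  add3 : A3 -> A3 -> A3;
  scale3 : K -> A3 -> A3
}.

Arguments one1 {K} c.
Arguments op0_11 {K} c _ _.
Arguments op0_12 {K} c _ _.
Arguments op0_21 {K} c _ _.
Arguments op0_13 {K} c _ _.
Arguments op0_31 {K} c _ _.
Arguments op1_22 {K} c _ _.
Arguments op1_33 {K} c _ _.
Arguments op2_33 {K} c _ _.

(* #0 and #1 are overloaded on the dimensions of their arguments.             *)
Class Comp0 (A B C : Type) := comp0c : A -> B -> C.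
Class Comp1 (A B C : Type) := comp1c : A -> B -> C.

#[export] Instance comp0_11 K (C : cat3 K) : Comp0 (A1 C) (A1 C) (A1 C) :=
  op0_11 C.
#[export] Instance comp0_12 K (C : cat3 K) : Comp0 (A1 C) (A2 C) (A2 C) :=
  op0_12 C.
#[export] Instance comp0_21 K (C : cat3 K) : Comp0 (A2 C) (A1 C) (A2 C) :=
  op0_21 C.
#[export] Instance comp0_13 K (C : cat3 K) : Comp0 (A1 C) (A3 C) (A3 C) :=
  op0_13 C.
#[export] Instance comp0_31 K (C : cat3 K) : Comp0 (A3 C) (A1 C) (A3 C) :=
  op0_31 C.
#[export] Instance comp1_22 K (C : cat3 K) : Comp1 (A2 C) (A2 C) (A2 C) :=
  op1_22 C.
#[export] Instance comp1_33 K (C : cat3 K) : Comp1 (A3 C) (A3 C) (A3 C) :=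
  op1_33 C.
#[export] Instance comp1_23 K (C : cat3 K) : Comp1 (A2 C) (A3 C) (A3 C) :=
  fun a x => op1_33 C (one3 a) x.
#[export] Instance comp1_32 K (C : cat3 K) : Comp1 (A3 C) (A2 C) (A3 C) :=
  fun x a => op1_33 C x (one3 a).

Notation "x #0 y" := (comp0c x y) (at level 40, left associativity).
Notation "x #1 y" := (comp1c x y) (at level 50, left associativity).
Notation "x #2 y" := (op2_33 _ x y) (at level 58, left associativity).

Section Cat3.

Variables (K : fieldType) (C : cat3 K).
Implicit Types (F G : A1 C) (a b : A2 C) (x y : A3 C).

Definition arrow2 F G a : Prop := [/\ in2 a, s2 a = F & t2 a = G].
Definition arrow3 a b x : Prop := [/\ in3 x, s3 x = a & t3 x = b].

Definition inverse2 a b : Prop :=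
  [/\ arrow2 (t2 a) (s2 a) b, a #1 b = one2 (s2 a) & b #1 a = one2 (t2 a)].
Definition inverse3 x y : Prop :=
  [/\ arrow3 (t3 x) (s3 x) y, x #2 y = one3 (s3 x) & y #2 x = one3 (t3 x)].

Definition inv2 a : A2 C := choose_or a (inverse2 a).
Definition inv3 x : A3 C := choose_or x (inverse3 x).

Definition iso2 F G a : Prop := arrow2 F G a /\ exists b, inverse2 a b.
Definition iso3 a b x : Prop := arrow3 a b x /\ exists y, inverse3 x y.

End Cat3.

(* ------------------------------------------------------------------------ *)
(* Strict 3-subcategories of V^*.                                             *)

Record sub3 (K : fieldType) (V : lin2cat K) := Sub3 {
  W1 : fun2 V -> Prop;
  W2 : trans2 V -> Prop;
  W3 : modif V -> Prop
}.

Definition cat3_of (K : fieldType) (V : lin2cat K) (W : sub3 V) : cat3 K :=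
  {| A1 := fun2 V; A2 := trans2 V; A3 := modif V;
     in1 := W1 W; in2 := W2 W; in3 := W3 W;
     s2 := @tsrc K V; t2 := @ttgt K V; s3 := @msrc K V; t3 := @mtgt K V;
     one1 := idF V; one2 := @idT K V; one3 := @idM K V;
     op0_11 := @compF K V;
     op0_12 := @whiskFT K V; op0_21 := @whiskTF K V;
     op0_13 := @whiskFM K V; op0_31 := @whiskMF K V;
     op1_22 := @compT K V; op1_33 := @hcompM K V; op2_33 := @vcompM K V;
     zero3 := @zeroM K V; add3 := @addM K V; scale3 := @scaleM K V |}.

(* In V^* every axiom of a strict 3-category holds except the interchange of  *)
(* 2-arrows along #0, which is only an invertible modification there; hence   *)
(* the three interchange equations below.  A K-linear category is understood  *)
(* to have a zero object, so that W contains zero transformations.            *)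
Record strict_sub3 (K : fieldType) (V : lin2cat K) (W : sub3 V) : Prop :=
  StrictSub3 {
  W1_fun2 : forall F, W1 W F -> is_fun2 F;
  W2_pseudonat : forall a, W2 W a -> is_pseudonat a;
  W3_modif : forall x, W3 W x -> is_modif x;
  W2_src : forall a, W2 W a -> W1 W (tsrc a);
  W2_tgt : forall a, W2 W a -> W1 W (ttgt a);
  W3_src : forall x, W3 W x -> W2 W (msrc x);
  W3_tgt : forall x, W3 W x -> W2 W (mtgt x);

  W_one1 : W1 W (idF V);
  W_one2 : forall F, W1 W F -> W2 W (idT F);
  W_one3 : forall a, W2 W a -> W3 W (idM a);
  W_op0_11 : forall F G, W1 W F -> W1 W G -> W1 W (compF F G);
  W_op0_12 : forall F a, W1 W F -> W2 W a -> W2 W (whiskFT F a);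
  W_op0_21 : forall a F, W2 W a -> W1 W F -> W2 W (whiskTF a F);
  W_op0_13 : forall F x, W1 W F -> W3 W x -> W3 W (whiskFM F x);
  W_op0_31 : forall x F, W3 W x -> W1 W F -> W3 W (whiskMF x F);
  W_op1_22 : forall a b, W2 W a -> W2 W b -> ttgt a = tsrc b ->
    W2 W (compT a b);
  W_op1_33 : forall x y, W3 W x -> W3 W y ->
    ttgt (msrc x) = tsrc (msrc y) -> W3 W (hcompM x y);
  W_op2_33 : forall x y, W3 W x -> W3 W y -> mtgt x = msrc y ->
    W3 W (vcompM x y);

  W_zero3 : forall a b, W2 W a -> W2 W b -> tsrc a = tsrc b ->
    ttgt a = ttgt b -> W3 W (zeroM a b);
  W_add3 : forall x y, W3 W x -> W3 W y -> msrc x = msrc y ->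
    mtgt x = mtgt y -> W3 W (addM x y);
  W_scale3 : forall c x, W3 W x -> W3 W (scaleM c x);
  W_zero2 : forall F G, W1 W F -> W1 W G ->
    exists z, [/\ W2 W z, tsrc z = F, ttgt z = G & idM z = zeroM z z];

  W_interchange22 : forall a b, W2 W a -> W2 W b ->
    compT (whiskTF a (tsrc b)) (whiskFT (ttgt a) b) =
    compT (whiskFT (tsrc a) b) (whiskTF a (ttgt b));
  W_interchange32 : forall x b, W3 W x -> W2 W b ->
    hcompM (whiskMF x (tsrc b)) (idM (whiskFT (ttgt (msrc x)) b)) =
    hcompM (idM (whiskFT (tsrc (msrc x)) b)) (whiskMF x (ttgt b));
  W_interchange23 : forall a y, W2 W a -> W3 W y ->
    hcompM (idM (whiskTF a (tsrc (msrc y)))) (whiskFM (ttgt a) y) =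
    hcompM (whiskFM (tsrc a) y) (idM (whiskTF a (ttgt (msrc y))))
}.

(* ------------------------------------------------------------------------ *)
(* 3-representations of a subgroup H of gT; the values outside H are          *)
(* irrelevant.                                                                *)

Record rep3 (K : fieldType) (gT : finGroupType) (C : cat3 K) := Rep3 {
  rho : gT -> A1 C;
  phi : gT -> gT -> A2 C;
  Phi : gT -> gT -> gT -> A3 C
}.

Section Rep3.

Variables (K : fieldType) (gT : finGroupType) (C : cat3 K) (X : rep3 gT C).

Local Notation r := (rho X).
Local Notation p := (phi X).
Local Notation P := (Phi X).
Local Open Scope group_scope.

Record is_rep3 (H : {group gT}) : Prop := IsRep3 {
  rho_in1 : {in H, forall g, in1 (r g)};
  rho_equiv : {in H, forall g, exists F : A1 C,
    [/\ in1 F, exists a, iso2 (r g #0 F) (one1 C) a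
             & exists b, iso2 (F #0 r g) (one1 C) b]};
  phi_iso2 : {in H &, forall h g, iso2 (r h #0 r g) (r (h * g)) (p h g)};
  Phi_iso3 : {in H & &, forall g3 g2 g1,
    iso3 ((r g3 #0 p g2 g1) #1 p g3 (g2 * g1))
         ((p g3 g2 #0 r g1) #1 p (g3 * g2) g1)
         (P g3 g2 g1)};
  rho_1 : r 1 = one1 C;
  phi_1l : {in H, forall g, p 1 g = one2 (r g)};
  phi_1r : {in H, forall g, p g 1 = one2 (r g)};
  Phi_cocycle : {in H & &, forall g4 g3 g2, {in H, forall g1,
       ((r g4 #0 P g3 g2 g1) #1 p g4 (g3 * g2 * g1))
    #2 ((r g4 #0 p g3 g2 #0 r g1) #1 P g4 (g3 * g2) g1)
    #2 ((P g4 g3 g2 #0 r g1) #1 p (g4 * g3 * g2) g1)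
    =  (((r g4 #0 r g3) #0 p g2 g1) #1 P g4 g3 (g2 * g1))
    #2 ((p g4 g3 #0 (r g2 #0 r g1)) #1 P (g4 * g3) g2 g1)}}
}.

End Rep3.

(* ------------------------------------------------------------------------ *)
(* Categorical actions of a group on a K-linear category, and 2-characters.   *)

Record cat_action (K : fieldType) (gT : finGroupType) := CatAction {
  Ob : Type;
  Mor : Type;
  is_ob : Ob -> Prop;
  is_mor : Ob -> Ob -> Mor -> Prop;
  idMor : Ob -> Mor;
  compMor : Mor -> Mor -> Mor;
  addMor : Mor -> Mor -> Mor;
  scaleMor : K -> Mor -> Mor;
  psi_ob : gT -> Ob -> Ob;
  psi_mor : gT -> Mor -> Mor;
  Gam : gT -> gT -> Ob -> Mor;
  unitMor : Ob -> Mor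
}.

Section Character2.

Variables (K : fieldType) (gT : finGroupType) (U : cat_action K gT).
Implicit Types (c d : Ob U) (th : Ob U -> Mor U).
Local Open Scope group_scope.

Local Notation "u ;; v" := (compMor u v) (at level 50, left associativity).

Definition invMor c d (u : Mor U) : Mor U :=
  choose_or u (fun v => [/\ is_mor d c v, u ;; v = idMor c & v ;; u = idMor d]).

(* Natural transformations are functions on the raw type Ob U, compared on    *)
(* objects only.                                                              *)
Definition cat_trace (g : gT) th : Prop :=
  (forall c, is_ob c -> is_mor c (psi_ob g c) (th c)) /\
  (forall c d u, is_ob c -> is_ob d -> is_mor c d u ->
     u ;; th d = th c ;; psi_mor g u).

Definition trace_map (g k : gT) th : Ob U -> Mor U := fun c =>
  let c' := psi_ob k^-1 c in
  unitMor c
  ;; invMor (psi_ob k c') (psi_ob (k * k^-1) c) (Gam k k^-1 c)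
  ;; psi_mor k (th c')
  ;; Gam k g c'
  ;; Gam (k * g) k^-1 c.

(* A linear isomorphism from K^n onto the space cat_trace g.                  *)
Definition trace_coords (g : gT) (n : nat)
    (i : 'rV[K]_n -> Ob U -> Mor U) : Prop :=
  [/\ forall v, cat_trace g (i v),
      forall a u v c, is_ob c ->
        i (a *: u + v)%R c = addMor (scaleMor a (i u c)) (i v c)
    & forall th, cat_trace g th ->
        exists! v, forall c, is_ob c -> th c = i v c].

Definition trace_findim (g : gT) : Prop :=
  exists n (i : 'rV[K]_n -> Ob U -> Mor U), trace_coords g i.

Definition is_character2 (g k : gT) (t : K) : Prop :=
  exists n (i : 'rV[K]_n -> Ob U -> Mor U) (A : 'M[K]_n),
    [/\ trace_coords g i,
        forall v c, is_ob c -> trace_map g k (i v) c = i (v *m A)%R c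
      & t = (\tr A)%R].

Definition character2 (g k : gT) : K := choose_or 0%R (is_character2 g k).

End Character2.

(* ------------------------------------------------------------------------ *)
(* The 2-categorical trace of rho_f and the action of the centralizer of f.   *)

Section Trace2.

Variables (K : fieldType) (gT : finGroupType) (C : cat3 K) (X : rep3 gT C).

Local Notation r := (rho X).
Local Notation p := (phi X).
Local Notation P := (Phi X).
Local Open Scope group_scope.

Definition trace2_ob (f : gT) (w : A2 C) : Prop := arrow2 (one1 C) (r f) w.

Definition unit2 (g : gT) : A2 C := inv2 (p g g^-1).

Definition psi2 (f g : gT) (w : A2 C) : A2 C :=
  unit2 g #1 (r g #0 w #0 r g^-1) #1 (p g f #0 r g^-1) #1 p (g * f) g^-1.

Definition psi3 (f g : gT) (w : A3 C) : A3 C :=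
  unit2 g #1 (r g #0 w #0 r g^-1) #1 (p g f #0 r g^-1) #1 p (g * f) g^-1.

Definition Lft (h g e : gT) : A2 C :=
     (r h #0 p g e #0 (r g^-1 #0 r h^-1))
  #1 (r h #0 p (g * e) g^-1 #0 r h^-1)
  #1 (p h (g * e * g^-1) #0 r h^-1)
  #1 p (h * g * e * g^-1) h^-1.

Definition Rgt (h g e : gT) : A2 C :=
     (p h g #0 (r e #0 r g^-1 #0 r h^-1))
  #1 (p (h * g) e #0 (r g^-1 #0 r h^-1))
  #1 (r (h * g * e) #0 p g^-1 h^-1)
  #1 p (h * g * e) (g^-1 * h^-1).

Definition Lam (h g e : gT) : A3 C :=
     ((r h #0 p g e #0 (r g^-1 #0 r h^-1))
      #1 (P h (g * e) g^-1 #0 r h^-1)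
      #1 p (h * g * e * g^-1) h^-1)
  #2 ((P h g e #0 (r g^-1 #0 r h^-1))
      #1 (p (h * g * e) g^-1 #0 r h^-1)
      #1 p (h * g * e * g^-1) h^-1)
  #2 ((p h g #0 (r e #0 r g^-1 #0 r h^-1))
      #1 (p (h * g) e #0 (r g^-1 #0 r h^-1))
      #1 inv3 (P (h * g * e) g^-1 h^-1)).

Definition Gamma (f h g : gT) (w : A2 C) : A3 C :=
     (inv2 (Lft h g 1) #1 inv3 (Lam h g 1) #1 inv2 (Rgt h g 1))
  #1 ((r h #0 r g) #0 w #0 (r g^-1 #0 r h^-1))
  #1 Lam h g f.

(* As rho_1 = 1 and phi_{1,g}, phi_{g,1} are identities, psi_1 is the identity *)
(* functor, so that Gamma_{1,1} is an automorphism of id; compatibility of the *)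
(* unit id -> psi_1 with Gamma forces it to be the inverse of Gamma_{1,1}      *)
(* (the identity when Phi is normalized).                                      *)
Definition centralizer_action (f : gT) : cat_action K gT :=
  {| Ob := A2 C; Mor := A3 C;
     is_ob := trace2_ob f; is_mor := @arrow3 K C;
     idMor := @one3 K C; compMor := op2_33 C;
     addMor := @add3 K C; scaleMor := @scale3 K C;
     psi_ob := psi2 f; psi_mor := psi3 f; Gam := Gamma f;
     unitMor := fun w => inv3 (Gamma f 1 1 w) |}.

Definition character3 (f g k : gT) : K :=
  character2 (centralizer_action f) g k.

End Trace2.

(* ------------------------------------------------------------------------ *)
(* Functors, transformations and modifications on V^m as m x m matrices; the  *)
(* entry None is zero.                                                        *)

Definition olift2 (A B C : Type) (op : A -> B -> C) (u : option A)
    (v : option B) : option C :=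
  if u is Some a then if v is Some b then Some (op a b) else None else None.

Section Matrices.

Variables (A B C : Type) (m : nat).
Implicit Types (M : 'M[option A]_m) (N : 'M[option B]_m).

(* Matrix multiplication: the sum over j has at most one nonzero term as soon *)
(* as one of the factors has at most one nonzero entry in each row/column.    *)
Definition mx_prod (op : A -> B -> C) M N : 'M[option C]_m :=
  \matrix_(i, k) if [pick j | isSome (M i j) && isSome (N j k)] is Some j
                 then olift2 op (M i j) (N j k) else None.

Definition mx_zip (op : A -> B -> C) M N : 'M[option C]_m :=
  \matrix_(i, k) olift2 op (M i k) (N i k).

Definition mx_omap (op : A -> C) M : 'M[option C]_m := map_mx (omap op) M.

End Matrices.

(* The entries of a matrix arrow between the matrices S and T: zero as soon   *)
(* as the corresponding entry of S or T is.                                   *)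
Definition mx_arrow (A B : Type) (m : nat) (arr : A -> A -> B -> Prop)
    (S T : 'M[option A]_m) (M : 'M[option B]_m) : Prop :=
  forall j k, match S j k, T j k, M j k with
              | Some F, Some G, Some a => arr F G a
              | Some _, Some _, None => False
              | _, _, Some _ => False
              | _, _, None => True
              end.

Section MatrixCat3.

Variables (K : fieldType) (C : cat3 K) (m : nat).

Definition mA1 := 'M[option (A1 C)]_m.

Record mA2 := MA2 {
  ms2 : mA1; mt2 : mA1; mx2 : 'M[option (A2 C)]_m
}.

Record mA3 := MA3 {
  ms3 : mA2; mt3 : mA2; mx3 : 'M[option (A3 C)]_m
}.

Definition min1 (F : mA1) : Prop :=
  [/\ forall j k, if F j k is Some F' then in1 F' else True,
      forall j k k', isSome (F j k) -> isSome (F j k') -> k = k'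
    & forall j j' k, isSome (F j k) -> isSome (F j' k) -> j = j'].

Definition min2 (a : mA2) : Prop :=
  [/\ min1 (ms2 a), min1 (mt2 a)
    & mx_arrow (@arrow2 K C) (ms2 a) (mt2 a) (mx2 a)].

Definition min3 (x : mA3) : Prop :=
  [/\ min2 (ms3 x), min2 (mt3 x), ms2 (ms3 x) = ms2 (mt3 x),
      mt2 (ms3 x) = mt2 (mt3 x)
    & mx_arrow (@arrow3 K C) (mx2 (ms3 x)) (mx2 (mt3 x)) (mx3 x)].

Definition mone1 : mA1 :=
  \matrix_(j, k) if j == k then Some (one1 C) else None.
Definition mone2 (F : mA1) : mA2 := MA2 F F (mx_omap (@one2 K C) F).
Definition mone3 (a : mA2) : mA3 := MA3 a a (mx_omap (@one3 K C) (mx2 a)).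

Definition mop0_11 (F G : mA1) : mA1 := mx_prod (op0_11 C) F G.

Definition mop0_12 (F : mA1) (a : mA2) : mA2 :=
  MA2 (mop0_11 F (ms2 a)) (mop0_11 F (mt2 a)) (mx_prod (op0_12 C) F (mx2 a)).
Definition mop0_21 (a : mA2) (F : mA1) : mA2 :=
  MA2 (mop0_11 (ms2 a) F) (mop0_11 (mt2 a) F) (mx_prod (op0_21 C) (mx2 a) F).
Definition mop0_13 (F : mA1) (x : mA3) : mA3 :=
  MA3 (mop0_12 F (ms3 x)) (mop0_12 F (mt3 x)) (mx_prod (op0_13 C) F (mx3 x)).
Definition mop0_31 (x : mA3) (F : mA1) : mA3 :=
  MA3 (mop0_21 (ms3 x) F) (mop0_21 (mt3 x) F) (mx_prod (op0_31 C) (mx3 x) F).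

(* Only used where no composite of the form F => 0 => G with F and G nonzero   *)
(* occurs: the arrows from 1 to an induced rho_f never have such factors.      *)
Definition mop1_22 (a b : mA2) : mA2 :=
  MA2 (ms2 a) (mt2 b) (mx_zip (op1_22 C) (mx2 a) (mx2 b)).
Definition mop1_33 (x y : mA3) : mA3 :=
  MA3 (mop1_22 (ms3 x) (ms3 y)) (mop1_22 (mt3 x) (mt3 y))
      (mx_zip (op1_33 C) (mx3 x) (mx3 y)).
Definition mop2_33 (x y : mA3) : mA3 :=
  MA3 (ms3 x) (mt3 y) (mx_zip (op2_33 C) (mx3 x) (mx3 y)).

Definition mzero3 (a b : mA2) : mA3 :=
  MA3 a b (mx_zip (@zero3 K C) (mx2 a) (mx2 b)).
Definition madd3 (x y : mA3) : mA3 :=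
  MA3 (ms3 x) (mt3 x) (mx_zip (@add3 K C) (mx3 x) (mx3 y)).
Definition mscale3 (c : K) (x : mA3) : mA3 :=
  MA3 (ms3 x) (mt3 x) (mx_omap (scale3 c) (mx3 x)).

Definition mx_cat3 : cat3 K :=
  {| A1 := mA1; A2 := mA2; A3 := mA3;
     in1 := min1; in2 := min2; in3 := min3;
     s2 := ms2; t2 := mt2; s3 := ms3; t3 := mt3;
     one1 := mone1; one2 := mone2; one3 := mone3;
     op0_11 := mop0_11; op0_12 := mop0_12; op0_21 := mop0_21;
     op0_13 := mop0_13; op0_31 := mop0_31;
     op1_22 := mop1_22; op1_33 := mop1_33; op2_33 := mop2_33;
     zero3 := mzero3; add3 := madd3; scale3 := mscale3 |}.

End MatrixCat3.

(* ------------------------------------------------------------------------ *)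
(* The induced action, for representatives s_1, ..., s_m of the left cosets.  *)

Definition left_coset_reps (gT : finGroupType) (G H : {group gT}) (m : nat)
    (s : 'I_m -> gT) : Prop :=
  injective (fun i => s i *: H)%g /\
  [set s i *: H | i : 'I_m]%g = lcosets H G.

Section Induced.

Variables (K : fieldType) (gT : finGroupType) (H : {group gT}) (C : cat3 K).
Variables (X : rep3 gT C) (m : nat) (s : 'I_m -> gT).
Local Open Scope group_scope.

(* g s_i = s_j h with h := shift g j i, and h \in H for one j only.           *)
Definition shift (g : gT) (j i : 'I_m) : gT := (s j)^-1 * (g * s i).

Definition ind_rho (g : gT) : A1 (mx_cat3 C m) :=
  \matrix_(j, i) if shift g j i \in H then Some (rho X (shift g j i)) else None.

Definition ind_phi (g2 g1 : gT) : A2 (mx_cat3 C m) :=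
  @MA2 K C m (ind_rho g2 #0 ind_rho g1) (ind_rho (g2 * g1))
    (\matrix_(k, i)
       if [pick j | (shift g1 j i \in H) && (shift g2 k j \in H)] is Some j
       then Some (phi X (shift g2 k j) (shift g1 j i)) else None).

Definition ind_Phi (g3 g2 g1 : gT) : A3 (mx_cat3 C m) :=
  @MA3 K C m
    ((ind_rho g3 #0 ind_phi g2 g1) #1 ind_phi g3 (g2 * g1))
    ((ind_phi g3 g2 #0 ind_rho g1) #1 ind_phi (g3 * g2) g1)
    (\matrix_(l, i)
       if [pick jk : 'I_m * 'I_m | [&& shift g1 jk.1 i \in H,
             shift g2 jk.2 jk.1 \in H & shift g3 l jk.2 \in H]] is Some jk
       then Some (Phi X (shift g3 l jk.2) (shift g2 jk.2 jk.1)
                        (shift g1 jk.1 i))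
       else None).

Definition ind_rep3 : rep3 gT (mx_cat3 C m) := Rep3 ind_rho ind_phi ind_Phi.

End Induced.

(* Main.v *)
From HB Require Import structures.
Require Import Defs.
From mathcomp Require Import all_boot all_order all_algebra all_fingroup.
From mathcomp Require Import boolp.

Set Implicit Arguments.
Unset Strict Implicit.
Unset Printing Implicit Defensive.

Import GRing.Theory.
Local Open Scope ring_scope.

(** The group [G] permutes the cosets of [H]: [g r_i = r_(g i) sh g i] with a cocycle [sh] valued in
    [H]. A 2-arrow from 1 to the induced rho_f lives only on the diagonal entries i fixed by f, so
    the 2-categorical trace of the induced action at f is the product, over these i, of the traces
    of rho at [f ^ r i], and psi_g permutes the components. A natural transformation id -> psi_g
    vanishes at every i moved by g. At an i fixed by g its i-th entry depends on the i-th component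
    alone and is a local transformation. Hence the categorical trace of psi_g is the direct sum of
    the local ones over the i fixed by f and g ([ind_coords]). The map induced by k carries the
    summand of i to that of k i ([trace_map_ind]), so its matrix is a block permutation matrix, and
    its trace is the sum, over the i fixed by f, g and k, of the local 3-characters at
    [(f, g, k) ^ r i] ([ind_character3]). The local 3-character is invariant under simultaneous
    conjugation in [H] ([character3_conj]), so every such i accounts for |H| equal terms in the sum
    over s in r_i H ([sum_left_cosets]), and |H| is invertible in characteristic 0.

    Invariance under conjugation rests on transport. For h in [H], psi_h carries the trace at x to
    the trace at h x h^-1, and [Psi] is the resulting map on natural transformations. These maps
    compose ([Psi_comp]) and are trivial for h = 1 ([Psi_1]). The map of k is the case in which h =
    k fixes x, so the maps of k and of h k h^-1 are conjugate and have the same trace.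

    All this needs the associativity of Gamma, also when psi_g changes the trace on which it acts
    ([Gamma_assoc]). The 2-arrows into the various rho_e form a monoidal category without unit,
    [Smon], whose pentagon is the 3-cocycle condition. Conjugation by the identities of rho_h and
    rho_(h^-1) carries canonical maps [Ghat] from conjugating twice to conjugating once, with Lambda
    as 3-arrow. The object psi_g(w) is the conjugate of w divided by the conjugate of the unit
    object, and Gamma is the quotient of [Ghat] at w by [Ghat] at the unit object ([Gamma_DD]).
    Quotients compose and are unique ([DD_comp], [DD_uniq]). By coherence the two paths out of a
    triple conjugation agree up to maps that act on the outer factors only, and such maps have
    identity quotients ([DD_shift]). *)

(** * Strict laws for transformations and modifications *)

Section StarLaws.

Variables (K : fieldType) (V : lin2cat K).
Implicit Types (F G : fun2 V) (a b c : trans2 V) (x y z : modif V).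

Lemma hcomp_vcompl (u v : cell2 V) f : tgt2 u = src2 v ->
  tgt1 (src2 u) = src1 f ->
  hcomp (vcomp u v) (id2 f) = vcomp (hcomp u (id2 f)) (hcomp v (id2 f)).
Proof.
move=> uv uf; rewrite hv_interchange ?src2_id ?tgt2_id //.
by rewrite -{2}(src2_id f) vcomp_idl.
Qed.

Lemma hcomp_vcompr (u v : cell2 V) f : tgt2 u = src2 v ->
  tgt1 f = src1 (src2 u) ->
  hcomp (id2 f) (vcomp u v) = vcomp (hcomp (id2 f) u) (hcomp (id2 f) v).
Proof.
move=> uv uf; rewrite hv_interchange ?src2_id ?tgt2_id //.
by rewrite -{2}(src2_id f) vcomp_idl.
Qed.

Lemma trans2_ext a b : tsrc a = tsrc b -> ttgt a = ttgt b ->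
  tob a =1 tob b -> tar a =1 tar b -> a = b.
Proof.
by case: a b => [s t o r] [s' t' o' r'] /= -> -> /funext -> /funext ->.
Qed.

Lemma modif_ext x y : msrc x = msrc y -> mtgt x = mtgt y ->
  mob x =1 mob y -> x = y.
Proof. by case: x y => [s t o] [s' t' o'] /= -> -> /funext ->. Qed.

(** Compositions are total functions, so each strict law carries composability conditions; these are
    solved by pushing sources and targets through all operations. *)
Local Ltac cells := solve [ repeat first
  [ done
  | match goal with
    | |- context [src2 (id2 ?f)] => rewrite (src2_id f)
    | |- context [tgt2 (id2 ?f)] => rewrite (tgt2_id f)
    | |- context [src1 (id1 ?f)] => rewrite (src1_id f)
    | |- context [tgt1 (id1 ?f)] => rewrite (tgt1_id f)
    | |- context [src1 (comp1 ?f ?g)] => rewrite (@src1_comp _ _ f g); [|cells]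
    | |- context [tgt1 (comp1 ?f ?g)] => rewrite (@tgt1_comp _ _ f g); [|cells]
    | |- context [src2 (vcomp ?f ?g)] => rewrite (@src2_vcomp _ _ f g); [|cells]
    | |- context [tgt2 (vcomp ?f ?g)] => rewrite (@tgt2_vcomp _ _ f g); [|cells]
    | |- context [src2 (hcomp ?f ?g)] => rewrite (@src2_hcomp _ _ f g); [|cells]
    | |- context [tgt2 (hcomp ?f ?g)] => rewrite (@tgt2_hcomp _ _ f g); [|cells]
    | H : is_fun2 ?F |- context [src1 (far ?F _)] => rewrite (far_src H)
    | H : is_fun2 ?F |- context [tgt1 (far ?F _)] => rewrite (far_tgt H)
    | H : is_fun2 ?F |- context [src2 (fcell ?F _)] => rewrite (fcell_src H)
    | H : is_fun2 ?F |- context [tgt2 (fcell ?F _)] => rewrite (fcell_tgt H)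
    | H : is_pseudonat ?a |- context [src1 (far (tsrc ?a) _)] =>
        rewrite (far_src (tsrc_fun2 H))
    | H : is_pseudonat ?a |- context [src1 (far (ttgt ?a) _)] =>
        rewrite (far_src (ttgt_fun2 H))
    | H : is_pseudonat ?a |- context [tgt1 (far (tsrc ?a) _)] =>
        rewrite (far_tgt (tsrc_fun2 H))
    | H : is_pseudonat ?a |- context [tgt1 (far (ttgt ?a) _)] =>
        rewrite (far_tgt (ttgt_fun2 H))
    | H : is_pseudonat ?a |- context [src1 (tob ?a _)] => rewrite (tob_src H)
    | H : is_pseudonat ?a |- context [tgt1 (tob ?a _)] => rewrite (tob_tgt H)
    | H : is_pseudonat ?a |- context [src2 (tar ?a _)] => rewrite (tar_src H)
    | H : is_pseudonat ?a |- context [tgt2 (tar ?a _)] => rewrite (tar_tgt H)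
    | H : is_modif ?x |- context [src2 (mob ?x _)] => rewrite (mob_src H)
    | H : is_modif ?x |- context [tgt2 (mob ?x _)] => rewrite (mob_tgt H)
    | H : is_modif ?x |- context [tsrc (mtgt ?x)] => rewrite -(modif_tsrc H)
    | H : is_modif ?x |- context [ttgt (mtgt ?x)] => rewrite -(modif_ttgt H)
    | H : ttgt ?a = _ |- context [ttgt ?a] => rewrite H
    | H : mtgt ?a = _ |- context [mtgt ?a] => rewrite H
    | |- context [comp1 ?f (comp1 ?g ?h)] => rewrite (@comp1A _ _ f g h); [|cells|cells]
    end ] ].

Lemma compTA a b c : is_pseudonat a -> is_pseudonat b -> is_pseudonat c ->
  ttgt a = tsrc b -> ttgt b = tsrc c ->
  compT a (compT b c) = compT (compT a b) c.
Proof.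
move=> Ha Hb Hc ab bc; apply: trans2_ext => //= [t|f].
  rewrite comp1A //; cells.
rewrite -!hcomp_id2; [|cells..].
rewrite hcomp_vcompl; [|cells..].
rewrite hcomp_vcompr; [|cells..].
by rewrite !hcompA ?vcompA //; cells.
Qed.

Lemma compT_idl a : is_pseudonat a -> compT (idT (tsrc a)) a = a.
Proof.
move=> Ha; apply: trans2_ext => //= [t|f].
  by rewrite -(tob_src Ha) comp1_idl.
rewrite hcomp_id2; [|cells].
have -> : fob (tsrc a) (src1 f) = src1 (src2 (tar a f)) by cells.
by rewrite hcomp_idl -(tar_src Ha) vcomp_idl.
Qed.

Lemma compT_idr a : is_pseudonat a -> compT a (idT (ttgt a)) = a.
Proof.
move=> Ha; apply: trans2_ext => //= [t|f].
  by rewrite -(tob_tgt Ha) comp1_idr.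
rewrite hcomp_id2; [|cells].
have -> : fob (ttgt a) (tgt1 f) = tgt1 (src2 (tar a f)) by cells.
by rewrite hcomp_idr -(tar_tgt Ha) vcomp_idr.
Qed.

Lemma whiskFT_comp F a b : is_fun2 F -> is_pseudonat a -> is_pseudonat b ->
  ttgt a = tsrc b -> whiskFT F (compT a b) = compT (whiskFT F a) (whiskFT F b).
Proof.
move=> HF Ha Hb ab; apply: trans2_ext => //= [t|f].
  by rewrite far_comp //; cells.
by rewrite fcell_vcomp ?fcell_hcomp ?fcell_id //; cells.
Qed.

Lemma whiskFT_id F G : is_fun2 F -> whiskFT F (idT G) = idT (compF F G).
Proof.
move=> HF; apply: trans2_ext => //= [t|f]; first by rewrite far_id.
by rewrite fcell_id.
Qed.

Lemma whiskTF_comp F a b : is_fun2 F ->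
  whiskTF (compT a b) F = compT (whiskTF a F) (whiskTF b F).
Proof. by move=> HF; apply: trans2_ext => //= f; rewrite far_src ?far_tgt. Qed.

Lemma compF_idl F : compF (idF V) F = F. Proof. by case: F. Qed.
Lemma compF_idr F : compF F (idF V) = F. Proof. by case: F. Qed.

Lemma whiskFT_idF a : whiskFT (idF V) a = a.
Proof. by apply: trans2_ext; rewrite //= compF_idl. Qed.
Lemma whiskTF_idF a : whiskTF a (idF V) = a.
Proof. by apply: trans2_ext; rewrite //= compF_idr. Qed.

Lemma hcompMA x y z : is_modif x -> is_modif y -> is_modif z ->
  ttgt (msrc x) = tsrc (msrc y) -> ttgt (msrc y) = tsrc (msrc z) ->
  hcompM x (hcompM y z) = hcompM (hcompM x y) z.
Proof.
move=> Hx Hy Hz xy yz.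
have Px := msrc_pseudonat Hx; have Py := msrc_pseudonat Hy.
have Pz := msrc_pseudonat Hz.
have Qx := mtgt_pseudonat Hx; have Qy := mtgt_pseudonat Hy.
have Qz := mtgt_pseudonat Hz.
have E t : tgt1 (src2 (mob x t)) = src1 (src2 (mob y t)) by cells.
have E' t : tgt1 (src2 (mob y t)) = src1 (src2 (mob z t)) by cells.
apply: modif_ext => /= [||t]; last by rewrite hcompA.
  by rewrite compTA.
by rewrite compTA //; cells.
Qed.

Lemma hcompM_id a b : is_pseudonat a -> is_pseudonat b -> ttgt a = tsrc b ->
  hcompM (idM a) (idM b) = idM (compT a b).
Proof.
by move=> Ha Hb ab; apply: modif_ext => //= t; rewrite hcomp_id2 //; cells.
Qed.

Lemma hcompM_idl x : is_modif x -> hcompM (idM (idT (tsrc (msrc x)))) x = x.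
Proof.
move=> Hx; have Px := msrc_pseudonat Hx; have Qx := mtgt_pseudonat Hx.
apply: modif_ext => /= [||t]; first by rewrite compT_idl.
  by rewrite (modif_tsrc Hx) compT_idl.
have -> : fob (tsrc (msrc x)) t = src1 (src2 (mob x t)) by cells.
by rewrite hcomp_idl.
Qed.

Lemma hcompM_idr x : is_modif x -> hcompM x (idM (idT (ttgt (msrc x)))) = x.
Proof.
move=> Hx; have Px := msrc_pseudonat Hx; have Qx := mtgt_pseudonat Hx.
apply: modif_ext => /= [||t]; first by rewrite compT_idr.
  by rewrite (modif_ttgt Hx) compT_idr.
have -> : fob (ttgt (msrc x)) t = tgt1 (src2 (mob x t)) by cells.
by rewrite hcomp_idr.
Qed.

Lemma vcompMA x y z : is_modif x -> is_modif y -> is_modif z ->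
  mtgt x = msrc y -> mtgt y = msrc z ->
  vcompM x (vcompM y z) = vcompM (vcompM x y) z.
Proof.
move=> Hx Hy Hz xy yz; apply: modif_ext => //= t.
by rewrite vcompA //; cells.
Qed.

Lemma vcompM_idl x : is_modif x -> vcompM (idM (msrc x)) x = x.
Proof.
by move=> Hx; apply: modif_ext => //= t; rewrite -mob_src // vcomp_idl.
Qed.

Lemma vcompM_idr x : is_modif x -> vcompM x (idM (mtgt x)) = x.
Proof.
by move=> Hx; apply: modif_ext => //= t; rewrite -mob_tgt // vcomp_idr.
Qed.

(** The exchange between #1 and #2 is that of the 2-cells of [V], applied at each object. *)
Lemma exchangeM x x' y y' : is_modif x -> is_modif x' -> is_modif y ->
  is_modif y' -> mtgt x = msrc x' -> mtgt y = msrc y' ->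
  ttgt (msrc x) = tsrc (msrc y) ->
  vcompM (hcompM x y) (hcompM x' y') = hcompM (vcompM x x') (vcompM y y').
Proof.
move=> Hx Hx' Hy Hy' xx' yy' xy.
have Px := msrc_pseudonat Hx; have Py := msrc_pseudonat Hy.
apply: modif_ext => //= t; rewrite hv_interchange //; cells.
Qed.

Lemma whiskFM_hcomp F x y : is_fun2 F -> is_modif x -> is_modif y ->
  ttgt (msrc x) = tsrc (msrc y) ->
  whiskFM F (hcompM x y) = hcompM (whiskFM F x) (whiskFM F y).
Proof.
move=> HF Hx Hy xy.
have Px := msrc_pseudonat Hx; have Py := msrc_pseudonat Hy.
have Qx := mtgt_pseudonat Hx; have Qy := mtgt_pseudonat Hy.
apply: modif_ext => /= [||t]; rewrite ?whiskFT_comp //; first by cells.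
by rewrite fcell_hcomp //; cells.
Qed.

Lemma whiskFM_vcomp F x y : is_fun2 F -> is_modif x -> is_modif y ->
  mtgt x = msrc y ->
  whiskFM F (vcompM x y) = vcompM (whiskFM F x) (whiskFM F y).
Proof.
move=> HF Hx Hy xy; apply: modif_ext => //= t; rewrite fcell_vcomp //; cells.
Qed.

Lemma whiskFM_id F a : is_fun2 F -> whiskFM F (idM a) = idM (whiskFT F a).
Proof. by move=> HF; apply: modif_ext => //= t; rewrite fcell_id. Qed.

Lemma whiskMF_hcomp F x y : is_fun2 F ->
  whiskMF (hcompM x y) F = hcompM (whiskMF x F) (whiskMF y F).
Proof. by move=> HF; apply: modif_ext => //=; rewrite whiskTF_comp. Qed.

Lemma whiskFM_idF x : whiskFM (idF V) x = x.
Proof. by apply: modif_ext; rewrite //= whiskFT_idF. Qed.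
Lemma whiskMF_idF x : whiskMF x (idF V) = x.
Proof. by apply: modif_ext; rewrite //= whiskTF_idF. Qed.

Lemma hcompM_addl x x' y : is_modif x -> is_modif x' -> is_modif y ->
  msrc x = msrc x' -> mtgt x = mtgt x' -> ttgt (msrc x) = tsrc (msrc y) ->
  hcompM (addM x x') y = addM (hcompM x y) (hcompM x' y).
Proof.
move=> Hx Hx' Hy sx tx xy.
have Px := msrc_pseudonat Hx; have Py := msrc_pseudonat Hy.
apply: modif_ext => //= t; rewrite hcompDl //; try cells.
all: try by rewrite (mob_src Hx) (mob_src Hx') sx.
all: try by rewrite (mob_tgt Hx) (mob_tgt Hx') tx.
Qed.

Lemma hcompM_addr x y y' : is_modif x -> is_modif y -> is_modif y' ->
  msrc y = msrc y' -> mtgt y = mtgt y' -> ttgt (msrc x) = tsrc (msrc y) ->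
  hcompM x (addM y y') = addM (hcompM x y) (hcompM x y').
Proof.
move=> Hx Hy Hy' sy ty xy.
have Px := msrc_pseudonat Hx; have Py := msrc_pseudonat Hy.
apply: modif_ext => //= t; rewrite hcompDr //; try cells.
all: try by rewrite (mob_src Hy) (mob_src Hy') sy.
all: try by rewrite (mob_tgt Hy) (mob_tgt Hy') ty.
Qed.

Lemma hcompM_scalel e x y : is_modif x -> is_modif y ->
  ttgt (msrc x) = tsrc (msrc y) ->
  hcompM (scaleM e x) y = scaleM e (hcompM x y).
Proof.
move=> Hx Hy xy; have Px := msrc_pseudonat Hx; have Py := msrc_pseudonat Hy.
by apply: modif_ext => //= t; rewrite hcompZl //; cells.
Qed.

Lemma hcompM_scaler e x y : is_modif x -> is_modif y ->
  ttgt (msrc x) = tsrc (msrc y) ->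
  hcompM x (scaleM e y) = scaleM e (hcompM x y).
Proof.
move=> Hx Hy xy; have Px := msrc_pseudonat Hx; have Py := msrc_pseudonat Hy.
by apply: modif_ext => //= t; rewrite hcompZr //; cells.
Qed.

Lemma vcompM_addl x x' y : is_modif x -> is_modif x' -> is_modif y ->
  msrc x = msrc x' -> mtgt x = mtgt x' -> mtgt x = msrc y ->
  vcompM (addM x x') y = addM (vcompM x y) (vcompM x' y).
Proof.
move=> Hx Hx' Hy sx tx xy; apply: modif_ext => //= t; rewrite vcompDl //.
- by rewrite (mob_src Hx) (mob_src Hx') sx.
- by rewrite (mob_tgt Hx) (mob_tgt Hx') tx.
- by rewrite (mob_tgt Hx) (mob_src Hy) xy.
Qed.

Lemma vcompM_addr x y y' : is_modif x -> is_modif y -> is_modif y' ->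
  msrc y = msrc y' -> mtgt y = mtgt y' -> mtgt x = msrc y ->
  vcompM x (addM y y') = addM (vcompM x y) (vcompM x y').
Proof.
move=> Hx Hy Hy' sy ty xy; apply: modif_ext => //= t; rewrite vcompDr //.
- by rewrite (mob_src Hy) (mob_src Hy') sy.
- by rewrite (mob_tgt Hy) (mob_tgt Hy') ty.
- by rewrite (mob_tgt Hx) (mob_src Hy) xy.
Qed.

Lemma vcompM_scalel e x y : is_modif x -> is_modif y -> mtgt x = msrc y ->
  vcompM (scaleM e x) y = scaleM e (vcompM x y).
Proof.
move=> Hx Hy xy; apply: modif_ext => //= t; rewrite vcompZl //.
by rewrite (mob_tgt Hx) (mob_src Hy) xy.
Qed.

Lemma vcompM_scaler e x y : is_modif x -> is_modif y -> mtgt x = msrc y ->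
  vcompM x (scaleM e y) = scaleM e (vcompM x y).
Proof.
move=> Hx Hy xy; apply: modif_ext => //= t; rewrite vcompZr //.
by rewrite (mob_tgt Hx) (mob_src Hy) xy.
Qed.

Lemma whiskFM_add F x y : is_fun2 F -> is_modif x -> is_modif y ->
  msrc x = msrc y -> mtgt x = mtgt y ->
  whiskFM F (addM x y) = addM (whiskFM F x) (whiskFM F y).
Proof.
move=> HF Hx Hy sxy txy; apply: modif_ext => //= t; rewrite fcell_add //.
- by rewrite (mob_src Hx) (mob_src Hy) sxy.
- by rewrite (mob_tgt Hx) (mob_tgt Hy) txy.
Qed.

Lemma whiskFM_scale F e x : is_fun2 F ->
  whiskFM F (scaleM e x) = scaleM e (whiskFM F x).
Proof. by move=> HF; apply: modif_ext => //= t; rewrite fcell_scale. Qed.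

Lemma cell2_linear (f g : cell1 V) : src1 f = src1 g -> tgt1 f = tgt1 g ->
  [/\ forall u, src2 u = f -> tgt2 u = g -> scale2 0 u = zero2 f g,
      add2 (zero2 f g) (zero2 f g) = zero2 f g
    & forall e, scale2 e (zero2 f g) = zero2 f g].
Proof.
move=> /cell2_lmod/[apply]; case=> E [i [_ iP <- iD iZ]]; split.
- by move=> u su tu; have /iP [v <-] : src2 u = f /\ tgt2 u = g by []; rewrite -iZ scale0r.
- by rewrite -iD addr0.
- by move=> e; rewrite -iZ scaler0.
Qed.

Section Zero.
Variables a b : trans2 V.
Hypotheses (Ha : is_pseudonat a) (Hb : is_pseudonat b).
Hypotheses (sab : tsrc a = tsrc b) (tab : ttgt a = ttgt b).

Let par t : src1 (tob a t) = src1 (tob b t) /\ tgt1 (tob a t) = tgt1 (tob b t).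
Proof. by rewrite !tob_src // !tob_tgt // sab tab. Qed.

(** Exhibits the zero modification as a multiple of any parallel one, so that its behaviour under
    composition and under psi_g follows later from linearity. *)
Lemma scaleM0 x : is_modif x -> msrc x = a -> mtgt x = b ->
  scaleM 0 x = zeroM a b.
Proof.
move=> Hx sx tx; apply: modif_ext => //= t.
have [s1 t1] := par t; have [E _ _] := cell2_linear s1 t1.
by apply: E; rewrite ?mob_src ?mob_tgt ?sx ?tx.
Qed.

Lemma addM00 : addM (zeroM a b) (zeroM a b) = zeroM a b.
Proof.
apply: modif_ext => //= t.
by have [s1 t1] := par t; have [_ E _] := cell2_linear s1 t1.
Qed.

Lemma scaleMr0 e : scaleM e (zeroM a b) = zeroM a b.
Proof.
apply: modif_ext => //= t.
by have [s1 t1] := par t; have [_ _ E] := cell2_linear s1 t1.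
Qed.
End Zero.

End StarLaws.
(** A monoidal category without unit: associator and pentagon carry the whole coherence of iterated
    conjugation. Typing morphisms by their ends frees that argument from composability
    conditions. *)
Record semigroupal := Semigroupal {
  sob : Type;
  shom : sob -> sob -> Type;
  sid : forall A, shom A A;
  scomp : forall A B C, shom A B -> shom B C -> shom A C;
  sten : sob -> sob -> sob;
  stenh : forall A A' B B', shom A A' -> shom B B' ->
    shom (sten A B) (sten A' B');
  sass : forall A B C, shom (sten A (sten B C)) (sten (sten A B) C);
  sassV : forall A B C, shom (sten (sten A B) C) (sten A (sten B C));
  scompA : forall A B C D (f : shom A B) (g : shom B C) (h : shom C D),
    scomp f (scomp g h) = scomp (scomp f g) h;
  scomp_idl : forall A B (f : shom A B), scomp (sid A) f = f;
  scomp_idr : forall A B (f : shom A B), scomp f (sid B) = f;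
  stenh_id : forall A B, stenh (sid A) (sid B) = sid (sten A B);
  stenh_comp : forall A A' A'' B B' B'' (f : shom A A') (f' : shom A' A'')
    (g : shom B B') (g' : shom B' B''),
    scomp (stenh f g) (stenh f' g') = stenh (scomp f f') (scomp g g');
  sassK : forall A B C, scomp (sass A B C) (sassV A B C) = sid _;
  sassVK : forall A B C, scomp (sassV A B C) (sass A B C) = sid _;
  sass_nat : forall A A' B B' C C' (f : shom A A') (g : shom B B')
    (h : shom C C'),
    scomp (stenh f (stenh g h)) (sass A' B' C') =
    scomp (sass A B C) (stenh (stenh f g) h);
  spentagon : forall A B C D,
    scomp (stenh (sid A) (sass B C D))
      (scomp (sass A (sten B C) D) (stenh (sass A B C) (sid D))) =
    scomp (sass A B (sten C D)) (sass (sten A B) C D)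
}.

(** * Coherence of iterated conjugation *)

Section Conjugation.

Variable M : semigroupal.

Local Notation "f ;; g" := (scomp f g) (at level 55, right associativity).
Local Notation "A (x) B" := (sten A B) (at level 40, left associativity).
Local Notation "f [x] g" := (stenh f g) (at level 40, left associativity).
Local Notation "f \x A" := (stenh f (sid A)) (at level 40, left associativity).
Local Notation "A x\ f" := (stenh (sid A) f) (at level 40, left associativity).

Lemma stenhl_comp (A B C D : sob M) (f : shom A B) (g : shom B C) :
  (f ;; g) \x D = (f \x D) ;; (g \x D).
Proof. by rewrite stenh_comp scomp_idl. Qed.

Lemma stenhr_comp (A B C D : sob M) (f : shom A B) (g : shom B C) :
  D x\ (f ;; g) = (D x\ f) ;; (D x\ g).
Proof. by rewrite stenh_comp scomp_idl. Qed.

Lemma sassV_nat (A A' B B' C C' : sob M) (f : shom A A') (g : shom B B')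
    (h : shom C C') :
  ((f [x] g) [x] h) ;; sassV A' B' C' = sassV A B C ;; (f [x] (g [x] h)).
Proof.
rewrite -[RHS]scomp_idr -(sassK A' B' C') scompA -(scompA _ _ (sass _ _ _)).
by rewrite sass_nat scompA sassVK scomp_idl.
Qed.

Definition conj_ob (A A' Y : sob M) : sob M := (A (x) Y) (x) A'.

Definition conj_hom (A B A' B' Y Z : sob M) (f : shom A B) (f' : shom A' B')
  (y : shom Y Z) : shom (conj_ob A A' Y) (conj_ob B B' Z) := (f [x] y) [x] f'.

(** Reassociates A (B Y B') A' into (A B) Y (B' A'). When the outer factors are identities of the
    rho_h, its three steps become the three factors of Lambda. *)
Definition conj_mul (A B A' B' Y : sob M) :
  shom (conj_ob A A' (conj_ob B B' Y)) (conj_ob (A (x) B) (B' (x) A') Y) :=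
  (sass A (B (x) Y) B' \x A') ;; ((sass A B Y \x B') \x A') ;;
  sassV ((A (x) B) (x) Y) B' A'.

Lemma conj_mul_nat (A A1 B B1 A' A1' B' B1' Y Z : sob M)
    (f : shom A A1) (g : shom B B1) (f' : shom A' A1') (g' : shom B' B1')
    (y : shom Y Z) :
  conj_hom f f' (conj_hom g g' y) ;; conj_mul A1 B1 A1' B1' Z =
  conj_mul A B A' B' Y ;; conj_hom (f [x] g) (g' [x] f') y.
Proof.
have split P Q R S T (u : shom P Q) (v : shom Q R) (w : @shom M S T) :
    (u ;; v) [x] w = (u \x _) ;; (v [x] w).
  by rewrite stenh_comp scomp_idl.
rewrite /conj_mul /conj_hom /conj_ob -!scompA.
rewrite (scompA (_ [x] f')) (stenh_comp _ (sass _ _ _) f') scomp_idr sass_nat.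
rewrite split -scompA (scompA (_ [x] f')) (stenh_comp _ (_ \x B1') f') scomp_idr.
rewrite (stenh_comp _ (sass _ _ _) g') scomp_idr sass_nat.
by rewrite !split -!scompA sassV_nat.
Qed.

Lemma spentagonV (A B C D : sob M) :
  sassV (A (x) B) C D ;; sassV A B (C (x) D) =
  (sassV A B C \x D) ;; sassV A (B (x) C) D ;; (A x\ sassV B C D).
Proof.
have E := spentagon A B C D.
(* Both sides invert the same path P of associators: l followed by P and P followed by r are
   identities, so l = r. *)
set l := LHS; set r := RHS.
have El : l ;; (sass A B (C (x) D) ;; sass (A (x) B) C D) = sid _.
  by rewrite /l -scompA (scompA (sassV A B _)) sassVK scomp_idl sassVK.
have Er : (sass A B (C (x) D) ;; sass (A (x) B) C D) ;; r = sid _.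
  rewrite -E /r -!scompA (scompA (_ \x D)) -stenhl_comp sassK stenh_id scomp_idl.
  by rewrite (scompA (sass A _ _)) sassK scomp_idl -stenhr_comp sassK stenh_id.
by rewrite -[l]scomp_idr -Er scompA El scomp_idl.
Qed.

Section Assoc.

Variables (A B C A' B' C' Y : sob M).
Let U := (B (x) C) (x) Y.
Let Z := ((A (x) B) (x) C) (x) Y.

(** The part of the coherence that concerns the left factors: naturality of the associator and two
    pentagons. *)
Lemma conj_mulA1 :
  sass A B (conj_ob C C' Y) ;; sass (A (x) B) (C (x) Y) C' ;;
    (sass (A (x) B) C Y \x C') =
  (A x\ sass B (C (x) Y) C') ;; (A x\ (sass B C Y \x C')) ;; sass A U C' ;;
    (sass A (B (x) C) Y \x C') ;; ((sass A B C \x Y) \x C').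
Proof.
rewrite (scompA (A x\ (_ \x C'))) sass_nat -scompA.
rewrite -!stenhl_comp spentagon stenhl_comp.
by rewrite !scompA -(scompA (A x\ _)) spentagon.
Qed.

Lemma conj_mulA2 :
  sass A (B (x) conj_ob C C' Y) B' ;; (sass A B (conj_ob C C' Y) \x B') ;;
    (sass (A (x) B) (C (x) Y) C' \x B') ;; ((sass (A (x) B) C Y \x C') \x B') ;;
    sassV Z C' B' =
  (A x\ (sass B (C (x) Y) C' \x B')) ;; (A x\ ((sass B C Y \x C') \x B')) ;;
    (A x\ sassV U C' B') ;; sass A U (C' (x) B') ;;
    (sass A (B (x) C) Y \x (C' (x) B')) ;;
    ((sass A B C \x Y) \x (C' (x) B')).
Proof.
have -> : (A x\ sassV U C' B') ;; sass A U (C' (x) B') ;;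
    (sass A (B (x) C) Y \x (C' (x) B')) ;;
    ((sass A B C \x Y) \x (C' (x) B')) =
  sass A (U (x) C') B' ;; ((sass A U C' ;; (sass A (B (x) C) Y \x C') ;;
    ((sass A B C \x Y) \x C')) \x B') ;; sassV Z C' B'.
  have E : (A x\ sassV U C' B') ;; sass A U (C' (x) B') =
    sass A (U (x) C') B' ;; (sass A U C' \x B') ;; sassV (A (x) U) C' B'.
    rewrite -[LHS]scomp_idr -(sassK _ C' B') -scompA.
    rewrite [in LHS](scompA (sass A U _)) -spentagon.
    by rewrite !scompA -stenhr_comp sassVK stenh_id scomp_idl.
  rewrite scompA E -!scompA -stenhl_comp -(stenh_id C' B'); congr (_ ;; _).
  rewrite -sassV_nat scompA -stenhl_comp.
  by rewrite -stenhl_comp.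
rewrite [RHS]scompA -stenhr_comp -[in RHS]stenhl_comp [RHS]scompA sass_nat.
rewrite -[RHS]scompA; congr (_ ;; _).
rewrite !scompA; congr (_ ;; _); rewrite -!stenhl_comp; congr (_ \x B').
by rewrite -!scompA conj_mulA1 stenhr_comp -!scompA.
Qed.

(** The two ways to unfold a triple conjugation differ by the associator of the left outer factors
    and the inverse associator of the right ones. The left side is [conj_mulA2], the right side the
    inverted pentagon [spentagonV]. *)
Lemma conj_mulA :
  conj_mul A B A' B' (conj_ob C C' Y) ;;
    conj_mul (A (x) B) C (B' (x) A') C' Y =
  conj_hom (sid A) (sid A') (conj_mul B C B' C' Y) ;;
    conj_mul A (B (x) C) A' (C' (x) B') Y ;;
    conj_hom (sass A B C) (sassV C' B' A') (sid Y).
Proof.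
have nat P Q R S (u : @shom M P Q) :
    sassV P R S ;; (u \x (R (x) S)) = ((u \x R) \x S) ;; sassV Q R S.
  by rewrite -stenh_id -sassV_nat.
rewrite /conj_mul /conj_hom /conj_ob -!scompA.
rewrite (scompA (sassV _ B' A')) nat -scompA (scompA (sassV _ B' A')) nat.
rewrite -scompA spentagonV.
have -> : (sass A B C \x Y) [x] sassV C' B' A' =
    ((sass A B C \x Y) \x _) ;; (_ x\ sassV C' B' A').
  by rewrite stenh_comp scomp_idl scomp_idr.
rewrite (scompA (sassV _ (C' (x) B') A')) nat -!scompA.
have /(congr1 (fun u => (u \x A') ;; sassV Z (C' (x) B') A' ;;
  (Z x\ sassV C' B' A'))) := conj_mulA2.
by rewrite !stenhr_comp !stenhl_comp -!scompA.
Qed.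

(** The common beginning of both paths out of a triple conjugation; by [conj_pathl] and [conj_pathr]
    what remains acts on the outer factors alone. *)
Definition conj_mul3 :=
  conj_hom (sid A) (sid A') (conj_mul B C B' C' Y) ;;
    conj_mul A (B (x) C) A' (C' (x) B') Y.

Lemma conj_hom_comp (P Q R P' Q' R' S : sob M) (p : shom P Q) (q : shom Q R)
    (p' : shom P' Q') (q' : shom Q' R') :
  conj_hom p p' (sid S) ;; conj_hom q q' (sid S) =
  conj_hom (p ;; q) (p' ;; q') (sid S).
Proof. by rewrite /conj_hom !stenh_comp scomp_idl. Qed.

Lemma conj_hom_compr (P P' R S T : sob M) (p : shom R S) (q : shom S T) :
  conj_hom (sid P) (sid P') p ;; conj_hom (sid P) (sid P') q =
  conj_hom (sid P) (sid P') (p ;; q).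
Proof. by rewrite /conj_hom !stenh_comp !scomp_idl. Qed.

Lemma conj_pathl (D D' E E' : sob M) (p : shom (B (x) C) D)
    (p' : shom (C' (x) B') D') (q : shom (A (x) D) E) (q' : shom (D' (x) A') E') :
  conj_hom (sid A) (sid A') (conj_mul B C B' C' Y ;; conj_hom p p' (sid Y)) ;;
    (conj_mul A D A' D' Y ;; conj_hom q q' (sid Y)) =
  conj_mul3 ;;
    conj_hom ((sid A [x] p) ;; q) ((p' [x] sid A') ;; q') (sid Y).
Proof.
rewrite -conj_hom_compr -conj_hom_comp /conj_mul3.
have := conj_mul_nat (sid A) p (sid A') p' (sid Y).
move: (conj_mul B C B' C' Y) (conj_mul A D A' D' Y) => m1 m2.
move: (conj_mul A (B (x) C) A' (C' (x) B') Y) => m3 nat.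
by rewrite -!scompA (scompA _ m2) nat -!scompA.
Qed.

Lemma conj_pathr (D D' E E' : sob M) (p : shom (A (x) B) D)
    (p' : shom (B' (x) A') D') (q : shom (D (x) C) E) (q' : shom (C' (x) D') E') :
  (conj_mul A B A' B' (conj_ob C C' Y) ;; conj_hom p p' (sid _)) ;;
    (conj_mul D C D' C' Y ;; conj_hom q q' (sid Y)) =
  conj_mul3 ;;
    conj_hom (sass A B C ;; (p [x] sid C) ;; q)
      (sassV C' B' A' ;; (sid C' [x] p') ;; q') (sid Y).
Proof.
have -> : sid (conj_ob C C' Y) = conj_hom (sid C) (sid C') (sid Y).
  by rewrite /conj_hom !stenh_id.
rewrite -!conj_hom_comp /conj_mul3.
have := conj_mul_nat p (sid C) p' (sid C') (sid Y); have := conj_mulA.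
move: (conj_mul B C B' C' Y) (conj_mul A (B (x) C) A' (C' (x) B') Y) => m1 m2.
move: (conj_mul (A (x) B) C (B' (x) A') C' Y) (conj_mul D C D' C' Y) => m3 m4.
move: (conj_mul A B A' B' (conj_ob C C' Y)) => m5 assoc nat.
by rewrite -scompA (scompA _ m4) nat !scompA assoc -!scompA.
Qed.

End Assoc.

Lemma conj_mul_natr (A B A' B' D D' Y Z : sob M) (p : shom (A (x) B) D)
    (p' : shom (B' (x) A') D') (y : shom Y Z) :
  conj_hom (sid A) (sid A') (conj_hom (sid B) (sid B') y) ;;
    (conj_mul A B A' B' Z ;; conj_hom p p' (sid Z)) =
  (conj_mul A B A' B' Y ;; conj_hom p p' (sid Y)) ;;
    conj_hom (sid D) (sid D') y.
Proof.
have := conj_mul_nat (sid A) (sid B) (sid A') (sid B') y.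
move: (conj_mul A B A' B' Y) (conj_mul A B A' B' Z) => m1 m2 nat.
rewrite scompA nat -!scompA; congr (_ ;; _).
by rewrite /conj_hom !stenh_comp !stenh_id !scomp_idl !scomp_idr.
Qed.

End Conjugation.

(** * The graded monoidal category of 2-arrows into the rho_e *)

Section Monoidal.

Variables (K : fieldType) (gT : finGroupType) (V : lin2cat K) (W : sub3 V).
Hypothesis hW : strict_sub3 W.
Variable X : rep3 gT (cat3_of W).
Hypothesis hX : is_rep3 X [set: gT].
Implicit Types (F G : fun2 V) (a b c : trans2 V) (x y z : modif V).

Local Open Scope group_scope.

Local Notation "a ** b" := (compT a b) (at level 50, left associativity).
Local Notation "x *** y" := (hcompM x y) (at level 50, left associativity).
Local Notation "x ;; y" := (vcompM x y) (at level 55, right associativity).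
Local Notation "F |> a" := (whiskFT F a) (at level 40).
Local Notation "a |< F" := (whiskTF a F) (at level 40).
Local Notation "F ||> x" := (whiskFM F x) (at level 40).
Local Notation "x ||< F" := (whiskMF x F) (at level 40).

Definition ro (h : gT) : fun2 V := rho X h.
Definition ph (h g : gT) : trans2 V := phi X h g.
Definition Ph (h g k : gT) : modif V := Phi X h g k.

Lemma roW h : W1 W (ro h).
Proof. by apply: (rho_in1 hX); rewrite inE. Qed.

Lemma phW h g : W2 W (ph h g).
Proof.
by case: (phi_iso2 hX (in_setT h) (in_setT g)) => -[].
Qed.

Lemma phs h g : tsrc (ph h g) = compF (ro h) (ro g).
Proof. by case: (phi_iso2 hX (in_setT h) (in_setT g)) => -[]. Qed.

Lemma pht h g : ttgt (ph h g) = ro (h * g).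
Proof. by case: (phi_iso2 hX (in_setT h) (in_setT g)) => -[]. Qed.

Lemma PhW h g k : W3 W (Ph h g k).
Proof. by case: (Phi_iso3 hX (in_setT h) (in_setT g) (in_setT k)) => -[]. Qed.

Lemma Phs h g k : msrc (Ph h g k) = (ro h |> ph g k) ** ph h (g * k).
Proof. by case: (Phi_iso3 hX (in_setT h) (in_setT g) (in_setT k)) => -[]. Qed.

Lemma Pht h g k : mtgt (Ph h g k) = (ph h g |< ro k) ** ph (h * g) k.
Proof. by case: (Phi_iso3 hX (in_setT h) (in_setT g) (in_setT k)) => -[]. Qed.

Definition iPh h g k : modif V := inv3 (Phi X h g k).

Lemma iPhP h g k : inverse3 (C := cat3_of W) (Ph h g k) (iPh h g k).
Proof.
rewrite /iPh /inv3 /choose_or; case: pselect => [e|[]]; first by case: cid.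
by case: (Phi_iso3 hX (in_setT h) (in_setT g) (in_setT k)).
Qed.

Lemma iPhW h g k : W3 W (iPh h g k).
Proof. by case: (iPhP h g k) => -[]. Qed.
Lemma iPhs h g k : msrc (iPh h g k) = (ph h g |< ro k) ** ph (h * g) k.
Proof. by case: (iPhP h g k) => -[_ + _] _ _; rewrite -Pht. Qed.
Lemma iPht h g k : mtgt (iPh h g k) = (ro h |> ph g k) ** ph h (g * k).
Proof. by case: (iPhP h g k) => -[_ _ +] _ _; rewrite -Phs. Qed.
Lemma Ph_iPh h g k : Ph h g k ;; iPh h g k = idM (msrc (Ph h g k)).
Proof. by case: (iPhP h g k). Qed.
Lemma iPh_Ph h g k : iPh h g k ;; Ph h g k = idM (mtgt (Ph h g k)).
Proof. by case: (iPhP h g k). Qed.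

Lemma ro1 : ro 1 = idF V. Proof. exact: (rho_1 hX). Qed.
Lemma ph1l g : ph 1 g = idT (ro g).
Proof. by apply: (phi_1l hX); rewrite inE. Qed.
Lemma ph1r g : ph g 1 = idT (ro g).
Proof. by apply: (phi_1r hX); rewrite inE. Qed.

Definition bnd := (phs, pht, iPhs, iPht, Phs, Pht).

(** The source is left free and the grade e is recorded, so that the identity of rho_h and the
    objects 1 => rho_f of the 2-categorical traces lie in one category. *)
Record mobj := MObj {
  me : gT; mw :> trans2 V; mwW : W2 W mw; mwt : ttgt mw = ro me }.

(** A square filled by a 3-arrow, as in a lax slice: [ma] moves the source functor, and [mx]
    compares A with [ma] followed by B. Morphisms preserve the grade. *)
Record mhom (A B : mobj) := MHom {
  ma : trans2 V; mx : modif V;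
  mhe : me A = me B; maW : W2 W ma;
  mas : tsrc ma = tsrc A; mat : ttgt ma = tsrc B;
  mxW : W3 W mx; mxs : msrc mx = A; mxt : mtgt mx = ma ** B }.

Lemma mhom_ext A B (f g : mhom A B) : ma f = ma g -> mx f = mx g -> f = g.
Proof.
case: f g => [a x p1 p2 p3 p4 p5 p6 p7] [a' x' q1 q2 q3 q4 q5 q6 q7] /= ea ex.
by subst; f_equal; exact: Prop_irrelevance.
Qed.

(** [simpbd], [bd] and [mem] discharge the typing conditions of the strict laws: boundaries are
    computed, and membership in [W] is derived from its closure properties. *)
Ltac simpbd := repeat (progress (cbn [tsrc ttgt msrc mtgt compT whiskFT whiskTF idT idM
    hcompM vcompM whiskFM whiskMF mw me];
  repeat match goal with
  | |- context [tsrc (ph _ _)] => rewrite phs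
  | |- context [ttgt (ph _ _)] => rewrite pht
  | |- context [msrc (Ph _ _ _)] => rewrite Phs
  | |- context [mtgt (Ph _ _ _)] => rewrite Pht
  | |- context [msrc (iPh _ _ _)] => rewrite iPhs
  | |- context [mtgt (iPh _ _ _)] => rewrite iPht
  | |- context [ttgt (mw ?A)] => rewrite (mwt A)
  | |- context [tsrc (ma ?f)] => rewrite (mas f)
  | |- context [ttgt (ma ?f)] => rewrite (mat f)
  | |- context [msrc (mx ?f)] => rewrite (mxs f)
  | |- context [mtgt (mx ?f)] => rewrite (mxt f)
  | H : me ?A = _ |- context [me ?A] => rewrite H
  | f : mhom ?A ?B |- context [me ?A] => rewrite (mhe f)
  | |- context [ro 1] => rewrite ro1
  | |- context [compF (idF _) _] => rewrite compF_idl
  | |- context [compF _ (idF _)] => rewrite compF_idr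
  | H : ttgt ?a = _ |- context [ttgt ?a] => rewrite H
  | H : tsrc ?a = _ |- context [tsrc ?a] => rewrite H
  | H : msrc ?a = _ |- context [msrc ?a] => rewrite H
  | H : mtgt ?a = _ |- context [mtgt ?a] => rewrite H
  end)).

Ltac bd := solve [reflexivity | assumption | simpbd; reflexivity
  | simpbd; rewrite ?mulgA; reflexivity].

Ltac mem := lazymatch goal with
  | |- W3 _ (hcompM _ _) => apply: (W_op1_33 hW); [mem|mem|bd]
  | |- W3 _ (vcompM _ _) => apply: (W_op2_33 hW); [mem|mem|bd]
  | |- W3 _ (whiskFM _ _) => apply: (W_op0_13 hW); [mem|mem]
  | |- W3 _ (whiskMF _ _) => apply: (W_op0_31 hW); [mem|mem]
  | |- W3 _ (idM _) => apply: (W_one3 hW); mem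
  | |- W3 _ (Ph _ _ _) => apply: PhW
  | |- W3 _ (iPh _ _ _) => apply: iPhW
  | |- W3 _ (mx ?f) => apply: (mxW f)
  | |- W2 _ (ma ?f) => apply: (maW f)
  | |- W2 _ (compT _ _) => apply: (W_op1_22 hW); [mem|mem|bd]
  | |- W2 _ (whiskFT _ _) => apply: (W_op0_12 hW); [mem|mem]
  | |- W2 _ (whiskTF _ _) => apply: (W_op0_21 hW); [mem|mem]
  | |- W2 _ (idT _) => apply: (W_one2 hW); mem
  | |- W2 _ (ph _ _) => apply: phW
  | |- W2 _ (mw ?A) => apply: (mwW A)
  | |- W1 _ (compF _ _) => apply: (W_op0_11 hW); mem
  | |- W1 _ (ro _) => apply: roW
  | |- W1 _ (idF _) => apply: (W_one1 hW)
  | |- _ => first [ assumption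
     | lazymatch goal with
       | |- W2 _ (msrc _) => apply: (W3_src hW); mem
       | |- W2 _ (mtgt _) => apply: (W3_tgt hW); mem
       | |- W1 _ (tsrc _) => apply: (W2_src hW); mem
       | |- W1 _ (ttgt _) => apply: (W2_tgt hW); mem
       | |- is_fun2 _ => apply: (W1_fun2 hW); mem
       | |- is_pseudonat _ => apply: (W2_pseudonat hW); mem
       | |- is_modif _ => apply: (W3_modif hW); mem
       end ] end.

Ltac ty := lazymatch goal with |- _ = _ => bd | _ => mem end.

Section Rew.
Variables (F G F' G' : fun2 V) (a b c : trans2 V) (x y z x' y' : modif V).
Hypotheses (WF : W1 W F) (WG : W1 W G).
Hypotheses (Wa : W2 W a) (Wb : W2 W b) (Wc : W2 W c).
Hypotheses (Wx : W3 W x) (Wy : W3 W y) (Wz : W3 W z).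
Hypotheses (Wx' : W3 W x') (Wy' : W3 W y').

Lemma cA : ttgt a = tsrc b -> ttgt b = tsrc c -> a ** (b ** c) = a ** b ** c.
Proof. by apply: compTA; mem. Qed.
Lemma wlc : ttgt a = tsrc b -> F |> (a ** b) = (F |> a) ** (F |> b).
Proof. by apply: whiskFT_comp; mem. Qed.
Lemma wrc : (a ** b) |< F = (a |< F) ** (b |< F).
Proof. by apply: whiskTF_comp; mem. Qed.
Lemma c1 : tsrc a = F -> idT F ** a = a.
Proof. by move=> <-; apply: compT_idl; mem. Qed.
Lemma c2 : ttgt a = F -> a ** idT F = a.
Proof. by move=> <-; apply: compT_idr; mem. Qed.
Lemma wli : F |> idT G = idT (compF F G).
Proof. by apply: whiskFT_id; mem. Qed.
Lemma hA : ttgt (msrc x) = tsrc (msrc y) -> ttgt (msrc y) = tsrc (msrc z) ->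
  x *** (y *** z) = x *** y *** z.
Proof. by apply: hcompMA; mem. Qed.
Lemma hi : ttgt a = tsrc b -> idM a *** idM b = idM (a ** b).
Proof. by apply: hcompM_id; mem. Qed.
Lemma h1 : tsrc (msrc x) = F -> idM (idT F) *** x = x.
Proof. by move=> <-; apply: hcompM_idl; mem. Qed.
Lemma h2 : ttgt (msrc x) = F -> x *** idM (idT F) = x.
Proof. by move=> <-; apply: hcompM_idr; mem. Qed.
Lemma vA : mtgt x = msrc y -> mtgt y = msrc z ->
  x ;; (y ;; z) = (x ;; y) ;; z.
Proof. by apply: vcompMA; mem. Qed.
Lemma v1 : msrc x = a -> idM a ;; x = x.
Proof. by move=> <-; apply: vcompM_idl; mem. Qed.
Lemma v2 : mtgt x = a -> x ;; idM a = x.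
Proof. by move=> <-; apply: vcompM_idr; mem. Qed.
Lemma exch : mtgt x = msrc x' -> mtgt y = msrc y' ->
  ttgt (msrc x) = tsrc (msrc y) ->
  (x *** y) ;; (x' *** y') = (x ;; x') *** (y ;; y').
Proof. by apply: exchangeM; mem. Qed.
Lemma wlh : ttgt (msrc x) = tsrc (msrc y) ->
  F ||> (x *** y) = (F ||> x) *** (F ||> y).
Proof. by apply: whiskFM_hcomp; mem. Qed.
Lemma wlv : mtgt x = msrc y -> F ||> (x ;; y) = (F ||> x) ;; (F ||> y).
Proof. by apply: whiskFM_vcomp; mem. Qed.
Lemma wlI : F ||> idM a = idM (F |> a).
Proof. by apply: whiskFM_id; mem. Qed.
Lemma wrh : (x *** y) ||< F = (x ||< F) *** (y ||< F).
Proof. by apply: whiskMF_hcomp; mem. Qed.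

(** Interchange along #0, the strictness required of [W]. The four functors are named explicitly to
    direct the rewriting. *)
Lemma slide : tsrc a = F -> ttgt a = F' -> tsrc b = G -> ttgt b = G' ->
  (a |< G) ** (F' |> b) = (F |> b) ** (a |< G').
Proof. by move=> <- <- <- <-; rewrite (W_interchange22 hW). Qed.
Lemma slidel : tsrc (msrc x) = F -> ttgt (msrc x) = F' ->
  tsrc b = G -> ttgt b = G' ->
  (x ||< G) *** idM (F' |> b) = idM (F |> b) *** (x ||< G').
Proof. by move=> <- <- <- <-; rewrite (W_interchange32 hW). Qed.
Lemma slider : tsrc a = F -> ttgt a = F' ->
  tsrc (msrc y) = G -> ttgt (msrc y) = G' ->
  idM (a |< G) *** (F' ||> y) = (F ||> y) *** idM (a |< G').
Proof. by move=> <- <- <- <-; rewrite (W_interchange23 hW). Qed.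
End Rew.

Ltac bd ::= solve [reflexivity | assumption | simpbd; reflexivity
  | simpbd; rewrite ?mulgA; reflexivity
  | simpbd;
    repeat first [ rewrite wlc; [|ty..] | rewrite wrc; [|mem..]
      | rewrite c1; [|ty..] | rewrite c2; [|ty..] | rewrite cA; [|ty..] ];
    simpbd; rewrite ?mulgA; reflexivity ].
Ltac tyn := ty.

Lemma hiMF a F : idM a ||< F = idM (a |< F). Proof. by []. Qed.

Lemma hlv a x y : W2 W a -> W3 W x -> W3 W y -> mtgt x = msrc y ->
  ttgt a = tsrc (msrc x) ->
  idM a *** (x ;; y) = (idM a *** x) ;; (idM a *** y).
Proof. by move=> *; rewrite exch ?v1 //; ty. Qed.

Lemma hrv a x y : W2 W a -> W3 W x -> W3 W y -> mtgt x = msrc y ->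
  ttgt (msrc x) = tsrc a ->
  (x ;; y) *** idM a = (x *** idM a) ;; (y *** idM a).
Proof. by move=> *; rewrite exch ?v1 //; ty. Qed.


Lemma mid_t (A : mobj) : mtgt (idM A) = idT (tsrc A) ** A.
Proof. rewrite c1 //; ty. Qed.
Definition mid (A : mobj) : mhom A A.
apply: (@MHom A A (idT (tsrc A)) (idM A)); first [exact: (mid_t A) | ty].
Defined.

Lemma mcomp_t A B C (f : mhom A B) (g : mhom B C) :
  mtgt (mx f ;; (idM (ma f) *** mx g)) = (ma f ** ma g) ** C.
Proof. by simpbd; rewrite cA; ty. Qed.
Definition mcomp A B C (f : mhom A B) (g : mhom B C) : mhom A C.
apply: (@MHom A C (ma f ** ma g) (mx f ;; (idM (ma f) *** mx g)));
  first [exact: mcomp_t | ty].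
Defined.


Lemma mcompA A B C D (f : mhom A B) (g : mhom B C) (h : mhom C D) :
  mcomp f (mcomp g h) = mcomp (mcomp f g) h.
Proof.
apply: mhom_ext => /=; first by rewrite cA; ty.
rewrite hlv; [|ty..]; rewrite hA; [|ty..].
rewrite -hi; [|ty..]; rewrite vA //; try ty.
Qed.

Lemma mid_l A B (f : mhom A B) : mcomp (mid A) f = f.
Proof.
apply: mhom_ext => /=; first by rewrite c1 //; ty.
by rewrite h1 ?v1 //; ty.
Qed.
Lemma mid_r A B (f : mhom A B) : mcomp f (mid B) = f.
Proof.
apply: mhom_ext => /=; first by rewrite c2 //; ty.
by rewrite hi ?v2 //; ty.
Qed.

Lemma mten_in (A B : mobj) :
  W2 W ((A |< tsrc B) ** (ro (me A) |> B) ** ph (me A) (me B)).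
Proof. ty. Qed.
Lemma mten_tgt (A B : mobj) :
  ttgt ((A |< tsrc B) ** (ro (me A) |> B) ** ph (me A) (me B)) =
  ro (me A * me B).
Proof. ty. Qed.
(** The composite of A and B along #0, spelled by whiskerings with A first, followed by the phi that
    multiplies the grades. *)
Definition mten (A B : mobj) : mobj := MObj (mten_in A B) (mten_tgt A B).


Lemma mtenh_t A A' B B' (f : mhom A A') (g : mhom B B') :
  mtgt ((mx f ||< tsrc B) *** (ro (me A) ||> mx g) *** idM (ph (me A) (me B)))
  = ((ma f |< tsrc B) ** (tsrc A' |> ma g)) ** mten A' B'.
Proof.
simpbd; rewrite wrc ?wlc; [|ty..]; rewrite !cA; [|ty..].
rewrite -(cA (a := ma f |< _)); [|ty..].
rewrite (slide (F := tsrc A') (G' := tsrc B')); [|ty..].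
by rewrite !cA; ty.
Qed.

Definition mtenh A A' B B' (f : mhom A A') (g : mhom B B') :
  mhom (mten A B) (mten A' B').
apply: (@MHom _ _ ((ma f |< tsrc B) ** (tsrc A' |> ma g))
  ((mx f ||< tsrc B) *** (ro (me A) ||> mx g) *** idM (ph (me A) (me B))));
  first [exact: mtenh_t | ty | idtac].
- by rewrite /= (mhe f) (mhe g).
- by rewrite /= !mxs.
Defined.

Lemma mtenh_id A B : mtenh (mid A) (mid B) = mid (mten A B).
Proof.
apply: mhom_ext => /=; first by rewrite wli ?c1 //; ty.
rewrite hiMF wlI ?hi //; ty.
Qed.

(** The 3-arrow of f' has to pass the 2-arrow of g, which is the interchange [slidel]. *)
Lemma mtenh_comp A A' A'' B B' B'' (f : mhom A A') (f' : mhom A' A'')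
    (g : mhom B B') (g' : mhom B' B'') :
  mcomp (mtenh f g) (mtenh f' g') = mtenh (mcomp f f') (mcomp g g').
Proof.
apply: mhom_ext => /=.
  rewrite wrc ?wlc; [|ty..]; rewrite !cA; [|ty..].
  rewrite -(cA (a := ma f |< _) (b := ma f' |< _)); [|ty..].
  rewrite (slide (a := ma f') (F := tsrc A') (G' := tsrc B')); [|ty..].
  by rewrite !cA; ty.
rewrite -!hi; [|ty..].
rewrite !hA; [|ty..].
rewrite -(hA (x := idM (ma f |< _)) (z := mx f' ||< _)); [|ty..].
rewrite -(slidel (x := mx f') (F := tsrc A') (G := tsrc B) (F' := ro (me A''))); [|ty..].
rewrite (mhe f) (mhe f') (mhe g) (mhe g').
rewrite hA; [|ty..].
have -> : (mx f ;; idM (ma f) *** mx f') ||< tsrc B =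
  (mx f ||< tsrc B) ;; (idM (ma f |< tsrc B) *** (mx f' ||< tsrc B)).
  by rewrite -hiMF -wrh; ty.
rewrite wlv; [|ty..]; rewrite wlh; [|ty..].
rewrite -(hA (y := idM _) (z := ro _ ||> _)); [|ty..].
rewrite exch; [|tyn..].
rewrite exch; [|tyn..].
by rewrite v1 ?wlI; ty.
Qed.

Implicit Types A B C D : mobj.

(** The factors of a triple product that precede every phi. What follows them is the source
    ([mten_r]) or the target ([mten_l]) of Phi, so Phi whiskered by them is the associator. *)
Definition alQ A B C : trans2 V :=
  (A |< tsrc (mten B C)) ** (ro (me A) |> (B |< tsrc C))
  ** (compF (ro (me A)) (ro (me B)) |> C).

Lemma mten_r A B C :
  mten A (mten B C) = alQ A B C
   ** ((ro (me A) |> ph (me B) (me C)) ** ph (me A) (me B * me C)) :> trans2 V.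
Proof. by rewrite /alQ /= !wlc; [|ty..]; rewrite !cA; ty. Qed.

Lemma mten_l A B C :
  mten (mten A B) C = alQ A B C
   ** ((ph (me A) (me B) |< ro (me C)) ** ph (me A * me B) (me C)) :> trans2 V.
Proof.
rewrite /alQ /= !wrc; [|ty..]; rewrite !cA; [|ty..].
rewrite -(cA (a := _ ** _) (b := ph _ _ |< _) (c := _ |> _)); [|ty..].
rewrite (slide (F := compF (ro (me A)) (ro (me B))) (G' := ro (me C))); [|ty..].
by rewrite !cA; ty.
Qed.

Lemma alph_s A B C : msrc (idM (alQ A B C) *** Ph (me A) (me B) (me C)) =
  mten A (mten B C).
Proof. by rewrite mten_r; simpbd. Qed.
Lemma alph_t A B C : mtgt (idM (alQ A B C) *** Ph (me A) (me B) (me C)) =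
  idT (tsrc (mten A (mten B C))) ** mten (mten A B) C.
Proof. by rewrite c1; [|ty..]; rewrite mten_l; simpbd. Qed.

Definition alph A B C : mhom (mten A (mten B C)) (mten (mten A B) C).
apply: (@MHom _ _ (idT (tsrc (mten A (mten B C))))
 (idM (alQ A B C) *** Ph (me A) (me B) (me C)));
 rewrite ?alph_s ?alph_t //; rewrite /alQ; try ty.
by rewrite /= mulgA.
Defined.

Lemma ialph_s A B C : msrc (idM (alQ A B C) *** iPh (me A) (me B) (me C)) =
  mten (mten A B) C.
Proof. by rewrite mten_l; simpbd. Qed.
Lemma ialph_t A B C : mtgt (idM (alQ A B C) *** iPh (me A) (me B) (me C)) =
  idT (tsrc (mten A (mten B C))) ** mten A (mten B C).
Proof. by rewrite c1; [|ty..]; rewrite mten_r; simpbd. Qed.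

Definition ialph A B C : mhom (mten (mten A B) C) (mten A (mten B C)).
apply: (@MHom _ _ (idT (tsrc (mten A (mten B C))))
 (idM (alQ A B C) *** iPh (me A) (me B) (me C)));
 rewrite ?ialph_s ?ialph_t //; rewrite /alQ; try ty.
by rewrite /= mulgA.
Defined.


Lemma mulgAE (a b c d : gT) : [/\ a * (b * c) = a * b * c,
  a * (b * (c * d)) = a * b * c * d, a * (b * c * d) = a * b * c * d,
  a * (b * c) * d = a * b * c * d & a * b * (c * d) = a * b * c * d].
Proof. by rewrite !mulgA. Qed.

Lemma alph_i A B C : mcomp (alph A B C) (ialph A B C) = mid _.
Proof.
apply: mhom_ext; cbn [ma mx alph ialph mcomp mid]; first by rewrite c1; ty.
rewrite h1; [|rewrite /alQ; ty..].
rewrite -hlv; [|rewrite /alQ; ty..].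
rewrite Ph_iPh hi; [|rewrite /alQ; ty..].
by rewrite mten_r Phs.
Qed.

Lemma alph_i' A B C : mcomp (ialph A B C) (alph A B C) = mid _.
Proof.
apply: mhom_ext; cbn [ma mx alph ialph mcomp mid]; first by rewrite c1; ty.
rewrite h1; [|rewrite /alQ; ty..].
rewrite -hlv; [|rewrite /alQ; ty..].
rewrite iPh_Ph hi; [|rewrite /alQ; ty..].
by rewrite mten_l Pht.
Qed.

Section AlphNat.
Variables (A A' B B' C C' : mobj).
Variables (f : mhom A A') (g : mhom B B') (h : mhom C C').

Let T := (mx f ||< tsrc (mten B C)) *** (ro (me A) ||> (mx g ||< tsrc C))
   *** (compF (ro (me A)) (ro (me B)) ||> mx h).

Lemma mtenh_r : mx (mtenh f (mtenh g h)) =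
  T *** idM (msrc (Ph (me A) (me B) (me C))).
Proof.
rewrite /T /= Phs !wlh; [|ty..]; rewrite wlI; [|ty..].
by rewrite -hi; [|ty..]; rewrite !hA; ty.
Qed.

Lemma mtenh_l : mx (mtenh (mtenh f g) h) =
  T *** idM (mtgt (Ph (me A) (me B) (me C))).
Proof.
rewrite /T /= !wrh; [|ty..]; rewrite Pht hiMF.
rewrite -[in RHS]hi; [|ty..]; rewrite !hA; [|ty..].
rewrite -(hA (y := idM _) (z := _ ||> mx h)); [|ty..].
rewrite (slider (F := compF (ro (me A)) (ro (me B))) (G' := ro (me C)) (F' := ro (me A * me B)) (G := tsrc C)); [|ty..].
by rewrite hA; ty.
Qed.

Lemma alph_nat_t : mtgt T = ma (mtenh f (mtenh g h)) ** alQ A' B' C'.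
Proof.
rewrite /T /alQ /= !mxt !wrc; [|ty..]; rewrite !wlc; [|ty..]; rewrite !cA; [|ty..].
rewrite (mhe f) (mhe g).
rewrite -(cA (a := ma f |< _) (b := A' |< _) (c := _ |> (ma g |< _))); [|ty..].
rewrite (slide (a := A') (F := tsrc A') (G' := compF (tsrc B') (tsrc C))); [|ty..].
rewrite cA; [|ty..].
rewrite -(cA (a := _ ** _) (b := _ |> (mw B' |< _)) (c := _ |> ma h)); [|ty..].
rewrite -[compF (ro (me A')) (ro (me B')) |> ma h]/(ro (me A') |> (ro (me B') |> ma h)).
rewrite -wlc; [|ty..].
rewrite (slide (a := B') (F := tsrc B') (G' := tsrc C')); [|ty..].
rewrite wlc; [|ty..]; rewrite cA; [|ty..].
rewrite -(cA (a := _ ** _) (b := mw A' |< _) (c := _ |> _)); [|ty..].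
rewrite (slide (a := A') (F := tsrc A') (G' := compF (tsrc B') (tsrc C'))); [|ty..].
by rewrite !cA; ty.
Qed.

Lemma alph_nat :
  mcomp (mtenh f (mtenh g h)) (alph A' B' C') =
  mcomp (alph A B C) (mtenh (mtenh f g) h).
Proof.
apply: mhom_ext; cbn [ma mx alph mcomp].
  rewrite c1; [|ty..]; rewrite c2; [|ty..].
  by rewrite /= wrc ?wlc; [|ty..]; rewrite cA; ty.
rewrite mtenh_r mtenh_l.
rewrite h1 /T; [|ty..].
rewrite (@exch (idM _)); [|rewrite /alQ; ty..|rewrite /alQ; tyn].
rewrite v1; [|rewrite /alQ; ty..].
rewrite v2; [|rewrite /alQ; ty..].
rewrite -/T.
rewrite (hA (x := idM (ma _))); [|rewrite /alQ; ty..].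
rewrite hi; [|rewrite /alQ; ty..].
rewrite -alph_nat_t.
rewrite -(mhe f) -(mhe g) -(mhe h) exch; [|rewrite /T; ty..].
by rewrite v1 ?v2 // /T; ty.
Qed.
End AlphNat.


Lemma Ph_cocycle (a b c d : gT) :
  ((ro a ||> Ph b c d) *** idM (ph a (b * c * d)) ;;
   (ro a ||> idM (ph b c) ||< ro d) *** Ph a (b * c) d) ;;
  ((Ph a b c ||< ro d) *** idM (ph (a * b * c) d)) =
  (idM (compF (ro a) (ro b) |> ph c d) *** Ph a b (c * d)) ;;
  (idM (ph a b |< compF (ro c) (ro d)) *** Ph (a * b) c d).
Proof.
rewrite wlI ?hiMF; [|ty..].
exact: (Phi_cocycle hX (in_setT a) (in_setT b) (in_setT c) (in_setT d)).
Qed.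

Section Pentagon.
Variables A B C D : mobj.

Let Q := (A |< tsrc (mten B (mten C D))) ** (ro (me A) |> (B |< tsrc (mten C D)))
  ** (compF (ro (me A)) (ro (me B)) |> (C |< tsrc D))
  ** (compF (ro (me A)) (compF (ro (me B)) (ro (me C))) |> D).

Lemma pent1 : mx (mtenh (mid A) (alph B C D)) = idM Q ***
  ((ro (me A) ||> Ph (me B) (me C) (me D)) *** idM (ph (me A) (me B * me C * me D))).
Proof.
rewrite /Q /= wlh ?hiMF ?wlI /alQ; [|ty..].
rewrite !wlc; [|ty..]; rewrite -!hi; [|ty..].
by rewrite !hA ?mulgA; ty.
Qed.

Lemma pent2 : mx (alph A (mten B C) D) = idM Q ***
  ((ro (me A) ||> idM (ph (me B) (me C)) ||< ro (me D)) *** Ph (me A) (me B * me C) (me D)).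
Proof.
rewrite /Q /= wlI ?hiMF /alQ /=; [|ty..].
rewrite !wrc; [|ty..]; rewrite !wlc; [|ty..]; rewrite !cA; [|ty..].
rewrite -(cA (a := _ ** _) (b := _ |> (ph _ _ |< _)) (c := _ |> D)); [|ty..].
rewrite -[compF (ro (me A)) (ro (me B * me C)) |> D]/(ro (me A) |> (ro (me B * me C) |> D)).
rewrite -wlc; [|ty..].
rewrite (slide (a := ph _ _) (F := compF (ro (me B)) (ro (me C))) (G' := ro (me D))); [|ty..].
rewrite wlc; [|ty..]; rewrite cA; [|ty..].
by rewrite -!hi; [|ty..]; rewrite !hA; ty.
Qed.

Lemma pent3 : mx (mtenh (alph A B C) (mid D)) = idM Q ***
  ((Ph (me A) (me B) (me C) ||< ro (me D)) *** idM (ph (me A * me B * me C) (me D))).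
Proof.
rewrite /Q /= wrh ?wlI ?hiMF /alQ /=; [|ty..].
rewrite !wrc; [|ty..].
rewrite -!hi; [|ty..]; rewrite !mulgA.
rewrite -(hA (z := idM (_ |> D))); [|ty..].
rewrite (slidel (F := compF (ro (me A)) (compF (ro (me B)) (ro (me C))))
  (G' := ro (me D))); [|ty..].
by rewrite !hA; ty.
Qed.

Lemma pent4 : mx (alph A B (mten C D)) = idM Q ***
  (idM (compF (ro (me A)) (ro (me B)) |> ph (me C) (me D)) ***
   Ph (me A) (me B) (me C * me D)).
Proof.
rewrite /Q /= /alQ /= !wlc; [|ty..].
by rewrite -!hi; [|ty..]; rewrite !hA; ty.
Qed.

Lemma pent5 : mx (alph (mten A B) C D) = idM Q ***
  (idM (ph (me A) (me B) |< compF (ro (me C)) (ro (me D))) ***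
   Ph (me A * me B) (me C) (me D)).
Proof.
rewrite /Q /= /alQ /= !wrc; [|ty..].
rewrite -(cA (b := ph _ _ |< _) (c := ro _ |> _)); [|ty..].
rewrite (slide (a := ph _ _) (F := compF (ro (me A)) (ro (me B)))
  (G' := compF (ro (me C)) (tsrc D))); [|ty..].
rewrite cA; [|ty..].
rewrite -(cA (b := ph _ _ |< _) (c := _ |> D)); [|ty..].
rewrite -[compF (ro (me A * me B)) (ro (me C)) |> D]/(ro (me A * me B) |> (ro (me C) |> D)).
rewrite (slide (a := ph _ _) (F := compF (ro (me A)) (ro (me B)))
  (G' := compF (ro (me C)) (ro (me D)))); [|ty..].
rewrite cA; [|ty..].
by rewrite -!hi; [|ty..]; rewrite !hA; ty.
Qed.

(** Each of the five edges is an edge of the 3-cocycle condition whiskered by the same Q ([pent1] to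
    [pent5]), so the pentagon is that condition. *)
Lemma pentagon :
  mcomp (mtenh (mid A) (alph B C D))
    (mcomp (alph A (mten B C) D) (mtenh (alph A B C) (mid D))) =
  mcomp (alph A B (mten C D)) (alph (mten A B) C D).
Proof.
apply: mhom_ext.
  cbn [ma mcomp mtenh alph mid].
  rewrite !wli; [|ty..]; rewrite !c1 //; ty.
rewrite /mcomp; cbn [mx].
rewrite !(h1 (x := mx _)); [|ty..].
rewrite pent1 pent2 pent3 pent4 pent5.
have -> : ma (mtenh (mid A) (alph B C D)) =
    idT (tsrc (mten A (mten B (mten C D)))).
  by cbn [ma mtenh alph mid]; rewrite !wli ?c1 //; ty.
rewrite h1; [|rewrite /Q; ty..].
rewrite vA; [|rewrite /Q; tyn..].
rewrite -hlv; [|rewrite /Q; ty..].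
rewrite -hlv; [|rewrite /Q; ty..].
rewrite Ph_cocycle hlv //; rewrite /Q; try ty.
simpbd; rewrite !cA; [|ty..].
by rewrite (slide (F := compF (ro (me A)) (ro (me B)))
  (G' := ro (me C * me D))); ty.
Qed.
End Pentagon.

Definition Smon : semigroupal :=
  Semigroupal mcompA mid_l mid_r mtenh_id mtenh_comp alph_i alph_i'
    alph_nat pentagon.

(** * Conjugation objects and inverses *)

Definition eobj h : mobj := @MObj h (idT (ro h)) (W_one2 hW (roW h)) erefl.

Lemma iobj_t : ttgt (idT (idF V)) = ro 1. Proof. by rewrite ro1. Qed.
Definition iobj : mobj := MObj (W_one2 hW (W_one1 hW)) iobj_t.

Definition cob h (Y : mobj) : mobj := mten (mten (eobj h) Y) (eobj h^-1).
Definition chom h Y Z (y : mhom Y Z) : mhom (cob h Y) (cob h Z) :=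
  mtenh (mtenh (mid (eobj h)) y) (mid (eobj h^-1)).

Lemma cobE h Y : cob h Y = (ro h |> Y |< ro h^-1) **
  (ph h (me Y) |< ro h^-1) ** ph (h * me Y) h^-1 :> trans2 V.
Proof.
rewrite /cob /=.
rewrite -[idT (ro h) |< tsrc Y]/(idT (compF (ro h) (tsrc Y))).
rewrite wli; [|ty..]; rewrite c1; [|ty..]; rewrite c2; [|ty..].
by rewrite wrc; ty.
Qed.

Lemma chom_ma h Y Z (y : mhom Y Z) : ma (chom h y) = ro h |> ma y |< ro h^-1.
Proof.
rewrite /chom /=.
rewrite -[idT (ro h) |< tsrc Y]/(idT (compF (ro h) (tsrc Y))).
by rewrite wli; [|ty..]; rewrite c1; [|ty..]; rewrite c2; ty.
Qed.

Lemma chom_mx h Y Z (y : mhom Y Z) :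
  mx (chom h y) = (ro h ||> mx y ||< ro h^-1) ***
  idM (ph h (me Y) |< ro h^-1) *** idM (ph (h * me Y) h^-1).
Proof.
rewrite /chom /= !wlI ?wli; [|ty..].
rewrite h2; [|ty..].
rewrite hiMF.
rewrite -[idT (ro h) |< tsrc Y]/(idT (compF (ro h) (tsrc Y))).
rewrite h1; [|ty..].
by rewrite wrh; ty.
Qed.

Definition inverse a b := inverse2 (C := cat3_of W) a b.
Definition inv a : trans2 V := inv2 (C := cat3_of W) a.

(** Frees [inv2] from its choice: any inverse that can be exhibited is the chosen one ([invE]). *)
Lemma inverse_uniq a b b' : W2 W a -> inverse a b -> inverse a b' -> b = b'.
Proof.
move=> Wa [[/= Wb sb tb] ab ba] [[/= Wb' sb' tb'] ab' ba'].
have E : b ** (a ** b') = (b ** a) ** b' by rewrite cA; ty.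
move: E; rewrite [a ** b']ab' [b ** a]ba /=.
by rewrite c1 // c2.
Qed.

Lemma invE a b : W2 W a -> inverse a b -> inv a = b.
Proof.
move=> Wa Hb; rewrite /inv /inv2 /choose_or.
case: pselect => [e|[]]; last by exists b.
by case: cid => b' /= Hb'; exact: (inverse_uniq Wa).
Qed.

Lemma inverse_inv a b : W2 W a -> inverse a b -> inverse a (inv a).
Proof. by move=> Wa Hb; rewrite (invE Wa Hb). Qed.

Definition invertible a := exists b, inverse a b.

Lemma inverse_comp a b a' b' : W2 W a -> W2 W b -> ttgt a = tsrc b ->
  inverse a a' -> inverse b b' -> inverse (a ** b) (b' ** a').
Proof.
move=> Wa Wb ab [[/= Wa' sa ta] aa' a'a] [[/= Wb' sb tb] bb' b'b].
split=> /=; first by split=> //=; ty.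
- rewrite -[RHS]aa' -[_ #1 _]/((a ** b) ** (b' ** a')).
  rewrite -[a #1 a']/(a ** a') cA; [|ty..]; rewrite -(cA (b := b)); [|ty..].
  by rewrite [b ** b']bb' /= c2 //; ty.
- rewrite -[RHS]b'b -[_ #1 _]/((b' ** a') ** (a ** b)).
  rewrite -[b' #1 b]/(b' ** b) cA; [|ty..]; rewrite -(cA (b := a')); [|ty..].
  by rewrite [a' ** a]a'a /= c2 //; ty.
Qed.

Lemma inverse_wl F a a' : W1 W F -> W2 W a -> inverse a a' ->
  inverse (F |> a) (F |> a').
Proof.
move=> WF Wa [[/= Wa' sa ta] aa' a'a].
split=> /=; first by split=> //=; [ty|rewrite sa|rewrite ta].
- by rewrite -wli -?aa' ?wlc //; ty.
- by rewrite -wli -?a'a ?wlc //; ty.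
Qed.

Lemma inverse_wr F a a' : W1 W F -> W2 W a -> inverse a a' ->
  inverse (a |< F) (a' |< F).
Proof.
move=> WF Wa [[/= Wa' sa ta] aa' a'a].
split=> /=; first by split=> //=; [ty|rewrite sa|rewrite ta].
- by rewrite -[RHS]/(idT (tsrc a) |< F) -aa' wrc //; ty.
- by rewrite -[RHS]/(idT (ttgt a) |< F) -a'a wrc //; ty.
Qed.

Lemma inverse_idT F : W1 W F -> inverse (idT F) (idT F).
Proof.
move=> WF; split=> /=; first by split=> //=; ty.
all: by apply: c1 => //; ty.
Qed.

Lemma ph_inverse h g : inverse (ph h g) (inv (ph h g)).
Proof.
case: (phi_iso2 hX (in_setT h) (in_setT g)) => _ [b Hb].
by apply: (inverse_inv (b := b)) => //; ty.
Qed.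

Definition miso A B (n : mhom A B) :=
  exists n', mcomp n n' = mid A /\ mcomp n' n = mid B.

Lemma hxl a b x y : W3 W x -> W3 W y -> ttgt (msrc x) = tsrc (msrc y) ->
  msrc x = a -> mtgt y = b ->
  (idM a *** y) ;; (x *** idM b) = x *** y.
Proof. by move=> Wx Wy xy <- <-; rewrite exch; [|ty..]; rewrite v1 ?v2 //; ty. Qed.

Lemma modt x : W3 W x ->
  tsrc (mtgt x) = tsrc (msrc x) /\ ttgt (mtgt x) = ttgt (msrc x).
Proof. by move=> /(W3_modif hW) Hx; rewrite (modif_tsrc Hx) (modif_ttgt Hx). Qed.

Lemma hxr a b x y : W3 W x -> W3 W y -> ttgt (msrc x) = tsrc (msrc y) ->
  mtgt x = a -> msrc y = b ->
  (x *** idM b) ;; (idM a *** y) = x *** y.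
Proof.
move=> Wx Wy xy <- <-; have [_ tx] := modt Wx; rewrite exch; [|ty..].
by rewrite v1 ?v2 //; ty.
Qed.

Lemma miso_mx A B (n : mhom A B) n' : mcomp n n' = mid A -> mcomp n' n = mid B ->
  [/\ ma n ** ma n' = idT (tsrc A), mx n ;; (idM (ma n) *** mx n') = idM A
    & (idM (ma n) *** mx n') ;; mx n = idM (ma n ** B)].
Proof.
move=> nn' n'n; have E1 : ma n ** ma n' = idT (tsrc A) by rewrite -[LHS]/(ma (mcomp n n')) nn'.
split=> //; first by rewrite -[LHS]/(mx (mcomp n n')) nn'.
have E2 : mx n' ;; (idM (ma n') *** mx n) = idM B.
  by rewrite -[LHS]/(mx (mcomp n' n)) n'n.
rewrite -hi -?E2 ?hlv ?hA ?hi ?E1 ?h1 //; ty.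
Qed.

(** * Quotients of morphisms *)

Definition okp (v w : mobj) := [/\ me v = 1, tsrc w = tsrc v & inverse v (inv v)].

Lemma okpE v w : okp v w ->
  me v = 1 /\ [/\ W2 W (inv v), tsrc (inv v) = idF V, ttgt (inv v) = tsrc v,
      v ** inv v = idT (tsrc v) & inv v ** v = idT (idF V)].
Proof.
case=> e _ [[/= Wp sp tp] pv vp]; have tv : ttgt v = idF V.
  by rewrite mwt e ro1.
by split=> //; split; rewrite -?tv.
Qed.

(** y is the quotient of x by n, a 3-arrow from v^-1 w to v'^-1 w'. The 3-arrow m is the mate of n:
    the inverse of n, read on the inverses of v and v'. Its normalisation against n makes y depend
    on n and x only when n is invertible ([DD_uniq]). *)
Definition DD v v' w w' (n : mhom v v') (x : mhom w w') y := exists m,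
  [/\ W3 W m, msrc m = inv v ** ma n, mtgt m = inv v',
      (idM (inv v) *** mx n) ;; (m *** idM v') = idM (idT (idF V))
    & y = (idM (inv v) *** mx x) ;; (m *** idM w')].

Section DD.
Variables (v v' v'' w w' w'' : mobj).
Hypotheses (vw : okp v w) (vw' : okp v' w') (vw'' : okp v'' w'').
Variables (n : mhom v v') (x : mhom w w') (n2 : mhom v' v'') (x2 : mhom w' w'').
Hypotheses (nx : ma n = ma x) (nx2 : ma n2 = ma x2).

Lemma DD_typ y : DD n x y ->
  [/\ W3 W y, msrc y = inv v ** w & mtgt y = inv v' ** w'].
Proof.
case=> m [Wm sm tm _ ->]; have [ev [Wp sp tp _ _]] := okpE vw; rewrite nx in sm.
case: vw => _ wv _; case: vw' => _ wv' _.
split; ty.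
Qed.

(** One exchange computation, used twice in [DD_comp]: with the b's equal to the v's it normalises
    the composite mate, with the w's it computes the composite quotient. *)
Lemma DD_chain P F0 F1 F2 a1 a2 p p' p'' b b' b'' (z1 z2 m1 m2 : modif V) :
  W2 W a1 -> W2 W a2 -> W2 W p -> W2 W b -> W2 W b' -> W2 W b'' ->
  W3 W z1 -> W3 W z2 -> W3 W m1 -> W3 W m2 ->
  tsrc p = P -> ttgt p = F0 -> tsrc a1 = F0 -> ttgt a1 = F1 -> tsrc a2 = F1 ->
  ttgt a2 = F2 -> tsrc b = F0 -> tsrc b' = F1 -> tsrc b'' = F2 ->
  msrc z1 = b -> mtgt z1 = a1 ** b' -> msrc z2 = b' -> mtgt z2 = a2 ** b'' ->
  msrc m1 = p ** a1 -> mtgt m1 = p' -> msrc m2 = p' ** a2 -> mtgt m2 = p'' ->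
  (idM p *** (z1 ;; (idM a1 *** z2))) ;; (((m1 *** idM a2) ;; m2) *** idM b'') =
  ((idM p *** z1) ;; (m1 *** idM b')) ;; ((idM p' *** z2) ;; (m2 *** idM b'')).
Proof.
move=> Wa1 Wa2 Wp Wb Wb' Wb'' Wz1 Wz2 Wm1 Wm2 sp tp sa1 ta1 sa2 ta2 sb sb' sb''.
move=> sz1 tz1 sz2 tz2 sm1 tm1 sm2 tm2.
have [sp' tp'] := modt Wm1; rewrite tm1 sm1 /= ta1 sp in sp' tp'.
have Wp' : W2 W p' by rewrite -tm1; ty.
have tz1' : ttgt b = ttgt b'.
  by have [_] := modt Wz1; rewrite tz1 sz1 /=.
rewrite hlv; [|ty..]; rewrite hrv; [|ty..].
rewrite vA; [|ty..].
rewrite -(vA (x := idM p *** z1)); [|ty..].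
rewrite hA; [|ty..]; rewrite hi; [|ty..].
rewrite -(hA (x := m1)); [|ty..].
rewrite hi; [|ty..].
rewrite (hxl (b := a2 ** b'')); [|ty..].
by rewrite -(hxr (x := m1) (a := p') (b := b')) ?vA //; ty.
Qed.

Lemma DD_comp y y2 : DD n x y -> DD n2 x2 y2 -> DD (mcomp n n2) (mcomp x x2) (y ;; y2).
Proof.
case=> m [Wm sm tm E ->] [m2 [Wm2 sm2 tm2 E2 ->]].
have [ev [Wp sp tp _ _]] := okpE vw; have [ev' [Wp' sp' tp' _ _]] := okpE vw'.
have [ev'' [Wp'' sp'' tp'' _ _]] := okpE vw''.
have [_ wv _] := vw; have [_ wv' _] := vw'; have [_ wv'' _] := vw''.
exists ((m *** idM (ma n2)) ;; m2); split; try ty.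
- rewrite /= (@DD_chain (idF V) (tsrc v) (tsrc v') (tsrc v'') _ _ _
    (inv v') (inv v'') v v' v''); try ty.
  by rewrite E E2 v1; ty.
- rewrite nx nx2 in sm sm2 *.
  by rewrite (@DD_chain (idF V) (tsrc v) (tsrc v') (tsrc v'') _ _ _
    (inv v') (inv v'') w w' w''); ty.
Qed.
End DD.
Lemma DD_inv_comp v v' w w' (n : mhom v v') : okp v w -> okp v' w' ->
  ma n ** v' = v -> inv v ** ma n = inv v'.
Proof.
move=> vw vw' E; have [ev [Wp sp tp vp pv]] := okpE vw.
have [ev' [Wp' sp' tp' vp' pv']] := okpE vw'.
rewrite -[LHS](c2 (F := tsrc v')); [|ty..].
rewrite -vp' cA; [|ty..]; rewrite -(cA (b := ma n)); [|ty..].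
by rewrite E pv c1; ty.
Qed.

(** When both 3-arrows are identities, the mate may be taken to be an identity, since [ma n] turns
    the inverse of v into the inverse of v'. *)
Lemma DD_id v v' w w' (n : mhom v v') (x : mhom w w') :
  okp v w -> okp v' w' -> ma n = ma x -> mx n = idM v -> mx x = idM w ->
  DD n x (idM (inv v ** w)).
Proof.
move=> vw vw' nx En Ex; have [ev [Wp sp tp vp pv]] := okpE vw.
have [ev' [Wp' sp' tp' vp' pv']] := okpE vw'.
have [_ wv _] := vw; have [_ wv' _] := vw'.
have Fn : ma n ** v' = v by rewrite -mxt En.
have Fx : ma x ** w' = w by rewrite -mxt Ex.
have Ep := DD_inv_comp vw vw' Fn.
exists (idM (inv v')); split; try ty.
- by rewrite Ep.
- by rewrite En !hi ?pv ?pv' ?v1; ty.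
- rewrite Ex !hi; [|ty..]; rewrite v2 //; [ty|].
  by simpbd; rewrite -{1}Fx cA ?nx -?nx ?Ep; ty.
Qed.

Section DDiso.
Variables (v v' w w' : mobj).
Hypotheses (vw : okp v w) (vw' : okp v' w').
Variables (n : mhom v v') (n' : mhom v' v) (x : mhom w w').
Hypotheses (nx : ma n = ma x).
Hypotheses (nn' : mcomp n n' = mid v) (n'n : mcomp n' n = mid v').

Definition mate := (idM (inv v ** ma n) *** mx n') *** idM (inv v').

Lemma mate_in : [/\ W3 W mate, msrc mate = inv v ** ma n & mtgt mate = inv v'].
Proof.
have [ev [Wp sp tp vp pv]] := okpE vw; have [ev' [Wp' sp' tp' vp' pv']] := okpE vw'.
have [E1 _ _] := miso_mx nn' n'n.
rewrite /mate; split; first ty.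
  by simpbd; rewrite -cA ?vp' ?c2; ty.
simpbd; rewrite cA ?(cA (c := ma n')); [|ty..].
rewrite -(cA (b := ma n)) ?E1; [|ty..].
by rewrite c2 ?pv ?c1; ty.
Qed.

Lemma mate_v : mate *** idM v' = idM (inv v ** ma n) *** mx n'.
Proof.
have [ev [Wp sp tp vp pv]] := okpE vw; have [ev' [Wp' sp' tp' vp' pv']] := okpE vw'.
rewrite /mate -hA; [|ty..]; rewrite hi; [|ty..].
by rewrite pv' h2; ty.
Qed.

Lemma DD_ex :
  DD n x ((idM (inv v) *** mx x) ;; (mate *** idM w')).
Proof.
have [ev [Wp sp tp vp pv]] := okpE vw; have [ev' [Wp' sp' tp' vp' pv']] := okpE vw'.
have [E1 E2 E3] := miso_mx nn' n'n; have [Wm sm tm] := mate_in.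
exists mate; split=> //.
rewrite mate_v -hi; [|ty..]; rewrite -hA; [|ty..]; rewrite -hlv; [|ty..].
by rewrite E2 hi ?pv; ty.
Qed.

Lemma DD_mate m : W3 W m -> msrc m = inv v ** ma n -> mtgt m = inv v' ->
  (idM (inv v) *** mx n) ;; (m *** idM v') = idM (idT (idF V)) -> m = mate.
Proof.
move=> Wm sm tm E.
have [ev [Wp sp tp vp pv]] := okpE vw; have [ev' [Wp' sp' tp' vp' pv']] := okpE vw'.
have [E1 E2 E3] := miso_mx nn' n'n.
have tt : mtgt (idM (inv v ** ma n) *** mx n') = idT (idF V).
  simpbd; rewrite cA ?(cA (c := ma n')); [|ty..].
  rewrite -(cA (b := ma n)) ?E1; [|ty..].
  by rewrite c2 ?pv; ty.
(* By the normalisation, [m *** idM v'] is inverse to the 3-arrow of n whiskered by v^-1. By [E3]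
   this inverse is the 3-arrow of n', and v' is then cancelled against its inverse. *)
have H : m *** idM v' = idM (inv v ** ma n) *** mx n'.
  rewrite -[RHS](v2 (a := idT (idF V))); [|ty..].
  have E0 : ma n ** (ma n' ** v) = v by rewrite cA ?E1 ?c1; ty.
  have E1' : inv v ** ma n ** (ma n' ** v) = inv v ** v.
    by rewrite -cA ?E0; ty.
  rewrite -E vA; [|first [ty | simpbd; exact: E1']..].
  rewrite -[idM (_ ** ma n)]hi; [|ty..]; rewrite -(hA (x := idM (inv v))); [|ty..].
  rewrite -hlv; [|first [ty | simpbd; exact: E0]..].
  by rewrite E3 hi ?v1; ty.
rewrite /mate -H -hA; [|ty..]; rewrite hi; [|ty..].
by rewrite vp' h2; ty.
Qed.

Lemma DD_uniq y y' : DD n x y -> DD n x y' -> y = y'.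
Proof.
by move=> [m [? ? ? ? ->]] [m' [? ? ? ? ->]]; rewrite (DD_mate (m := m)) // (DD_mate (m := m')).
Qed.
End DDiso.

Definition un k : trans2 V := inv (ph k k^-1).

Lemma unP k : [/\ W2 W (un k), tsrc (un k) = idF V,
  ttgt (un k) = compF (ro k) (ro k^-1),
  ph k k^-1 ** un k = idT (compF (ro k) (ro k^-1))
  & un k ** ph k k^-1 = idT (idF V)].
Proof.
have [[/= Wu +] + +] := ph_inverse k k^-1.
rewrite -/(un k) phs pht mulgV ro1 => su tu pu up.
by split.
Qed.

(** The u_k of psi_k comes from here: it is the phi part of the inverse of a conjugated 2-arrow of
    grade 1. *)
Lemma cob_okp k v w : okp v w ->
  okp (cob k v) (cob k w) /\ inv (cob k v) = un k ** (ro k |> inv v |< ro k^-1).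
Proof.
move=> vw; have [ev [Wp sp tp vp pv]] := okpE vw; have [_ wv iv] := vw.
have Ec : cob k v = (ro k |> v |< ro k^-1) ** ph k k^-1 :> trans2 V.
  rewrite cobE ev mulg1 ph1r.
  rewrite -[idT (ro k) |< _]/(idT (compF (ro k) (ro k^-1))).
  by rewrite c2; ty.
have Ic : inverse (cob k v) (un k ** (ro k |> inv v |< ro k^-1)).
  rewrite Ec; apply: inverse_comp; [ty|ty|ty| |exact: ph_inverse].
  by apply: inverse_wr; [ty|ty|apply: inverse_wl; [ty|ty|]].
have Ei := invE (mwW (cob k v)) Ic.
split=> //; split; last by rewrite Ei.
  by rewrite /= ev mulg1 mulgV.
by rewrite /cob /= wv.
Qed.

Lemma conj_chain k p z m b c (u : trans2 V) :
  W2 W u -> W2 W p -> W2 W b -> W2 W c -> W3 W z -> W3 W m ->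
  ttgt u = compF (ro k) (ro k^-1) -> tsrc p = idF V -> ttgt p = tsrc (msrc z) ->
  mtgt (idM p *** z) = msrc (m *** idM b) -> ttgt (msrc m) = tsrc b ->
  tsrc c = compF (ro k) (compF (ttgt b) (ro k^-1)) ->
  ttgt (msrc z) = ttgt b ->
  (idM (u ** (ro k |> p |< ro k^-1)) *** ((ro k ||> z ||< ro k^-1) *** idM c)) ;;
  ((idM u *** (ro k ||> m ||< ro k^-1)) *** idM ((ro k |> b |< ro k^-1) ** c)) =
  idM u *** (ro k ||> ((idM p *** z) ;; (m *** idM b)) ||< ro k^-1) *** idM c.
Proof.
move=> Wu Wp Wb Wc Wz Wm tu sp tp E mb sc tz.
have tz' : ttgt (mtgt z) = ttgt b by have [_ ->] := modt Wz.
have sm : tsrc (msrc m) = idF V.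
  by have := congr1 (@tsrc _ _) E; rewrite /= sp.
rewrite -hi; [|ty..]; rewrite hA; [|ty..].
rewrite -(hA (x := idM u)); [|ty..].
rewrite -(hi (b := c)); [|ty..].
rewrite (hA (y := idM (_ |> b |< _))); [|ty..].
rewrite -(hA (x := idM u) (z := idM (_ |> b |< _))); [|ty..].
rewrite -hiMF -!wlI; [|ty..].
rewrite -hiMF -!wrh; [|ty..].
rewrite -!wlh; [|ty..].
rewrite -(wlI b); [|ty..]; rewrite -wlh; [|ty..].
rewrite wlv; [|ty..].
set zz := ro k ||> _; set mm := ro k ||> _.
have Ez : mtgt zz = msrc mm.
  rewrite /zz /mm.
  exact: (congr1 (fun a => ro k |> a) E).
have Wzz : W3 W zz by rewrite /zz; ty.
have Wmm : W3 W mm by rewrite /mm; ty.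
have szz : tsrc (msrc zz) = ro k by rewrite /zz; ty.
have tzz : ttgt (msrc zz) = compF (ro k) (ttgt b) by rewrite /zz; ty.
have smm : tsrc (msrc mm) = ro k by rewrite /mm; ty.
have tmm : ttgt (msrc mm) = compF (ro k) (ttgt b) by rewrite /mm; ty.
rewrite -hrv; [|first [ty|by rewrite /= Ez]..].
by rewrite -hlv //; first [ty|by rewrite /= Ez].
Qed.

(** Conjugating numerator and denominator applies psi_k to the quotient: u_k comes from the inverted
    denominator, the phi factors from the numerator. *)
Lemma DD_conj v v' w w' (n : mhom v v') (x : mhom w w') k y :
  okp v w -> okp v' w' -> ma n = ma x -> DD n x y ->
  DD (chom k n) (chom k x) (psi3 X (me w) k y).
Proof.
move=> vw vw' nx [m [Wm sm tm E ->]].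
have [ev [Wp sp tp vp pv]] := okpE vw; have [ev' [Wp' sp' tp' vp' pv']] := okpE vw'.
have [Wu su tu pu up] := unP k.
have [_ Ei] := cob_okp k vw; have [_ Ei'] := cob_okp k vw'.
have [_ wv iv] := vw; have [_ wv' iv'] := vw'.
have tp0 : tsrc (inv v') = tsrc (inv v) by rewrite sp sp'.
rewrite /DD Ei Ei'; exists (idM (un k) *** (ro k ||> m ||< ro k^-1)); split.
- ty.
- rewrite chom_ma; ty.
- ty.
- have -> : mx (chom k n) = (ro k ||> mx n ||< ro k^-1) *** idM (ph k k^-1).
    rewrite chom_mx ev mulg1 ph1r.
    rewrite -[idT (ro k) |< _]/(idT (compF (ro k) (ro k^-1))).
    by rewrite h2; ty.
  have -> : mw (cob k v') = (ro k |> v' |< ro k^-1) ** ph k k^-1.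
    rewrite cobE ev' mulg1 ph1r.
    rewrite -[idT (ro k) |< _]/(idT (compF (ro k) (ro k^-1))).
    by rewrite c2; ty.
  rewrite conj_chain; try ty.
  rewrite E wlI; [|ty..]; rewrite hiMF.
  rewrite wli; [|ty..].
  rewrite -[_ |< ro k^-1]/(idT (compF (ro k) (ro k^-1))).
  by rewrite h2 ?hi ?up; ty.
- have -> : psi3 X (me w) k ((idM (inv v) *** mx x) ;; (m *** idM w')) =
    idM (un k) *** (ro k ||> ((idM (inv v) *** mx x) ;; (m *** idM w')) ||< ro k^-1)
      *** idM (ph k (me w) |< ro k^-1) *** idM (ph (k * me w) k^-1) by [].
  rewrite -(hA (y := idM _)); [|rewrite nx in sm; ty..]; rewrite hi; [|ty..].
  rewrite chom_mx cobE -(mhe x) -(hA (y := idM _)); [|ty..]; rewrite hi; [|ty..].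
  rewrite -cA; [|ty..].
  rewrite conj_chain //; rewrite nx in sm; ty.
Qed.

Lemma inverse_sym a b : W2 W a -> inverse a b -> inverse b a.
Proof.
move=> Wa [[Wb sb tb] ab ba]; split; first by split.
- by apply: (etrans ba); rewrite sb.
- by apply: (etrans ab); rewrite tb.
Qed.

Lemma miso_cart A B (n : mhom A B) b : mx n = idM A -> inverse (ma n) b -> miso n.
Proof.
move=> En [[/= Wb sb tb] ab ba].
have {ab}ab : ma n ** b = idT (tsrc A) by rewrite -(mas n).
have {ba}ba : b ** ma n = idT (tsrc B) by rewrite -(mat n).
have sb' : tsrc b = tsrc B by rewrite sb mat.
have tb' : ttgt b = tsrc A by rewrite tb mas.
have EA : ma n ** B = A by rewrite -mxt En.
have EB : mtgt (idM B) = b ** A.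
  by rewrite -EA cA ?ba ?c1; ty.
exists (MHom (esym (mhe n)) Wb sb' tb' (W_one3 hW (mwW B)) erefl EB); split.
  apply: mhom_ext => /=; first exact: ab.
  by rewrite En hi ?EA ?v1 //; ty.
apply: mhom_ext => /=; first exact: ba.
have {}EB : b ** A = B := esym EB.
by rewrite En hi ?EB ?v1 //; ty.
Qed.

Lemma eobj_ten h g : mten (eobj h) (eobj g) = ph h g :> trans2 V.
Proof.
rewrite /=; rewrite -[idT (ro h) |< _]/(idT (compF (ro h) (ro g))).
by rewrite wli ?c1; ty.
Qed.

(** * Morphisms that act on the outer factors *)

Section Phm.
Variables (h g k : gT) (hgk : h * g = k).

Lemma phm_t : mtgt (idM (mten (eobj h) (eobj g))) = ph h g ** eobj k.
Proof. by rewrite [LHS]eobj_ten -hgk c2; ty. Qed.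

(** The multiplication of outer factors, with phi as 2-arrow and an identity 3-arrow. The product is
    a separate k so that g^-1 h^-1 can be sent to (h g)^-1. *)
Definition phm : mhom (mten (eobj h) (eobj g)) (eobj k).
apply: (@MHom _ _ (ph h g) (idM (mten (eobj h) (eobj g))));
  first [exact: phm_t | by rewrite -hgk | idtac]; try ty.
by rewrite -hgk; ty.
Defined.

Lemma miso_phm : miso phm.
Proof. exact: (@miso_cart _ _ phm _ erefl (ph_inverse h g)). Qed.
End Phm.

Section Shift.
Variables (A A' w : mobj) (a : gT).
Variables (xi : mhom A (eobj a)) (xi' : mhom A' (eobj a^-1)).
Hypothesis sw : tsrc w = idF V.

Let x := mtenh (mtenh xi (mid w)) xi'.
Let Z := (A |< tsrc A') ** (ro a |> A').
Let z := (mx xi ||< tsrc A') *** (ro a ||> mx xi').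

(** As w starts at the identity functor, interchange moves A' in front of w; the factor Z split off
    in this way does not involve w. *)
Lemma shift_mw : mten (mten A w) A' = Z ** cob a w :> trans2 V.
Proof.
have eA : me A = a := mhe xi; have eA' : me A' = a^-1 := mhe xi'.
rewrite cobE /Z /= eA eA' sw !wrc; [|ty..].
rewrite -(cA (b := ph _ _ |< _)); [|ty..].
rewrite (slide (a := ph _ _) (F := compF (ro a) (ro (me w))) (G' := ro a^-1)); [|ty..].
rewrite cA; [|ty..].
rewrite -(cA (b := _ |> w |< _)); [|ty..].
rewrite -[compF (ro a) (ro (me w)) |> A']/(ro a |> (ro (me w) |> A')).
rewrite -[(ro a |> w) |< tsrc A']/(ro a |> (w |< tsrc A')).
rewrite -wlc; [|ty..].
rewrite (slide (a := w) (F := idF V) (G' := ro a^-1)); [|ty..].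
rewrite wlc ?whiskFT_idF ?whiskTF_idF; [|ty..].
by rewrite !cA; ty.
Qed.

Lemma shift_ma : ma x = (ma xi |< tsrc A') ** (ro a |> ma xi').
Proof.
rewrite /x /= sw wli; [|ty..].
rewrite wrc; [|ty..].
rewrite -[idT _ |< tsrc A']/(idT (compF (ro a) (compF (idF V) (tsrc A')))).
by rewrite c2 ?whiskTF_idF ?compF_idr; ty.
Qed.

Lemma shift_mx : mx x = z *** idM (cob a w).
Proof.
have eA : me A = a := mhe xi; have eA' : me A' = a^-1 := mhe xi'.
rewrite cobE /x /z /= eA eA' sw !wrh; [|ty..].
rewrite wlI ?hiMF; [|ty..].
rewrite -(hA (y := idM (ph _ _ |< _))); [|ty..].
rewrite (slider (F := compF (ro a) (ro (me w))) (G' := ro a^-1)); [|ty..].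
rewrite hA; [|ty..].
rewrite -(hA (y := idM (_ |> w |< _))); [|ty..].
rewrite -[compF (ro a) (ro (me w)) ||> mx xi']/(ro a ||> (ro (me w) ||> mx xi')).
rewrite -[idM ((ro a |> w) |< tsrc A')]/(idM (ro a |> (w |< tsrc A'))).
rewrite -wlI -?wlh; [|ty..].
rewrite (slider (a := w) (F := idF V) (G' := ro a^-1)); [|ty..].
rewrite wlh ?whiskFM_idF ?whiskMF_idF ?wlI; [|ty..].
by rewrite -!hi ?hA; ty.
Qed.

End Shift.

Lemma okp_iobj (w : mobj) : tsrc w = idF V -> okp iobj w /\ inv iobj = idT (idF V).
Proof.
move=> sw; have Ei := invE (mwW iobj) (inverse_idT (W_one1 hW)).
by split=> //; split=> //; rewrite Ei; exact: (inverse_idT (W_one1 hW)).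
Qed.

(** By [shift_mx] the 3-arrow consists of a part z independent of w, next to an untouched conjugate
    of w. Division by the same morphism at the unit object cancels z. *)
Lemma DD_shift A A' (w : mobj) (a : gT) (xi : mhom A (eobj a)) (xi' : mhom A' (eobj a^-1)) :
  tsrc w = idF V ->
  let n := mtenh (mtenh xi (mid iobj)) xi' in
  let x := mtenh (mtenh xi (mid w)) xi' in
  okp (mten (mten A iobj) A') (mten (mten A w) A') -> miso n ->
  DD n x (idM (inv (mten (mten A iobj) A') ** mten (mten A w) A')).
Proof.
move=> sw n x ok [n' [nn' n'n]].
have [ok1 _] := okp_iobj sw; have [ok' Eu] := cob_okp a ok1.
have si : tsrc iobj = idF V by [].
have nx : ma n = ma x by rewrite !shift_ma.
have [m [Wm sm tm E _]] := DD_ex ok ok' x nn' n'n.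
exists m; split=> //; apply: esym.
have [ev [Wp sp tp vp pv]] := okpE ok; have [ev' [Wp' sp' tp' vp' pv']] := okpE ok'.
set p := inv (mten _ _) in sm E Wp sp tp vp pv *.
set u := inv (cob a iobj) in Wp' sp' tp' vp' pv' tm *.
have eA : me A = a := mhe xi; have eA' : me A' = a^-1 := mhe xi'.
set z := (mx xi ||< tsrc A') *** (ro a ||> mx xi').
set c := (ma xi |< tsrc A') ** (ro a |> ma xi').
have Wz : W3 W z by rewrite /z; ty.
have Wc : W2 W c by rewrite /c; ty.
have sz : msrc z = (A |< tsrc A') ** (ro a |> A') by rewrite /z; simpbd.
have tz : mtgt z = c.
  rewrite /z /c; simpbd.
  by rewrite -[mw (eobj a)]/(idT (ro a)) -[mw (eobj _)]/(idT (ro a^-1)) !c2; ty.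
have sm' : msrc m = p ** c by rewrite sm shift_ma.
have tz1 : tsrc c = compF (tsrc A) (tsrc A') by rewrite /c; ty.
have tz2 : ttgt c = compF (ro a) (ro a^-1) by rewrite /c; ty.
have sz1 : tsrc (msrc z) = compF (tsrc A) (tsrc A') by rewrite sz; ty.
have sz2 : ttgt (msrc z) = compF (ro a) (ro a^-1) by rewrite sz; ty.
have {}tp : ttgt p = compF (tsrc A) (tsrc A') by rewrite tp /=; simpbd.
have sF : tsrc (cob a iobj) = compF (ro a) (ro a^-1) by simpbd.
have sFw : tsrc (cob a w) = compF (ro a) (ro a^-1) by cbn; rewrite sw.
move: E; rewrite !shift_mx // -/z => E.
clearbody z.
(* The conjugate of the unit object is invertible; cancelling it on the right of the normalisation
   of m leaves an identity about z and m alone. *)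
have Epm : (idM p *** z) ;; m = idM u.
  rewrite -[LHS](h2 (F := compF (ro a) (ro a^-1))); [|ty..].
  rewrite -[compF _ _]sF -vp' -hi; [|ty..].
  rewrite hA; [|ty..]; rewrite hrv; [|ty..].
  rewrite -(hA (z := idM (cob a iobj))); [|ty..].
  by rewrite E h1 //; ty.
have Epu : p ** ((A |< tsrc A') ** (ro a |> A')) = u.
  by have := congr1 (@msrc _ _) Epm; rewrite /= sz.
rewrite hA; [|ty..]; rewrite -hrv; [|ty..].
rewrite Epm hi; [|ty..].
by rewrite (shift_mw xi xi' sw) cA ?Epu; ty.
Qed.

Lemma wri F G : idT F |< G = idT (compF F G). Proof. by []. Qed.

Ltac idn := repeat first [ rewrite wri | rewrite wli; [|ty..]
  | rewrite c1; [|ty..] | rewrite c2; [|ty..] | rewrite hiMF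
  | rewrite wlI; [|ty..] | rewrite h1; [|ty..] | rewrite h2; [|ty..]
  | rewrite wrc; [|ty..] | rewrite wlc; [|ty..] | rewrite wrh; [|ty..]
  | rewrite wlh; [|ty..] ].

(** * Lambda and Gamma as structure maps of conjugation *)

Section Ghat.
Variables (h g : gT) (Y : mobj).

Lemma VgM : g^-1 * h^-1 = (h * g)^-1. Proof. by rewrite invMg. Qed.

Definition cmul : mhom (cob h (cob g Y))
    (mten (mten (mten (eobj h) (eobj g)) Y) (mten (eobj g^-1) (eobj h^-1))) :=
  mcomp (mtenh (alph (eobj h) (mten (eobj g) Y) (eobj g^-1)) (mid (eobj h^-1)))
   (mcomp (mtenh (mtenh (alph (eobj h) (eobj g) Y) (mid (eobj g^-1)))
            (mid (eobj h^-1)))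
     (ialph (mten (mten (eobj h) (eobj g)) Y) (eobj g^-1) (eobj h^-1))).

(** The canonical map from conjugation by g and then h to conjugation by h g: reassociate, then
    multiply the outer factors. Its 3-arrow is Lambda next to the whiskered Y ([Ghat_mx]), the three
    associators in [cmul] giving the three factors of Lambda. *)
Definition Ghat : mhom (cob h (cob g Y)) (cob (h * g) Y) :=
  mcomp cmul (mtenh (mtenh (phm (erefl (h * g))) (mid Y)) (phm VgM)).

Let e := me Y.
Let l1 := idM (ro h |> ph g e |< compF (ro g^-1) (ro h^-1)) ***
  (Ph h (g * e) g^-1 ||< ro h^-1) *** idM (ph (h * g * e * g^-1) h^-1).
Let l2 := (Ph h g e ||< compF (ro g^-1) (ro h^-1)) ***
  idM (ph (h * g * e) g^-1 |< ro h^-1) *** idM (ph (h * g * e * g^-1) h^-1).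
Let l3 := idM ((ph h g |< compF (compF (ro e) (ro g^-1)) (ro h^-1)) **
  (ph (h * g) e |< compF (ro g^-1) (ro h^-1))) *** iPh (h * g * e) g^-1 h^-1.

Lemma LamE : Lam X h g e = (l1 ;; l2) ;; l3. Proof. by []. Qed.

Let T := compF (ro h) (ro g) |> Y |< compF (ro g^-1) (ro h^-1).

Lemma GT : [/\ W2 W T, tsrc T = compF (compF (ro h) (ro g))
    (compF (tsrc Y) (compF (ro g^-1) (ro h^-1)))
  & ttgt T = compF (compF (ro h) (ro g))
    (compF (ro e) (compF (ro g^-1) (ro h^-1)))].
Proof. by rewrite /T; split; ty. Qed.

Lemma Ghat_l1 : mx (mtenh (alph (eobj h) (mten (eobj g) Y) (eobj g^-1)) (mid (eobj h^-1)))
  = idM T *** l1.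
Proof.
have [WT sT tT] := GT.
rewrite /= /alQ /=; idn.
by rewrite -!hi; [|ty..]; rewrite !hA ?mulgA; ty.
Qed.

Lemma Ghat_l2 : mx (mtenh (mtenh (alph (eobj h) (eobj g) Y) (mid (eobj g^-1)))
    (mid (eobj h^-1))) = idM T *** l2.
Proof.
have [WT sT tT] := GT.
rewrite /= /alQ /=; idn.
by rewrite !hA ?mulgA; ty.
Qed.

Lemma Ghat_l3 : mx (ialph (mten (mten (eobj h) (eobj g)) Y) (eobj g^-1) (eobj h^-1))
  = idM T *** l3.
Proof.
have [WT sT tT] := GT.
rewrite /= /alQ /=; idn.
rewrite -[(ph h g |< _) |< _]/(ph h g |< compF (tsrc Y) (compF (ro g^-1) (ro h^-1))).
rewrite -[(ro (h * g) |> Y) |< _]/(ro (h * g) |> (Y |< compF (ro g^-1) (ro h^-1))).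
rewrite (slide (F := compF (ro h) (ro g))
  (G' := compF (ro e) (compF (ro g^-1) (ro h^-1)))); [|ty..].
rewrite -cA; [|ty..].
by rewrite /l3 hA ?hi; ty.
Qed.

Lemma mcomp_ma A B C (f : mhom A B) (f' : mhom B C) :
  ma (mcomp f f') = ma f ** ma f'.
Proof. by []. Qed.
Lemma mcomp_mx A B C (f : mhom A B) (f' : mhom B C) :
  mx (mcomp f f') = mx f ;; (idM (ma f) *** mx f').
Proof. by []. Qed.

Lemma cmul_ma : ma cmul = idT (tsrc (cob h (cob g Y))).
Proof. by rewrite /cmul !mcomp_ma /=; idn. Qed.

Lemma cmul_mx : mx cmul = idM T *** Lam X h g e.
Proof.
have [WT sT tT] := GT.
rewrite /cmul !mcomp_mx.
have -> : ma (mtenh (alph (eobj h) (mten (eobj g) Y) (eobj g^-1)) (mid (eobj h^-1)))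
  = idT (tsrc (cob h (cob g Y))).
by cbn [ma mtenh alph mid]; idn.
have -> : ma (mtenh (mtenh (alph (eobj h) (eobj g) Y) (mid (eobj g^-1)))
     (mid (eobj h^-1))) = idT (tsrc (cob h (cob g Y))).
by cbn [ma mtenh alph mid]; idn.
rewrite Ghat_l1 Ghat_l2 Ghat_l3 LamE.
rewrite h1; [|rewrite /l2 /l3; ty..].
rewrite h1; [|rewrite /l3; ty..].
have E12 : mtgt l1 = msrc l2 by rewrite /l1 /l2; ty.
have E23 : mtgt l2 = msrc l3.
  by rewrite /l2 /l3 /e; simpbd; rewrite !wrc ?cA; ty.
have [? ? ?] : [/\ W3 W l1, W3 W l2 & W3 W l3].
  by rewrite /l1 /l2 /l3; split; ty.
have s1 : tsrc (msrc l1) = ttgt T by rewrite tT /l1; ty.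
have s2 : tsrc (msrc l2) = ttgt T by rewrite tT /l2; ty.
have s3 : tsrc (msrc l3) = ttgt T by rewrite tT /l3; ty.
rewrite tT in s1 s2 s3; rewrite vA; [|ty..].
by rewrite -hlv; [|ty..]; rewrite -hlv; ty.
Qed.

Lemma Ghat_ma : ma Ghat = (ph h g |< compF (tsrc Y) (compF (ro g^-1) (ro h^-1)))
  ** (ro (h * g) |> (tsrc Y |> ph g^-1 h^-1)).
Proof.
by rewrite /Ghat mcomp_ma cmul_ma /=; idn.
Qed.

Lemma mx_comp_id A B C (f : mhom A B) (f' : mhom B C) b :
  mx f' = idM b -> mx (mcomp f f') = mx f.
Proof.
move=> E; have Eb : b = B by rewrite -[RHS](mxs f') E.
rewrite mcomp_mx E Eb hi ?v2 //; ty.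
Qed.

Lemma Ghat_mx : mx Ghat = idM T *** Lam X h g e.
Proof.
rewrite -cmul_mx /Ghat; apply: mx_comp_id => //.
rewrite /= !wlI; [|ty..]; rewrite !hiMF.
by rewrite !hi //; ty.
Qed.

End Ghat.

Lemma miso_comp A B C (f : mhom A B) (g : mhom B C) :
  miso f -> miso g -> miso (mcomp f g).
Proof.
move=> [f' [E1 E2]] [g' [E3 E4]]; exists (mcomp g' f').
rewrite !mcompA -(mcompA f) E3 mid_r E1.
by rewrite -(mcompA g') E2 mid_r E4.
Qed.

Lemma miso_mid A : miso (mid A).
Proof. by exists (mid A); rewrite mid_l. Qed.

Lemma miso_ten A A' B B' (f : mhom A A') (g : mhom B B') :
  miso f -> miso g -> miso (mtenh f g).
Proof.
move=> [f' [E1 E2]] [g' [E3 E4]]; exists (mtenh f' g').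
by rewrite !mtenh_comp E1 E2 E3 E4 !mtenh_id.
Qed.

Lemma miso_alph A B C : miso (alph A B C).
Proof. by exists (ialph A B C); rewrite alph_i alph_i'. Qed.

Lemma miso_ialph A B C : miso (ialph A B C).
Proof. by exists (alph A B C); rewrite alph_i alph_i'. Qed.

Lemma miso_chom k Y Z (y : mhom Y Z) : miso y -> miso (chom k y).
Proof.
by move=> y_iso; apply: miso_ten (miso_ten _ _) _ => //; exact: miso_mid.
Qed.

Lemma miso_cmul h g Y : miso (cmul h g Y).
Proof.
apply: miso_comp; first exact: miso_ten (miso_alph _ _ _) (miso_mid _).
apply: miso_comp; last exact: miso_ialph.
by apply: miso_ten (miso_mid _); apply: miso_ten (miso_alph _ _ _) (miso_mid _).
Qed.

Lemma miso_Ghat h g Y : miso (Ghat h g Y).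
Proof.
apply: miso_comp; first exact: miso_cmul.
by apply: miso_ten; [apply: miso_ten|]; first [exact: miso_phm | exact: miso_mid].
Qed.

Lemma Lft_src h g e : Lft X h g e = msrc (Lam X h g e).
Proof.
have -> : Lam X h g e = _ := LamE h g (eobj e).
by simpbd; rewrite /= !wrc ?cA; ty.
Qed.

Lemma Rgt_tgt h g e : Rgt X h g e = mtgt (Lam X h g e).
Proof.
have -> : Lam X h g e = _ := LamE h g (eobj e).
by simpbd; rewrite /= !cA; ty.
Qed.

Lemma cob2_okp h g (w : mobj) : tsrc w = idF V ->
  okp (cob h (cob g iobj)) (cob h (cob g w)) /\
  inv (cob h (cob g iobj)) =
    un h ** (ro h |> (un g ** (ro g |> idT (idF V) |< ro g^-1)) |< ro h^-1).
Proof.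
move=> sw; have [ok Ei] := okp_iobj sw.
have [ok1 E1] := cob_okp g ok; have [ok2 E2] := cob_okp h ok1.
by split=> //; rewrite E2 E1 Ei.
Qed.

Lemma cob1_okp h (w : mobj) : tsrc w = idF V -> okp (cob h iobj) (cob h w).
Proof. by move=> sw; have [ok Ei] := okp_iobj sw; case: (cob_okp h ok). Qed.

Lemma Ghat_nx h g (w : mobj) : tsrc w = idF V -> ma (Ghat h g iobj) = ma (Ghat h g w).
Proof. by move=> sw; rewrite !Ghat_ma sw. Qed.

Lemma inverse3_uniq x y y' : W3 W x -> inverse3 (C := cat3_of W) x y ->
  inverse3 (C := cat3_of W) x y' -> y = y'.
Proof.
move=> Wx [[/= Wy sy ty'] xy yx] [[/= Wy' sy' ty''] xy' y'x].
have E : y ;; (x ;; y') = (y ;; x) ;; y' by rewrite vA; ty.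
move: E; rewrite [x ;; y']xy' [y ;; x]yx /=.
by rewrite v1 // v2.
Qed.

Lemma inv3E x y : W3 W x -> inverse3 (C := cat3_of W) x y ->
  inv3 (C := cat3_of W) x = y.
Proof.
move=> Wx Hy; rewrite /inv3 /choose_or.
case: pselect => [e|[]]; last by exists y.
by case: cid => y' /= Hy'; exact: (inverse3_uniq Wx).
Qed.

(** Brings the quotient into the shape of the defining formula of Gamma, in which the inverse of n
    stands to the left of x in a #1 composite. *)
Lemma DD_mateE (v v' w w' : mobj) (n : mhom v v') (n' : mhom v' v) (x : mhom w w') :
  okp v w -> okp v' w' -> ma n = ma x ->
  mcomp n n' = mid v -> mcomp n' n = mid v' ->
  (idM (inv v) *** (idM (ma n) *** mx n') *** idM (inv v' ** ma n')) *** mx x =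
  (idM (inv v) *** mx x) ;; (mate n n' *** idM w').
Proof.
move=> ok ok' nx nn' n'n.
have [ev [Wp sp tp vp pv]] := okpE ok; have [ev' [Wp' sp' tp' vp' pv']] := okpE ok'.
have [E1 E2 E3] := miso_mx nn' n'n; have [E4 _ _] := miso_mx n'n nn'.
have [_ wv _] := ok; have [_ wv' _] := ok'.
have sM : msrc (idM (inv v) *** (idM (ma n) *** mx n') *** idM (inv v' ** ma n')) = inv v.
  simpbd; rewrite !cA; [|ty..]; rewrite -(cA (c := inv v')); [|ty..].
  rewrite vp' c2; [|ty..].
  by rewrite -cA ?E1 ?c2; ty.
rewrite -(hxl (a := inv v) (b := ma x ** w')) //; try ty.
congr (_ ;; _); rewrite -nx.
rewrite -(hi (a := inv v')); [|ty..]; rewrite -(hi (b := w')); [|ty..].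
rewrite /mate -hi; [|ty..].
rewrite !hA; [|ty..].
rewrite -(hA (y := idM (ma n')) (z := idM (ma n))); [|ty..].
by rewrite (hi (a := ma n') (b := ma n)) ?E4 ?h2; ty.
Qed.

Lemma miso_inverse A B (n : mhom A B) n' :
  mcomp n n' = mid A -> mcomp n' n = mid B -> inverse (ma n) (ma n').
Proof.
move=> nn' n'n.
have [E1 _ _] := miso_mx nn' n'n; have [E4 _ _] := miso_mx n'n nn'.
split; [split; first exact: maW | |].
- exact: (etrans (mas n') (esym (mat n))).
- exact: (etrans (mat n') (esym (mas n))).
- by apply: (etrans E1); rewrite -(mas n).
- by apply: (etrans E4); rewrite -(mat n).
Qed.

(** At the unit object the whiskered factor is an identity, so the 3-arrow of [Ghat] is Lambda^1,
    and the inverses in the formula for Gamma can be read off from an inverse of [Ghat]. *)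
Lemma Lam1_inverse h g n' (n := Ghat h g iobj) :
  mcomp n n' = mid (cob h (cob g iobj)) -> mcomp n' n = mid (cob (h * g) iobj) ->
  [/\ Lft X h g 1 = cob h (cob g iobj),
      inverse (Rgt X h g 1) (inv (cob (h * g) iobj) ** ma n')
    & inverse3 (C := cat3_of W) (Lam X h g 1) (idM (ma n) *** mx n')].
Proof.
move=> nn' n'n.
have ok : okp (cob (h * g) iobj) (cob (h * g) iobj) := cob1_okp (h * g) (erefl : tsrc iobj = idF V).
have [E1 E2 E3] := miso_mx nn' n'n.
have W_L : W3 W (Lam X h g 1).
  by have -> : Lam X h g 1 = _ := LamE h g (eobj 1); cbn [me eobj]; ty.
have En : mx n = Lam X h g 1.
  rewrite /n Ghat_mx -[RHS](h1 (F := tsrc (msrc (Lam X h g 1)))) //.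
  congr (idM _ *** _); have -> : Lam X h g 1 = _ := LamE h g iobj.
  rewrite -[mw iobj]/(idT (idF V)) -[me iobj]/(1 : gT).
  by rewrite wli ?wri; ty.
have EL : Lft X h g 1 = cob h (cob g iobj) by rewrite Lft_src -En mxs.
have ER : Rgt X h g 1 = ma n ** cob (h * g) iobj by rewrite Rgt_tgt -En mxt.
have Ia := miso_inverse nn' n'n.
split=> //.
  rewrite ER; apply: inverse_comp => //; try ty.
  by case: ok.
rewrite -En.
have A1 : W3 W (idM (ma n) *** mx n') by ty.
have A2 : msrc (idM (ma n) *** mx n') = mtgt (mx n) by rewrite mxt; ty.
have A3 : mtgt (idM (ma n) *** mx n') = msrc (mx n).
  by simpbd; rewrite cA ?E1 ?c1; ty.
split; first by split; [exact: A1 | exact: A2 | exact: A3].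
- by apply: (etrans E2); rewrite -(mxs n).
- by apply: (etrans E3); rewrite -(mxt n).
Qed.

(** The inverted L^1, Lambda^1 and R^1 make up the mate of [Ghat] at the unit object; the remaining
    factors are the 3-arrow of [Ghat] at w. *)
Lemma Gamma_DD h g (w : mobj) : tsrc w = idF V ->
  DD (Ghat h g iobj) (Ghat h g w) (Gamma X (me w) h g w).
Proof.
move=> sw; set n := Ghat h g iobj; set x := Ghat h g w.
have [n' [nn' n'n]] : miso n := miso_Ghat h g iobj.
have [ok _] := cob2_okp h g sw; have ok' := cob1_okp (h * g) sw.
have nx : ma n = ma x := Ghat_nx h g sw.
have [ev [Wp sp tp vp pv]] := okpE ok; have [ev' [Wp' sp' tp' vp' pv']] := okpE ok'.
have [E1 E2 E3] := miso_mx nn' n'n.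
have [E4 _ _] := miso_mx n'n nn'.
have W_L e : W3 W (Lam X h g e).
  by have -> : Lam X h g e = _ := LamE h g (eobj e); cbn [me eobj]; ty.
have [EL IR IL] := Lam1_inverse nn' n'n.
have iR : inv2 (C := cat3_of W) (Rgt X h g 1) = inv (cob (h * g) iobj) ** ma n'.
  by apply: invE => //; rewrite Rgt_tgt; apply: (W3_tgt hW).
have iL : inv3 (C := cat3_of W) (Lam X h g 1) = idM (ma n) *** mx n'.
  exact: inv3E.
have EG : Gamma X (me w) h g w = ((idM (inv (cob h (cob g iobj))) ***
    (idM (ma n) *** mx n') *** idM (inv (cob (h * g) iobj) ** ma n')) ***
    idM (compF (ro h) (ro g) |> w |< compF (ro g^-1) (ro h^-1))) *** Lam X h g (me w).
  by rewrite -iR -iL -EL.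
have [Wm sm tm] := mate_in ok ok' nn' n'n.
suff -> : Gamma X (me w) h g w = (idM (inv (cob h (cob g iobj))) *** mx x) ;;
    (mate n n' *** idM (cob (h * g) w)) by exact: DD_ex.
have WL := W_L (me w); have Wx := mxW x; have sx := mxs x; have tx := mxt x.
have sT : ttgt (compF (ro h) (ro g) |> w |< compF (ro g^-1) (ro h^-1)) =
  tsrc (msrc (Lam X h g (me w))).
  have -> : Lam X h g (me w) = _ := LamE h g w; ty.
have sT' : tsrc (compF (ro h) (ro g) |> w |< compF (ro g^-1) (ro h^-1)) =
  tsrc (cob h (cob g iobj)) by rewrite /= sw.
have Ex : mx x = idM (compF (ro h) (ro g) |> w |< compF (ro g^-1) (ro h^-1)) ***
  Lam X h g (me w) by rewrite /x Ghat_mx.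
have S1 : tsrc (cob h (cob g iobj)) =
  compF (ro h) (compF (ro g) (compF (ro g^-1) (ro h^-1))) by [].
rewrite EG -hA; [|ty..]; rewrite -Ex.
exact: DD_mateE.
Qed.


Lemma Lam1_iso h g (F := compF (ro h) (compF (ro g) (compF (ro g^-1) (ro h^-1)))) :
  [/\ iso2 (C := cat3_of W) F (idF V) (Lft X h g 1),
      iso2 (C := cat3_of W) F (idF V) (Rgt X h g 1)
    & iso3 (C := cat3_of W) (Lft X h g 1) (Rgt X h g 1) (Lam X h g 1)].
Proof.
have [n' [nn' n'n]] := miso_Ghat h g iobj.
have [EL IR IL] := Lam1_inverse nn' n'n.
have [ok _] := cob2_okp h g (erefl : tsrc iobj = idF V); have [_ _ I] := ok.
have WL : W3 W (Lam X h g 1).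
  by have -> : Lam X h g 1 = _ := LamE h g (eobj 1); cbn [me eobj]; ty.
have sL : tsrc (Lft X h g 1) = F by rewrite EL.
have tL : ttgt (Lft X h g 1) = idF V.
  by rewrite EL mwt -ro1; congr ro; rewrite /= mulg1 mulgV mulg1 mulgV.
have st := modif_tsrc (W3_modif hW WL); have tt := modif_ttgt (W3_modif hW WL).
rewrite -Lft_src -Rgt_tgt in st tt.
split.
- split; last by exists (inv (cob h (cob g iobj))); rewrite EL.
  by split=> //; rewrite Lft_src; exact: (W3_src hW).
- split; last by eexists; exact: IR.
  by split; [rewrite Rgt_tgt; exact: (W3_tgt hW)|exact: (etrans (esym st) sL)|exact: (etrans (esym tt) tL)].
- split; last by eexists; exact: IL.
  by split; rewrite // ?Lft_src ?Rgt_tgt.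
Qed.

(** * The 2-categorical traces inside the monoidal category *)

Definition obT f (w : trans2 V) (Hw : trace2_ob X f w) : mobj :=
  let: And3 Ww _ tw := Hw in @MObj f w Ww tw.

Lemma obT_src f w Hw : tsrc (@obT f w Hw) = idF V.
Proof. by case: Hw. Qed.
Lemma obTE f w Hw : @obT f w Hw = w :> trans2 V.
Proof. by case: Hw. Qed.
Lemma obT_me f w Hw : me (@obT f w Hw) = f.
Proof. by case: Hw. Qed.

Definition arrT f w w' (Hw : trace2_ob X f w) (Hw' : trace2_ob X f w') u :
  arrow3 (C := cat3_of W) w w' u -> mhom (obT Hw) (obT Hw').
Proof.
case: Hw Hw' => [Ww sw tw] [Ww' sw' tw'] [Wu su tu].
apply: (@MHom _ _ (idT (idF V)) u) => //=; first exact: (W_one2 hW (W_one1 hW)).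
by rewrite c1.
Defined.

Lemma arrT_ma f w w' Hw Hw' u Hu : ma (@arrT f w w' Hw Hw' u Hu) = idT (idF V).
Proof. by case: Hw Hw' Hu => [? ? ?] [? ? ?] [? ? ?]. Qed.
Lemma arrT_mx f w w' Hw Hw' u Hu : mx (@arrT f w w' Hw Hw' u Hu) = u.
Proof. by case: Hw Hw' Hu => [? ? ?] [? ? ?] [? ? ?]. Qed.

(** With [inv_cob] this presents psi_g(w) as the conjugate of w divided by the conjugate of the unit
    object. *)
Lemma psi2_cob f g (w : mobj) : tsrc w = idF V -> me w = f -> psi2 X f g w = un g ** cob g w.
Proof.
move=> sw <-; have [Wu su tu _ _] := unP g.
rewrite cobE -[LHS]/(un g ** (ro g |> w |< ro g^-1) ** (ph g (me w) |< ro g^-1)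
  ** ph (g * me w) g^-1).
by rewrite !cA; ty.
Qed.

Lemma psi2_ob f g w : trace2_ob X f w -> trace2_ob X (g * f * g^-1) (psi2 X f g w).
Proof.
move=> Hw; have [Wu su tu _ _] := unP g.
rewrite -(obTE Hw) psi2_cob ?obT_me ?obT_src //; split.
- have sw := obT_src Hw; have S : tsrc (cob g (obT Hw)) = compF (ro g) (ro g^-1).
    by rewrite -[LHS]/(compF (compF (ro g) (tsrc (obT Hw))) (ro g^-1)) sw.
  by rewrite /in2 /=; ty.
- exact: su.
- by rewrite -[LHS]/(ttgt (cob g (obT Hw))) mwt /= obT_me.
Qed.

Lemma inv_cob g (w : mobj) : tsrc w = idF V -> inv (cob g iobj) = un g.
Proof.
move=> sw; have [ok Ei] := okp_iobj sw; have [Wu su tu _ _] := unP g.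
have [_ ->] := cob_okp g ok.
by rewrite Ei wli ?wri ?c2; ty.
Qed.

Lemma DD_arr f w w' (Hw : trace2_ob X f w) (Hw' : trace2_ob X f w') u
  (Hu : arrow3 (C := cat3_of W) w w' u) : DD (mid iobj) (arrT Hw Hw' Hu) u.
Proof.
have [ok Ei] := okp_iobj (obT_src Hw).
have [Wu su tu] := Hu; have W1i := W_one1 hW.
have sw' := obT_src Hw'; have sw := obT_src Hw.
have Wi := W_one2 hW W1i.
rewrite /DD Ei arrT_mx; exists (idM (idT (idF V))); split; try ty.
- by rewrite /= h1 ?hi ?v1 ?c1 //; ty.
- rewrite h1 // ?hi ?c1 ?v2 //; try ty.
  + by rewrite obTE.
  + by have [] := Hw; rewrite -{2}su.
Qed.

Lemma ma_arr f w w' Hw Hw' u Hu : ma (mid iobj) = ma (@arrT f w w' Hw Hw' u Hu).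
Proof. by rewrite arrT_ma. Qed.

Lemma psi3_DD f g w w' (Hw : trace2_ob X f w) (Hw' : trace2_ob X f w') u
  (Hu : arrow3 (C := cat3_of W) w w' u) :
  DD (chom g (mid iobj)) (chom g (arrT Hw Hw' Hu)) (psi3 X f g u).
Proof.
have [ok Ei] := okp_iobj (obT_src Hw); have [ok' _] := okp_iobj (obT_src Hw').
have := DD_conj g ok ok' (ma_arr Hw Hw' Hu) (DD_arr Hw Hw' Hu).
by rewrite obT_me.
Qed.

Lemma ma_chom g (v v' w w' : mobj) (n : mhom v v') (x : mhom w w') : ma n = ma x ->
  ma (chom g n) = ma (chom g x).
Proof. by rewrite !chom_ma => ->. Qed.

Lemma psi3_arrow f g w w' u : trace2_ob X f w -> trace2_ob X f w' ->
  arrow3 (C := cat3_of W) w w' u ->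
  arrow3 (C := cat3_of W) (psi2 X f g w) (psi2 X f g w') (psi3 X f g u).
Proof.
move=> Hw Hw' Hu; have D := psi3_DD g Hw Hw' Hu.
have [ok Ei] := okp_iobj (obT_src Hw); have [ok' _] := okp_iobj (obT_src Hw').
have [okg _] := cob_okp g ok; have [okg' _] := cob_okp g ok'.
have [Wy sy ty'] := DD_typ okg okg' (ma_chom g (ma_arr Hw Hw' Hu)) D.
rewrite (inv_cob g (obT_src Hw)) in sy ty'.
rewrite -{1}(obTE Hw) -{1}(obTE Hw').
rewrite (psi2_cob g (obT_src Hw) (obT_me Hw)).
rewrite (psi2_cob g (obT_src Hw') (obT_me Hw')).
by split.
Qed.

Section GammaFacts.
Variables (f : gT) (w : trans2 V) (Hw : trace2_ob X f w).
Let y := obT Hw.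
Let sy : tsrc y = idF V := obT_src Hw.
Let ey : me y = f := obT_me Hw.

Lemma obT_psi2 g : obT (psi2_ob g Hw) = un g ** cob g y :> trans2 V.
Proof. by rewrite obTE -{1}(obTE Hw) (psi2_cob _ sy ey). Qed.

Lemma psi2_cob2 h g : psi2 X (g * f * g^-1) h (psi2 X f g w) =
  inv (cob h (cob g iobj)) ** cob h (cob g y).
Proof.
have [Wu su tu _ _] := unP g; have [Wuh suh tuh _ _] := unP h.
have [_ ->] := cob2_okp h g sy.
rewrite wli ?wri; [|ty..]; rewrite c2; [|ty..].
rewrite -{1}(obTE (psi2_ob g Hw)) psi2_cob ?obT_src ?obT_me //.
rewrite cobE obT_psi2 obT_me [in RHS]cobE -[me (cob g y)]/(g * me y * g^-1) ey.
have sc : tsrc (cob g y) = compF (ro g) (ro g^-1).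
  by rewrite -[LHS]/(compF (compF (ro g) (tsrc y)) (ro g^-1)) sy.
have mc : me (cob g y) = g * f * g^-1 by rewrite /= ey.
by rewrite wlc; [|ty..]; rewrite wrc; [|ty..]; rewrite !cA; ty.
Qed.

Lemma psi2_cob1 g : psi2 X f g w = inv (cob g iobj) ** cob g y.
Proof. by rewrite (inv_cob g sy) -(obT_psi2 g) obTE. Qed.

Lemma GammaT_DD h g : DD (Ghat h g iobj) (Ghat h g y) (Gamma X f h g w).
Proof. by have := Gamma_DD h g sy; rewrite ey obTE. Qed.

Lemma Gamma_arrow h g :
  arrow3 (C := cat3_of W) (psi2 X (g * f * g^-1) h (psi2 X f g w))
    (psi2 X f (h * g) w) (Gamma X f h g w).
Proof.
have [ok _] := cob2_okp h g sy; have ok' := cob1_okp (h * g) sy.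
have [W1 s1 t1] := DD_typ ok ok' (Ghat_nx h g sy) (GammaT_DD h g).
by rewrite psi2_cob2 psi2_cob1; split.
Qed.

Lemma Gamma_iso h g : exists v, inverse3 (C := cat3_of W) (Gamma X f h g w) v.
Proof.
have [ok _] := cob2_okp h g sy; have ok' := cob1_okp (h * g) sy.
have nx := Ghat_nx h g sy; have D := GammaT_DD h g.
have [n' [nn' n'n]] := miso_Ghat h g iobj.
have [x' [xx' x'x]] := miso_Ghat h g y.
have nx' : ma n' = ma x'.
  apply: inverse_uniq (maW _) (miso_inverse nn' n'n) _.
  by rewrite nx; exact: miso_inverse.
(* The inverse of Gamma is the quotient of the inverse of [Ghat]; both composites are quotients of
   identities, hence identities by uniqueness. *)
have [y' D'] : exists y', DD n' x' y'.
  by eexists; apply: (DD_ex ok' ok x' n'n nn').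
have [W1 s1 t1] := DD_typ ok ok' nx D; have [W2' s2' t2'] := DD_typ ok' ok nx' D'.
have Dm := DD_comp ok ok' ok nx nx' D D'; have Dm' := DD_comp ok' ok ok' nx' nx D' D.
rewrite nn' xx' in Dm; rewrite n'n x'x in Dm'.
have mm A : mcomp (mid A) (mid A) = mid A by rewrite mid_l.
have I A (B : mobj) : okp A B -> DD (mid A) (mid B) (idM (inv A ** B)).
  by move=> okAB; apply: DD_id => //=; case: okAB => _ -> _.
have uq A (B : mobj) z z' : okp A B -> DD (mid A) (mid B) z -> DD (mid A) (mid B) z' -> z = z'.
  by move=> okAB D1 D2; exact: (DD_uniq okAB okAB (mm A) (mm A) D1 D2).
exists y'; split.
- split; [exact: W2' | exact: (etrans s2' (esym t1)) |].
  exact: (etrans t2' (esym s1)).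
- exact: (etrans (uq _ _ _ _ ok Dm (I _ _ ok)) (congr1 (@idM _ _) (esym s1))).
- exact: (etrans (uq _ _ _ _ ok' Dm' (I _ _ ok')) (congr1 (@idM _ _) (esym t1))).
Qed.

End GammaFacts.

Opaque mcomp mtenh alph ialph mid phm mten.

Lemma Ghat_nat h g Y Z (y : mhom Y Z) :
  mcomp (chom h (chom g y)) (Ghat h g Z) = mcomp (Ghat h g Y) (chom (h * g) y).
Proof. exact: (conj_mul_natr (M := Smon) (phm (erefl (h * g))) (phm (VgM h g)) y). Qed.

Transparent mcomp mtenh alph ialph mid phm mten.

Lemma inverse_ten A B (A' B' : trans2 V) : inverse A A' -> inverse B B' ->
  inverse (mten A B) (inv (ph (me A) (me B)) ** ((ro (me A) |> B') ** (A' |< tsrc B))).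
Proof.
move=> iA iB; apply: inverse_comp; [ty|ty|ty| |exact: ph_inverse].
apply: inverse_comp; [ty|ty|ty| |]; first by apply: inverse_wr; [ty|ty|].
by apply: inverse_wl; [ty|ty|].
Qed.

Lemma invertible_ten A B : invertible A -> invertible B -> invertible (mten A B).
Proof. by move=> [A' iA] [B' iB]; exact: (ex_intro _ _ (inverse_ten iA iB)). Qed.

Lemma invertible_eobj h : invertible (eobj h).
Proof. by exists (idT (ro h)); apply: inverse_idT; ty. Qed.

Lemma invertible_iobj : invertible iobj.
Proof. by exists (idT (idF V)); apply: inverse_idT; ty. Qed.

Section Nat.
Variables (f h g : gT) (w w' : trans2 V).
Variables (Hw : trace2_ob X f w) (Hw' : trace2_ob X f w').

(** The two sides are quotients of the two sides of [Ghat_nat], taken at u and at the identity of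
    the unit object. *)
Lemma Gamma_nat u : arrow3 (C := cat3_of W) w w' u ->
  psi3 X (g * f * g^-1) h (psi3 X f g u) ;; Gamma X f h g w' =
  Gamma X f h g w ;; psi3 X f (h * g) u.
Proof.
move=> Hu; set uu := arrT Hw Hw' Hu.
have sy := obT_src Hw; have sy' := obT_src Hw'.
have [ok _] := okp_iobj sy; have [ok' _] := okp_iobj sy'.
have [okg _] := cob_okp g ok; have [okg' _] := cob_okp g ok'.
have [okhg _] := cob2_okp h g sy; have [okhg' _] := cob2_okp h g sy'.
have ok1 := cob1_okp (h * g) sy; have ok1' := cob1_okp (h * g) sy'.
have nx := Ghat_nx h g sy; have nx' := Ghat_nx h g sy'.
have um := ma_arr Hw Hw' Hu.
have D1 := DD_conj h okg okg' (ma_chom g um) (psi3_DD g Hw Hw' Hu).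
rewrite /= obT_me in D1.
have D2 := DD_comp okhg okhg' ok1' (ma_chom h (ma_chom g um)) nx' D1 (GammaT_DD Hw' h g).
have D3 := DD_comp okhg ok1 ok1' nx (ma_chom (h * g) um) (GammaT_DD Hw h g)
  (psi3_DD (h * g) Hw Hw' Hu).
rewrite !Ghat_nat in D2.
have [n' [nn' n'n]] : miso (mcomp (Ghat h g iobj) (chom (h * g) (mid iobj))).
  by apply: miso_comp; [exact: miso_Ghat | apply: miso_chom; exact: miso_mid].
exact: (DD_uniq okhg ok1' nn' n'n D2 D3).
Qed.

End Nat.

(** * Associativity of Gamma *)

Section Triple.
Variables (k h g : gT).

Let A := mten (eobj k) (mten (eobj h) (eobj g)).
Let A' := mten (mten (eobj g^-1) (eobj h^-1)) (eobj k^-1).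

(** This is [conj_mul3] in the present category: fully reassociated, with the outer factors not yet
    multiplied. [xil] and [xir] multiply them in the two possible orders. *)
Definition tri Y : mhom (cob k (cob h (cob g Y))) (mten (mten A Y) A') :=
  mcomp (chom k (cmul h g Y))
   (mcomp (mtenh (alph (eobj k) (mten (mten (eobj h) (eobj g)) Y)
                    (mten (eobj g^-1) (eobj h^-1))) (mid (eobj k^-1)))
     (mcomp (mtenh (mtenh (alph (eobj k) (mten (eobj h) (eobj g)) Y)
                      (mid (mten (eobj g^-1) (eobj h^-1)))) (mid (eobj k^-1)))
        (ialph (mten A Y) (mten (eobj g^-1) (eobj h^-1)) (eobj k^-1)))).

Definition xil : mhom A (eobj (k * (h * g))) :=
  mcomp (mtenh (mid (eobj k)) (phm (erefl (h * g)))) (phm (erefl (k * (h * g)))).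
Definition xil' : mhom A' (eobj (k * (h * g))^-1) :=
  mcomp (mtenh (phm (VgM h g)) (mid (eobj k^-1))) (phm (VgM k (h * g))).
Definition xir : mhom A (eobj (k * h * g)) :=
  mcomp (alph (eobj k) (eobj h) (eobj g))
   (mcomp (mtenh (phm (erefl (k * h))) (mid (eobj g))) (phm (erefl (k * h * g)))).
Definition xir' : mhom A' (eobj (k * h * g)^-1) :=
  mcomp (ialph (eobj g^-1) (eobj h^-1) (eobj k^-1))
   (mcomp (mtenh (mid (eobj g^-1)) (phm (VgM k h))) (phm (VgM (k * h) g))).

Opaque mcomp mtenh alph ialph mid phm mten.

Lemma Ghat_pathl Y : mcomp (chom k (Ghat h g Y)) (Ghat k (h * g) Y) =
  mcomp (tri Y) (mtenh (mtenh xil (mid Y)) xil').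
Proof.
exact: (@conj_pathl Smon (eobj k) (eobj h) (eobj g) (eobj k^-1) (eobj h^-1)
  (eobj g^-1) Y _ _ _ _ (phm (erefl (h * g))) (phm (VgM h g))
  (phm (erefl (k * (h * g)))) (phm (VgM k (h * g)))).
Qed.

Lemma Ghat_pathr Y : mcomp (Ghat k h (cob g Y)) (Ghat (k * h) g Y) =
  mcomp (tri Y) (mtenh (mtenh xir (mid Y)) xir').
Proof.
exact: (@conj_pathr Smon (eobj k) (eobj h) (eobj g) (eobj k^-1) (eobj h^-1)
  (eobj g^-1) Y _ _ _ _ (phm (erefl (k * h))) (phm (VgM k h))
  (phm (erefl (k * h * g))) (phm (VgM (k * h) g))).
Qed.

Transparent mcomp mtenh alph ialph mid phm mten.

Lemma miso_tri Y : miso (tri Y).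
Proof.
apply: miso_comp; first exact/miso_chom/miso_cmul.
apply: miso_comp; first exact: miso_ten (miso_alph _ _ _) (miso_mid _).
apply: miso_comp; last exact: miso_ialph.
by apply: miso_ten (miso_mid _); apply: miso_ten (miso_alph _ _ _) (miso_mid _).
Qed.

Lemma tri_ma Y : ma (tri Y) = idT (tsrc (cob k (cob h (cob g Y)))).
Proof.
rewrite /tri !mcomp_ma chom_ma cmul_ma.
by cbn [ma mtenh alph ialph mid]; idn.
Qed.

Lemma okp_tri (a : gT) (xi : mhom A (eobj a)) (xi' : mhom A' (eobj a^-1)) (y : mobj) :
  tsrc y = idF V -> okp (mten (mten A iobj) A') (mten (mten A y) A').
Proof.
move=> sy; split.
- by have := mhe xi; have := mhe xi' => /= -> ->; rewrite mulg1 mulgV.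
- by rewrite -[LHS]/(compF (compF (tsrc A) (tsrc y)) (tsrc A')) sy.
- have [b Hb] : invertible (mten (mten A iobj) A').
    by do ?[exact: invertible_eobj | exact: invertible_iobj | apply: invertible_ten].
  exact: inverse_inv (mwW _) Hb.
Qed.

End Triple.

Lemma chom_idmx k Y Z (y : mhom Y Z) : mx y = idM Y -> mx (chom k y) = idM (cob k Y).
Proof.
move=> E; rewrite chom_mx E cobE wlI; [|ty..].
by rewrite hiMF !hi; ty.
Qed.

Lemma uI_t g : mtgt (idM iobj) = un g ** cob g iobj.
Proof.
have [Wu su tu pu up] := unP g.
rewrite cobE -[mw iobj]/(idT (idF V)) -[me iobj]/(1 : gT) mulg1 ph1r.
by idn; rewrite up.
Qed.

Lemma unW g : W2 W (un g). Proof. by case: (unP g). Qed.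
Lemma uns g : tsrc (un g) = idF V. Proof. by case: (unP g). Qed.
Lemma unt g : ttgt (un g) = compF (ro g) (ro g^-1). Proof. by case: (unP g). Qed.

(** This morphism to a conjugate and [uT] have identity 3-arrows and the same 2-arrow u_g. So does
    each pair of their conjugates up to whiskering, and the quotient is an identity. *)
Definition uI g : mhom iobj (cob g iobj).
apply: (@MHom _ _ (un g) (idM iobj)) => //=; first by rewrite mulg1 mulgV.
- exact: unW.
- exact: uns.
- exact: unt.
- exact: (W_one3 hW (W_one2 hW (W_one1 hW))).
- exact: uI_t.
Defined.

Lemma uI_ma g : ma (uI g) = un g. Proof. by []. Qed.
Lemma uI_mx g : mx (uI g) = idM iobj. Proof. by []. Qed.

Section Assoc.
Variables (f : gT) (w : trans2 V) (Hw : trace2_ob X f w) (k h g : gT).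
Let y := obT Hw.
Let Hgw : trace2_ob X (g * f * g^-1) (psi2 X f g w) := psi2_ob g Hw.
Let yg := obT Hgw.
Let sy : tsrc y = idF V := obT_src Hw.
Let ey : me y = f := obT_me Hw.
Let syg : tsrc yg = idF V := obT_src Hgw.

Definition uT : mhom yg (cob g y).
apply: (@MHom _ _ (un g) (idM yg)) => //.
- by rewrite /yg obT_me /= ey.
- exact: unW.
- by rewrite uns syg.
- by rewrite unt -[RHS]/(compF (compF (ro g) (tsrc y)) (ro g^-1)) sy.
- exact: (W_one3 hW (mwW yg)).
- exact: obT_psi2.
Defined.

Lemma uT_ma : ma uT = un g. Proof. by []. Qed.
Lemma uT_mx : mx uT = idM yg. Proof. by []. Qed.

(** Replaces the object psi_g(w) by the conjugate of w, where the coherence of [Ghat] applies. *)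
Lemma Gamma_psi2_DD : DD (Ghat k h (cob g iobj)) (Ghat k h (cob g y))
  (Gamma X (g * f * g^-1) k h (psi2 X f g w)).
Proof.
have [okI _] := okp_iobj sy; have [okg _] := cob_okp g okI.
have [okhg _] := cob_okp h okg; have [okkhg _] := cob_okp k okhg.
have [okl _] := cob_okp (k * h) okg.
have [okh' _] := cob2_okp k h syg; have okl' := cob1_okp (k * h) syg.
have D1 := GammaT_DD Hgw k h; rewrite -/yg in D1.
have um : ma (uI g) = ma uT by rewrite uI_ma uT_ma.
(* The comparisons [Dc] and [Dd] along [uI] and [uT] have identity quotients, so naturality of
   [Ghat] identifies Gamma at psi_g(w) with the quotient [D2]. *)
have Dc := DD_id okh' okkhg (ma_chom k (ma_chom h um))
  (chom_idmx k (chom_idmx h (uI_mx g))) (chom_idmx k (chom_idmx h uT_mx)).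
have Dd := DD_id okl' okl (ma_chom (k * h) um)
  (chom_idmx (k * h) (uI_mx g)) (chom_idmx (k * h) uT_mx).
have nx : ma (Ghat k h (cob g iobj)) = ma (Ghat k h (cob g y)).
  rewrite !Ghat_ma -[tsrc (cob g y)]/(compF (compF (ro g) (tsrc y)) (ro g^-1)).
  by rewrite sy.
have nx1 := Ghat_nx k h syg.
have [n' [nn' n'n]] := miso_Ghat k h (cob g iobj).
have D2 := DD_ex okkhg okl (Ghat k h (cob g y)) nn' n'n.
set z := (_ ;; _) in D2.
have E1 := DD_comp okh' okkhg okl (ma_chom k (ma_chom h um)) nx Dc D2.
have E2 := DD_comp okh' okl' okl nx1 (ma_chom (k * h) um) D1 Dd.
rewrite !Ghat_nat in E1.
have [m' [mm' m'm]] : miso (mcomp (Ghat k h iobj) (chom (k * h) (uI g))).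
  apply: miso_comp; [exact: miso_Ghat | apply: miso_chom].
  apply: (miso_cart (uI_mx g) (b := ph g g^-1)); rewrite uI_ma.
  exact: inverse_sym (phW _ _) (ph_inverse _ _).
have [Wz sz tz] := DD_typ okkhg okl nx D2.
have [W1 s1 t1] := DD_typ okh' okl' nx1 D1.
have Ez := DD_uniq okh' okl mm' m'm E1 E2.
rewrite v1 in Ez; [|exact: Wz|].
  rewrite v2 in Ez; [by rewrite -Ez|exact: W1|exact: t1].
have [_ sc tc] := DD_typ okh' okkhg (ma_chom k (ma_chom h um)) Dc.
by rewrite sz; exact: esym tc.
Qed.

(** Both composites are quotients, along the two paths from a triple to a single conjugation. *)
Lemma Gamma_assoc :
  psi3 X (h * (g * f * g^-1) * h^-1) k (Gamma X f h g w) ;; Gamma X f k (h * g) w =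
  Gamma X (g * f * g^-1) k h (psi2 X f g w) ;; Gamma X f (k * h) g w.
Proof.
have [okI _] := okp_iobj sy; have [okg _] := cob_okp g okI.
have [okhg _] := cob_okp h okg; have [okkhg _] := cob_okp k okhg.
have [okl _] := cob_okp (k * h) okg; have ok1 := cob1_okp (h * g) sy.
have [okk1 _] := cob_okp k ok1.
have oke1 := cob1_okp (k * (h * g)) sy; have oke2 := cob1_okp (k * h * g) sy.
have nx1 := Ghat_nx h g sy; have nx2 := Ghat_nx k (h * g) sy.
have nx3 := Ghat_nx (k * h) g sy.
have nx4 : ma (Ghat k h (cob g iobj)) = ma (Ghat k h (cob g y)).
  rewrite !Ghat_ma -[tsrc (cob g y)]/(compF (compF (ro g) (tsrc y)) (ro g^-1)).
  by rewrite sy.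
have D1 := DD_comp okkhg okk1 oke1 (ma_chom k nx1) nx2
  (DD_conj k okhg ok1 nx1 (GammaT_DD Hw h g)) (GammaT_DD Hw k (h * g)).
rewrite -/y -[me (cob h (cob g y))]/(h * (g * me y * g^-1) * h^-1) ey in D1.
have D2 := DD_comp okkhg okl oke2 nx4 nx3 Gamma_psi2_DD (GammaT_DD Hw (k * h) g).
rewrite Ghat_pathl Ghat_pathl in D1; rewrite Ghat_pathr Ghat_pathr in D2.
have okt := okp_tri (xil k h g) (xil' k h g) sy.
have tn : ma (tri k h g iobj) = ma (tri k h g y).
  rewrite !tri_ma -[tsrc (cob k (cob h (cob g y)))]/(compF (compF (ro k)
    (compF (compF (ro h) (compF (compF (ro g) (tsrc y)) (ro g^-1))) (ro h^-1))) (ro k^-1)).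
  by rewrite sy.
have [t' [tt' t't]] := miso_tri k h g iobj.
have Dt := DD_ex okkhg okt (tri k h g y) tt' t't.
have isol : miso (mtenh (mtenh (xil k h g) (mid iobj)) (xil' k h g)).
  by do ?[exact: miso_phm | exact: miso_mid | apply: miso_ten | apply: miso_comp].
have isor : miso (mtenh (mtenh (xir k h g) (mid iobj)) (xir' k h g)).
  by do ?[exact: miso_phm | exact: miso_mid | exact: miso_alph | exact: miso_ialph
     | apply: miso_ten | apply: miso_comp].
(* Both paths begin with [tri] and end with a morphism on the outer factors, whose quotient is the
   same identity. Hence both composites equal the quotient of [tri] followed by that identity. *)
have Dl := DD_shift sy okt isol; have Dr := DD_shift sy okt isor.
have ml : ma (mtenh (mtenh (xil k h g) (mid iobj)) (xil' k h g)) =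
          ma (mtenh (mtenh (xil k h g) (mid y)) (xil' k h g)) by rewrite !shift_ma.
have mr : ma (mtenh (mtenh (xir k h g) (mid iobj)) (xir' k h g)) =
          ma (mtenh (mtenh (xir k h g) (mid y)) (xir' k h g)) by rewrite !shift_ma.
have El := DD_comp okkhg okt oke1 tn ml Dt Dl.
have Er := DD_comp okkhg okt oke2 tn mr Dt Dr.
have [n1 [n1n nn1]] := miso_comp (miso_tri k h g iobj) isol.
have [n2 [n2n nn2]] := miso_comp (miso_tri k h g iobj) isor.
rewrite (DD_uniq okkhg oke1 n1n nn1 D1 El).
by rewrite (DD_uniq okkhg oke2 n2n nn2 D2 Er).
Qed.

End Assoc.

(** * Functoriality and linearity of psi_g *)

Section Psi.
Variables (f g : gT) (w w' w'' : trans2 V).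
Hypotheses (Hw : trace2_ob X f w) (Hw' : trace2_ob X f w') (Hw'' : trace2_ob X f w'').
Local Notation arr := (arrow3 (C := cat3_of W)).

Lemma psi3E u : psi3 X f g u = idM (un g) *** (ro g ||> u ||< ro g^-1)
  *** idM (ph g f |< ro g^-1) *** idM (ph (g * f) g^-1).
Proof. by []. Qed.

Lemma psi3_id : psi3 X f g (idM w) = idM (psi2 X f g w).
Proof.
have [Ww sw tw] : [/\ W2 W w, tsrc w = idF V & ttgt w = ro f] := Hw.
have [Wu su tu pu up] := unP g.
rewrite psi3E wlI; [|ty..]; rewrite hiMF.
by rewrite !hi; ty.
Qed.

Lemma psi3_comp u v : arr w w' u -> arr w' w'' v ->
  psi3 X f g (u ;; v) = psi3 X f g u ;; psi3 X f g v.
Proof.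
move=> Hu Hv.
have [Ww sw tw] : [/\ W2 W w, tsrc w = idF V & ttgt w = ro f] := Hw.
have [Ww' sw' tw'] : [/\ W2 W w', tsrc w' = idF V & ttgt w' = ro f] := Hw'.
have [Wu su tu] : [/\ W3 W u, msrc u = w & mtgt u = w'] := Hu.
have [Wv sv tv] : [/\ W3 W v, msrc v = w' & mtgt v = w''] := Hv.
have [Wn sn tn pu up] := unP g.
rewrite !psi3E wlv; [|ty..].
rewrite -[((_ ;; _) ||< _)]/((ro g ||> u ||< ro g^-1) ;; (ro g ||> v ||< ro g^-1)).
rewrite hlv; [|ty..]; rewrite hrv; [|ty..].
by rewrite hrv; ty.
Qed.

Lemma psi3_add u v : arr w w' u -> arr w w' v ->
  psi3 X f g (addM u v) = addM (psi3 X f g u) (psi3 X f g v).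
Proof.
move=> Hu Hv.
have [Ww sw tw] : [/\ W2 W w, tsrc w = idF V & ttgt w = ro f] := Hw.
have [Ww' sw' tw'] : [/\ W2 W w', tsrc w' = idF V & ttgt w' = ro f] := Hw'.
have [Wu su tu] : [/\ W3 W u, msrc u = w & mtgt u = w'] := Hu.
have [Wv sv tv] : [/\ W3 W v, msrc v = w & mtgt v = w'] := Hv.
have [Wn sn tn pu up] := unP g.
rewrite !psi3E whiskFM_add; [|ty..].
rewrite -[addM _ _ ||< _]/(addM (ro g ||> u ||< ro g^-1) (ro g ||> v ||< ro g^-1)).
rewrite hcompM_addr; [|ty..]; rewrite hcompM_addl; [|ty..].
by rewrite hcompM_addl; ty.
Qed.

Lemma psi3_scale e u : arr w w' u ->
  psi3 X f g (scaleM e u) = scaleM e (psi3 X f g u).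
Proof.
move=> Hu.
have [Ww sw tw] : [/\ W2 W w, tsrc w = idF V & ttgt w = ro f] := Hw.
have [Ww' sw' tw'] : [/\ W2 W w', tsrc w' = idF V & ttgt w' = ro f] := Hw'.
have [Wu su tu] : [/\ W3 W u, msrc u = w & mtgt u = w'] := Hu.
have [Wn sn tn pu up] := unP g.
rewrite !psi3E whiskFM_scale; [|ty..].
rewrite -[scaleM _ _ ||< _]/(scaleM e (ro g ||> u ||< ro g^-1)).
rewrite hcompM_scaler; [|ty..]; rewrite hcompM_scalel; [|ty..].
by rewrite hcompM_scalel; ty.
Qed.

Lemma un1 : un 1 = idT (idF V).
Proof.
rewrite /un invg1 ph1r ro1; apply: invE; first by ty.
by apply: inverse_idT; ty.
Qed.

Lemma psi2_1 : psi2 X f 1 w = w.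
Proof.
have [Ww sw tw] : [/\ W2 W w, tsrc w = idF V & ttgt w = ro f] := Hw.
rewrite -[LHS]/(un 1 ** (ro 1 |> w |< ro 1^-1) ** (ph 1 f |< ro 1^-1) ** ph (1 * f) 1^-1).
rewrite un1 invg1 mul1g ph1l ph1r ro1 whiskFT_idF !whiskTF_idF.
by rewrite c1 ?c2; ty.
Qed.

Lemma psi3_1 u : arr w w' u -> psi3 X f 1 u = u.
Proof.
move=> Hu.
have [Ww sw tw] : [/\ W2 W w, tsrc w = idF V & ttgt w = ro f] := Hw.
have [Wu su tu] : [/\ W3 W u, msrc u = w & mtgt u = w'] := Hu.
rewrite -[LHS]/(idM (un 1) *** (ro 1 ||> u ||< ro 1^-1)
  *** idM (ph 1 f |< ro 1^-1) *** idM (ph (1 * f) 1^-1)).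
rewrite un1 invg1 mul1g ph1l ph1r ro1 whiskFM_idF whiskMF_idF whiskTF_idF.
by rewrite h1 ?h2; ty.
Qed.

End Psi.
End Monoidal.

(** * Transport of natural transformations along psi_h *)

Section Transport.

Variables (K : fieldType) (gT : finGroupType) (V : lin2cat K) (W : sub3 V).
Hypothesis hW : strict_sub3 W.
Variable X : rep3 gT (cat3_of W).
Hypothesis hX : is_rep3 X [set: gT].

Local Open Scope group_scope.
Local Notation "u ;; v" := (vcompM u v) (at level 55, right associativity).
Local Notation arr := (arrow3 (C := cat3_of W)).
Local Notation T := (trace2_ob X).
Local Notation F := (psi2 X).
Local Notation Fm := (psi3 X).
Local Notation G := (Gamma X).

Implicit Types (x y z g h k : gT) (c d e w : trans2 V) (u v : modif V).

(** Here and below, relations between group elements are hypotheses rather than substituted terms,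
    so that the rules apply when an index is only provably the expected one. *)
Lemma T_F x y g w : g * x * g^-1 = y -> T x w -> T y (F x g w).
Proof. by move=> <-; exact: psi2_ob. Qed.

Lemma G_arr x y h g k w : g * x * g^-1 = y -> h * g = k -> T x w ->
  arr (F y h (F x g w)) (F x k w) (G x h g w).
Proof. by move=> <- <- Hw; exact: Gamma_arrow. Qed.

Lemma G_nat x y h g k w w' u : g * x * g^-1 = y -> h * g = k -> T x w ->
  T x w' -> arr w w' u ->
  Fm y h (Fm x g u) ;; G x h g w' = G x h g w ;; Fm x k u.
Proof. by move=> <- <- Hw Hw'; exact: Gamma_nat. Qed.

Lemma G_assoc x y z k h g p q w : g * x * g^-1 = y -> h * y * h^-1 = z ->
  h * g = p -> k * h = q -> T x w ->
  Fm z k (G x h g w) ;; G x k p w = G y k h (F x g w) ;; G x q g w.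
Proof. by move=> <- <- <- <- Hw; exact: Gamma_assoc. Qed.

Definition iG x h g w : modif V := inv3 (C := cat3_of W) (G x h g w).

Lemma iG_arr x y h g k w : g * x * g^-1 = y -> h * g = k -> T x w ->
  [/\ arr (F x k w) (F y h (F x g w)) (iG x h g w),
      G x h g w ;; iG x h g w = idM (F y h (F x g w))
    & iG x h g w ;; G x h g w = idM (F x k w)].
Proof.
move=> exy ek Hw; have [WG sG tG] := G_arr exy ek Hw.
have [v Hv] := Gamma_iso hW hX Hw h g; have E := inv3E hW WG Hv.
rewrite /iG E; case: Hv => [[Wv sv tv] gv vg].
by split; [split; rewrite ?sv ?tv | apply: (etrans gv); rewrite sG | apply: (etrans vg); rewrite tG].
Qed.

Ltac bnd := cbn [msrc mtgt vcompM idM]; congruence.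
Ltac arrs := first [ assumption | lazymatch goal with
  | |- W3 _ (vcompM _ _) => apply: (W_op2_33 hW); [arrs|arrs|bnd]
  | |- W3 _ (idM _) => apply: (W_one3 hW); arrs
  | |- _ = _ => bnd end ].

Lemma arrM a b c u v : arr a b u -> arr b c v -> arr a c (u ;; v).
Proof.
move=> [Wu su tu] [Wv sv tv]; split; [|exact: su|exact: tv].
by apply: (W_op2_33 hW) => //; rewrite [LHS]tu.
Qed.

Lemma vAa a b c d u v (r : modif V) : arr a b u -> arr b c v -> arr c d r ->
  (u ;; v) ;; r = u ;; v ;; r.
Proof.
by move=> [? ? ?] [? ? ?] [? ? ?]; simpl in *; rewrite -!(vA hW) //; arrs.
Qed.

Lemma vcancel a b c u u' v v' : arr a b u -> arr a b u' -> arr b c v ->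
  arr c b v' -> v ;; v' = idM b -> u ;; v = u' ;; v -> u = u'.
Proof.
move=> [Wu su tu] [Wu' su' tu'] [Wv sv tv] [Wv' sv' tv'] vv' E.
rewrite /= in su tu su' tu' sv tv sv' tv'.
have : (u ;; v) ;; v' = (u' ;; v) ;; v' by rewrite E.
by rewrite -!(vA hW) ?vv' ?(v2 hW) //; arrs.
Qed.

Lemma vcancell a b c u u' v v' : arr b c u -> arr b c u' -> arr a b v ->
  arr b a v' -> v' ;; v = idM b -> v ;; u = v ;; u' -> u = u'.
Proof.
move=> [Wu su tu] [Wu' su' tu'] [Wv sv tv] [Wv' sv' tv'] vv' E.
rewrite /= in su tu su' tu' sv tv sv' tv'.
have : v' ;; (v ;; u) = v' ;; (v ;; u') by rewrite E.
by rewrite !(vA hW) ?vv' ?(v1 hW) //; arrs.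
Qed.

Lemma Fm_arr x y g w w' u : g * x * g^-1 = y -> T x w -> T x w' -> arr w w' u ->
  arr (F x g w) (F x g w') (Fm x g u).
Proof. by move=> _; exact: psi3_arrow. Qed.

Lemma F1 x w : T x w -> F x 1 w = w.
Proof. exact: (psi2_1 hW hX). Qed.
Lemma Fm1 x w w' u : T x w -> arr w w' u -> Fm x 1 u = u.
Proof. by move=> Hw; apply: psi3_1. Qed.

Lemma Fm_comp x g w w' w'' u v : T x w -> T x w' -> T x w'' -> arr w w' u ->
  arr w' w'' v -> Fm x g (u ;; v) = Fm x g u ;; Fm x g v.
Proof. by move=> Hw Hw' Hw''; exact: psi3_comp. Qed.
Lemma Fm_id x g w : T x w -> Fm x g (idM w) = idM (F x g w).
Proof. exact: psi3_id. Qed.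

Lemma conj1 x : 1 * x * 1^-1 = x. Proof. by rewrite invg1 mul1g mulg1. Qed.

(** Associativity for the triple (1, 1, g), with the common last factor Gamma_(1,g) cancelled. *)
Lemma G_1l x y g w : g * x * g^-1 = y -> T x w -> G x 1 g w = G y 1 1 (F x g w).
Proof.
move=> gx Hw; have E := G_assoc gx (conj1 y) (mul1g g) (mul1g 1) Hw.
have Hg := T_F gx Hw; have A := G_arr gx (mul1g g) Hw; rewrite (F1 Hg) in A.
rewrite (Fm1 Hg A) in E.
have B := G_arr (conj1 y) (mul1g 1) Hg; rewrite !(F1 Hg) in B.
have [C gC _] := iG_arr gx (mul1g g) Hw; rewrite (F1 Hg) in C gC.
exact: (vcancel A B A C gC E).
Qed.

(** Associativity for the triple (g, 1, 1), with the common last factor Gamma_(g,1) cancelled. *)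
Lemma G_1r x y g w : g * x * g^-1 = y -> T x w -> G x g 1 w = Fm x g (G x 1 1 w).
Proof.
move=> gx Hw; have E := G_assoc (conj1 x) (conj1 x) (mul1g 1) (mulg1 g) Hw.
have A := G_arr (conj1 x) (mulg1 g) Hw; rewrite (F1 Hw) in E A.
have B := G_arr (conj1 x) (mul1g 1) Hw; rewrite !(F1 Hw) in B.
have [C gC _] := iG_arr (conj1 x) (mulg1 g) Hw; rewrite (F1 Hw) in C gC.
exact: (vcancel A (Fm_arr gx Hw Hw B) A C gC (esym E)).
Qed.

Lemma G11_arr x w : T x w -> arr w w (G x 1 1 w).
Proof. by move=> Hw; have := G_arr (conj1 x) (mul1g 1) Hw; rewrite !(F1 Hw). Qed.

Lemma G11_iso x w : T x w -> [/\ arr w w (iG x 1 1 w),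
  G x 1 1 w ;; iG x 1 1 w = idM w & iG x 1 1 w ;; G x 1 1 w = idM w].
Proof. by move=> Hw; have := iG_arr (conj1 x) (mul1g 1) Hw; rewrite !(F1 Hw). Qed.

Lemma G11_nat x w w' u : T x w -> T x w' -> arr w w' u ->
  u ;; G x 1 1 w' = G x 1 1 w ;; u.
Proof.
move=> Hw Hw' Hu; have := G_nat (conj1 x) (mul1g 1) Hw Hw' Hu.
by rewrite !(Fm1 Hw Hu).
Qed.

Lemma paste a a' b b' c c' u v q (f1 f2 f1' f2' : modif V) :
  arr a b f1 -> arr b c f2 -> arr a' b' f1' -> arr b' c' f2' ->
  arr a a' u -> arr b b' v -> arr c c' q ->
  u ;; f1' = f1 ;; v -> v ;; f2' = f2 ;; q ->
  u ;; (f1' ;; f2') = (f1 ;; f2) ;; q.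
Proof.
move=> [? ? ?] [? ? ?] [? ? ?] [? ? ?] [? ? ?] [? ? ?] [? ? ?] E1 E2.
simpl in *.
rewrite (vA hW) ?E1; try by arrs.
by rewrite -!(vA hW) ?E2; try by arrs.
Qed.

Lemma inv_nat a a' b b' u v (f1 f1' p p' : modif V) : arr a b f1 -> arr a' b' f1' ->
  arr a a' u -> arr b b' v ->
  arr b a p -> p ;; f1 = idM b -> arr b' a' p' -> f1' ;; p' = idM a' ->
  u ;; f1' = f1 ;; v -> v ;; p' = p ;; u.
Proof.
move=> [? ? ?] [? ? ?] [? ? ?] [? ? ?] [? ? ?] E1 [? ? ?] E2 E; simpl in *.
have : p ;; (u ;; f1') ;; p' = p ;; (f1 ;; v) ;; p' by rewrite E.
rewrite -!(vA hW) ?E2; try by arrs.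
rewrite (v2 hW) ?[p ;; (f1 ;; _)](vA hW) ?E1; try by arrs.
by move=> ->; rewrite (v1 hW) //; arrs.
Qed.

Lemma vswap a b b' c d u v (u' v' r : modif V) : arr a b u -> arr b c v ->
  arr a b' u' -> arr b' c v' -> arr c d r -> u ;; v = u' ;; v' ->
  u ;; (v ;; r) = u' ;; (v' ;; r).
Proof.
move=> [? ? ?] [? ? ?] [? ? ?] [? ? ?] [? ? ?] E; simpl in *.
by rewrite !(vA hW) ?E //; arrs.
Qed.

Lemma vcut a b c u v r : arr a b u -> arr b a v -> arr a c r ->
  u ;; v = idM a -> u ;; (v ;; r) = r.
Proof.
move=> [? ? ?] [? ? ?] [? ? ?] E; simpl in *.
by rewrite (vA hW) ?E ?(v1 hW) //; arrs.
Qed.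

Lemma vA6 a b c d e i j u1 u2 u3 u4 u5 u6 : arr a b u1 -> arr b c u2 ->
  arr c d u3 -> arr d e u4 -> arr e i u5 -> arr i j u6 ->
  ((((u1 ;; u2) ;; u3) ;; u4) ;; u5) ;; u6 = u1 ;; u2 ;; u3 ;; u4 ;; u5 ;; u6.
Proof.
move=> [? ? ?] [? ? ?] [? ? ?] [? ? ?] [? ? ?] [? ? ?]; simpl in *.
by rewrite -!(vA hW) //; arrs.
Qed.

Definition nat_trans x g (th : trans2 V -> modif V) :=
  (forall c, T x c -> arr c (F x g c) (th c)) /\
  (forall c d u, T x c -> T x d -> arr c d u -> u ;; th d = th c ;; Fm x g u).

Section Psi.
Variables (x y h g g' : gT).
Hypotheses (xy : h * x * h^-1 = y) (gx : g * x * g^-1 = x) (gg' : h * g * h^-1 = g').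

Lemma yx : h^-1 * y * h^-1^-1 = x.
Proof. by rewrite -xy invgK !mulgA mulVg mul1g mulgKV. Qed.
Lemma g'y : g' * y * g'^-1 = y.
Proof.
by rewrite -gg' -xy -[in RHS]gx !invMg invgK !mulgA !mulgKV.
Qed.

(** For x = y this is the map that psi_h induces on the categorical trace ([trace_mapE]). Letting h
    carry x to another y puts these maps and conjugation by elements of the group in one family. *)
Definition Psi (th : trans2 V -> modif V) (c : trans2 V) : modif V :=
  (((iG y 1 1 c ;; iG y h h^-1 c) ;; Fm x h (th (F y h^-1 c))) ;;
   G x h g (F y h^-1 c)) ;; G y (h * g) h^-1 c.

Variable th : trans2 V -> modif V.
Hypothesis nth : nat_trans x g th.

Lemma Psi_facts c : T y c -> let c' := F y h^-1 c in
  [/\ T x c', arr c c (iG y 1 1 c), arr c (F x h c') (iG y h h^-1 c),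
      arr (F x h c') (F x h (F x g c')) (Fm x h (th c')) &
      arr (F x h (F x g c')) (F x (h * g) c') (G x h g c') /\
      arr (F x (h * g) c') (F y g' c) (G y (h * g) h^-1 c)].
Proof.
move=> Hc c'; have Hc' : T x c' := T_F yx Hc.
have [A _ _] := G11_iso Hc; have [B _ _] := iG_arr yx (mulgV h) Hc.
rewrite (F1 Hc) in B; have [N _] := nth.
split=> //; first exact: Fm_arr xy Hc' (T_F gx Hc') (N _ Hc').
by split; [exact: G_arr | exact: (G_arr yx gg' Hc)].
Qed.

Lemma Psi_arr c : T y c -> arr c (F y g' c) (Psi th c).
Proof.
move=> Hc; have [_ A B C [D E]] := Psi_facts Hc.
exact: arrM (arrM (arrM (arrM A B) C) D) E.
Qed.


(** Pastes the naturality squares of the five arrows in [Psi]; only the middle one concerns [th]. *)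
Lemma Psi_nat : nat_trans y g' (Psi th).
Proof.
split=> [c|c d u Hc Hd Hu]; first exact: Psi_arr.
have [_ A B N [D E]] := Psi_facts Hc.
have [_ A' B' N' [D' E']] := Psi_facts Hd.
have Hc' := T_F yx Hc; have Hd' := T_F yx Hd.
have Hu' := Fm_arr yx Hc Hd Hu.
have uh := Fm_arr xy Hc' Hd' Hu'.
have ug := Fm_arr gx Hc' Hd' Hu'.
have uhg := Fm_arr xy (T_F gx Hc') (T_F gx Hd') ug.
have hgy : h * g * x * (h * g)^-1 = y by rewrite invMg mulgA -!(mulgA h) gx !mulgA.
have ugh := Fm_arr hgy Hc' Hd' Hu'.
have ug' := Fm_arr g'y Hc Hd Hu.
rewrite /Psi.
have P1 := arrM A B; have P1' := arrM A' B'.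
have P2 := arrM P1 N; have P2' := arrM P1' N'.
have P3 := arrM P2 D; have P3' := arrM P2' D'.
apply: (paste P3 E P3' E' Hu ugh ug'); last first.
  by rewrite -(G_nat yx gg' Hc Hd Hu).
apply: (paste P2 D P2' D' Hu uhg ugh); last first.
  by rewrite (G_nat gx erefl Hc' Hd' Hu').
apply: (paste P1 N P1' N' Hu uh uhg); last first.
  have [nth1 nth2] := nth.
  rewrite -(Fm_comp _ Hc' Hd' (T_F gx Hd') Hu' (nth1 _ Hd')).
  rewrite -(Fm_comp _ Hc' (T_F gx Hc') (T_F gx Hd') (nth1 _ Hc') ug).
  by rewrite (nth2 _ _ _ Hc' Hd' Hu').
apply: (paste A B A' B' Hu Hu uh).
  have [Ac _ gc] := G11_iso Hc; have [Ad gd _] := G11_iso Hd.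
  exact: (inv_nat (G11_arr Hc) (G11_arr Hd) Hu Hu Ac gc Ad gd (G11_nat Hc Hd Hu)).
have [Ac _ gc] := iG_arr yx (mulgV h) Hc; have [Ad gd _] := iG_arr yx (mulgV h) Hd.
have gac := G_arr yx (mulgV h) Hc; have gad := G_arr yx (mulgV h) Hd.
rewrite ?(F1 Hc) ?(F1 Hd) in Ac Ad gc gd gac gad.
apply: (inv_nat gac gad uh Hu Ac gc Ad gd).
by have := G_nat yx (mulgV h) Hc Hd Hu; rewrite (Fm1 Hc Hu).
Qed.

(* Up to the structure isomorphisms, [Psi th] is [th] transported along [F x h]. *)
Lemma Psi_F d : T x d ->
  Psi th (F x h d) ;; G x g' h d = Fm x h (th d) ;; G x h g d.
Proof.
move=> Hd; set c := F x h d; have Hc : T y c := T_F xy Hd.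
have [_ A B N [D E]] := Psi_facts Hc; have Hc' := T_F yx Hc.
set t := G x h^-1 h d.
have Ht : arr (F y h^-1 c) d t by have := G_arr xy (mulVg h) Hd; rewrite (F1 Hd).
have [nth1 nth2] := nth.
have hgy : h * g * x * (h * g)^-1 = y by rewrite invMg mulgA -!(mulgA h) gx !mulgA.
have g'h : g' * h = h * g by rewrite -gg' mulgKV.
have G1 := G11_arr Hd.
have E1 : G y (h * g) h^-1 c ;; G x g' h d = Fm x (h * g) t ;; Fm x (h * g) (G x 1 1 d).
  by rewrite -(G_assoc xy yx (mulVg h) gg' Hd) (G_1r hgy Hd).
have E2 : G x h g (F y h^-1 c) ;; Fm x (h * g) t = Fm x h (Fm x g t) ;; G x h g d.
  by rewrite (G_nat gx erefl Hc' Hd Ht).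
have E3 : G x h g d ;; Fm x (h * g) (G x 1 1 d) = Fm x h (Fm x g (G x 1 1 d)) ;; G x h g d.
  by rewrite (G_nat gx erefl Hd Hd G1).
have E4 : Fm x h (th (F y h^-1 c)) ;; Fm x h (Fm x g t) = Fm x h t ;; Fm x h (th d).
  rewrite -(Fm_comp _ Hc' (T_F gx Hc') (T_F gx Hd) (nth1 _ Hc') (Fm_arr gx Hc' Hd Ht)).
  by rewrite -(nth2 _ _ _ Hc' Hd Ht) (Fm_comp _ Hc' Hd (T_F gx Hd) Ht (nth1 _ Hd)).
have E5 : Fm x h (th d) ;; Fm x h (Fm x g (G x 1 1 d)) = Fm x h (G x 1 1 d) ;; Fm x h (th d).
  rewrite -(Fm_comp _ Hd (T_F gx Hd) (T_F gx Hd) (nth1 _ Hd) (Fm_arr gx Hd Hd G1)).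
  by rewrite -(nth2 _ _ _ Hd Hd G1) (Fm_comp _ Hd Hd (T_F gx Hd) G1 (nth1 _ Hd)).
have E6 : Fm x h t ;; Fm x h (G x 1 1 d) = G y h h^-1 c ;; G y 1 1 c.
  rewrite -(G_1r xy Hd) (G_assoc xy yx (mulVg h) (mulgV h) Hd).
  by rewrite (G_1l xy Hd).
have [_ _ E7] := G11_iso Hc; have [_ _ E8] := iG_arr yx (mulgV h) Hc.
have aB := G_arr yx (mulgV h) Hc; rewrite (F1 Hc) in E8 aB.
have ht := Fm_arr xy Hc' Hd Ht; have hgt := Fm_arr xy (T_F gx Hc') (T_F gx Hd) (Fm_arr gx Hc' Hd Ht).
have khgt := Fm_arr hgy Hc' Hd Ht; have hG1 := Fm_arr xy Hd Hd G1.
have gG1 := Fm_arr xy (T_F gx Hd) (T_F gx Hd) (Fm_arr gx Hd Hd G1).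
have hgG1 := Fm_arr hgy Hd Hd G1; have aG := G_arr gx erefl Hd : arr _ (F x (h * g) d) (G x h g d).
have thd := Fm_arr xy Hd (T_F gx Hd) (nth1 _ Hd).
have aG' : arr (F y g' c) (F x (h * g) d) (G x g' h d) := G_arr xy g'h Hd.
have aG1 := G11_arr Hc.
rewrite /Psi -/c (vA6 A B N D E aG') E1.
rewrite (vswap D khgt hgt aG hgG1 E2) E3.
have aR := arrM gG1 aG; rewrite (vswap N hgt ht thd aR E4).
rewrite (vswap thd gG1 hG1 thd aG E5).
have aS := arrM thd aG.
have aG1' := G_arr yx (mulgV h) Hc; rewrite (F1 Hc) in aG1'.
rewrite (vswap ht hG1 aG1' aG1 aS E6).
by rewrite (vcut B aB (arrM aG1 aS) E8) (vcut A aG1 aS E7).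
Qed.

Lemma Psi_add th' c : nat_trans x g th' -> T y c ->
  Psi (fun d => addM (th d) (th' d)) c = addM (Psi th c) (Psi th' c).
Proof.
move=> nth' Hc; have [_ A B N [D E]] := Psi_facts Hc; have Hc' := T_F yx Hc.
have N' := Fm_arr xy Hc' (T_F gx Hc') (proj1 nth' _ Hc').
rewrite /Psi (psi3_add hW hX _ Hc' (T_F gx Hc') (proj1 nth _ Hc') (proj1 nth' _ Hc')).
move: (iG y 1 1 c ;; iG y h h^-1 c) (arrM A B) => P [Wp sp tp].
have M u : W3 W u -> is_modif u by apply: W3_modif.
have [Wn sn tn] := N; have [Wn' sn' tn'] := N'.
have [Wd sd td] := D; have [We se te] := E; cbn [s3 t3 in3 cat3_of] in *.
rewrite (vcompM_addr (M _ Wp) (M _ Wn) (M _ Wn')); try by bnd.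
rewrite (vcompM_addl (M _ (W_op2_33 hW Wp Wn _)) (M _ (W_op2_33 hW Wp Wn' _)) (M _ Wd)); try by bnd.
by rewrite vcompM_addl; try by [bnd | apply: M; arrs].
Qed.

Lemma Psi_scale (a : K) c : T y c ->
  Psi (fun d => scaleM a (th d)) c = scaleM a (Psi th c).
Proof.
move=> Hc; have [_ A B N [D E]] := Psi_facts Hc; have Hc' := T_F yx Hc.
rewrite /Psi (psi3_scale hW hX _ Hc' (T_F gx Hc') _ (proj1 nth _ Hc')).
move: (iG y 1 1 c ;; iG y h h^-1 c) (arrM A B) => P [Wp sp tp].
have M u : W3 W u -> is_modif u by apply: W3_modif.
have [Wn sn tn] := N.
have [Wd sd td] := D; have [We se te] := E; cbn [s3 t3 in3 cat3_of] in *.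
rewrite vcompM_scaler; try by [bnd | apply: M; arrs].
rewrite vcompM_scalel; try by [bnd | apply: M; arrs].
by rewrite vcompM_scalel; try by [bnd | apply: M; arrs].
Qed.

End Psi.

(** With this, equalities such as [Psi_comp] need checking only at objects in the image of psi,
    where [Psi_F] applies. *)
Lemma nat_iso x g th th' c d u v : g * x * g^-1 = x ->
  nat_trans x g th -> nat_trans x g th' ->
  T x c -> T x d -> arr c d u -> arr d c v -> u ;; v = idM c ->
  th d = th' d -> th c = th' c.
Proof.
move=> gx [n1 n2] [n1' n2'] Hc Hd Hu Hv uv E.
have Au := Fm_arr gx Hc Hd Hu; have Av := Fm_arr gx Hd Hc Hv.
apply: (vcancel (n1 _ Hc) (n1' _ Hc) Au Av); last by rewrite -(n2 _ _ _ Hc Hd Hu) E (n2' _ _ _ Hc Hd Hu).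
by rewrite -(Fm_comp _ Hc Hd Hc Hu Hv) uv (Fm_id _ Hc).
Qed.

Lemma Psi_ext y x h g th th' c : T y c -> h^-1 * y * h^-1^-1 = x ->
  (forall d, T x d -> th d = th' d) -> Psi x y h g th c = Psi x y h g th' c.
Proof. by move=> Hc yx E; rewrite /Psi E //; exact: T_F yx Hc. Qed.

(** The case h = 1 of [Psi_F]: [G_1l] and [G_1r] express both constraints through Gamma_(1,1), which
    is natural and cancels. *)
Lemma Psi_1 x g th c : g * x * g^-1 = x -> nat_trans x g th -> T x c ->
  Psi x x 1 g th c = th c.
Proof.
move=> gx nth Hc.
have gg : 1 * g * 1^-1 = g by rewrite invg1 mul1g mulg1.
have := Psi_F (conj1 x) gx gg nth Hc; rewrite (F1 Hc) (G_1l gx Hc).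
have [n1 n2] := nth; rewrite (Fm1 Hc (n1 _ Hc)) (G11_nat Hc (T_F gx Hc) (n1 _ Hc)).
rewrite (n2 _ _ _ Hc Hc (G11_arr Hc)) (G_1r gx Hc).
have A := Fm_arr gx Hc Hc (G11_arr Hc); have [B C _] := G11_iso Hc.
have B' := Fm_arr gx Hc Hc B.
apply: (vcancel _ (n1 _ Hc) A B').
  by have := Psi_arr (conj1 x) gx gg nth Hc.
by rewrite -(Fm_comp _ Hc Hc Hc (G11_arr Hc) B) C (Fm_id _ Hc).
Qed.

(** Both sides are determined by [Psi_F]; the two descriptions are linked by associativity of Gamma
    for the triples (h, k, g), (h, g', k) and (g'', h, k). *)
Lemma Psi_comp x y z k h g g' g'' th c : k * x * k^-1 = y -> h * y * h^-1 = z ->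
  g * x * g^-1 = x -> k * g * k^-1 = g' -> h * g' * h^-1 = g'' ->
  nat_trans x g th -> T z c ->
  Psi y z h g' (Psi x y k g th) c = Psi x z (h * k) g th c.
Proof.
move=> xy yz gx gg' g'g'' nth Hc.
have xz : h * k * x * (h * k)^-1 = z by rewrite invMg -yz -xy !mulgA.
have gg'' : h * k * g * (h * k)^-1 = g'' by rewrite invMg -g'g'' -gg' !mulgA.
have g'y1 := g'y xy gx gg'; have g''z := g'y yz g'y1 g'g''; have g'y := g'y1.
have nA := Psi_nat xy gx gg' nth; have nB := Psi_nat yz g'y g'g'' nA.
have nD := Psi_nat xz gx gg'' nth.
have zy := yx yz; have Hc' := T_F zy Hc; have yx' := yx xy.
set d := F y k^-1 (F z h^-1 c); have Hd : T x d := T_F yx' Hc'.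
have Hk := T_F xy Hd; have Hh := T_F yz Hk.
have [B1 gB1 _] := iG_arr zy (mulgV h) Hc; have B2 := G_arr zy (mulgV h) Hc.
have [_ _ B3] := iG_arr zy (mulgV h) Hc; rewrite (F1 Hc) in B1 B2 B3.
(* The object c is isomorphic to psi_h psi_(h^-1) c and, in the next reduction, to psi_h psi_k d, so
   the equality is needed only there. *)
apply: (nat_iso g''z nB nD Hc (T_F yz Hc') B1 B2 B3).
have [C1 _ C3] := iG_arr yx' (mulgV k) Hc'; have C2 := G_arr yx' (mulgV k) Hc'.
rewrite (F1 Hc') in C1 C2 C3.
have C3' := Fm_comp h Hc' (T_F xy Hd) Hc' C1 C2; rewrite C3 (Fm_id _ Hc') in C3'.
apply: (nat_iso g''z nB nD (T_F yz Hc') Hh (Fm_arr yz Hc' (T_F xy Hd) C1) (Fm_arr yz (T_F xy Hd) Hc' C2) (esym C3')).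
rewrite -/d.
set t := G x h k d; have Ht : arr (F y h (F x k d)) (F x (h * k) d) t := G_arr xy erefl Hd.
have g'k : g' * k = k * g by rewrite -gg' mulgKV.
have hg' : g'' * h = h * g' by rewrite -g'g'' mulgKV.
have Hhk := T_F xz Hd.
have [n1 n2] := nth.
have PB := Psi_F yz g'y g'g'' nA Hk; have PA := Psi_F xy gx gg' nth Hd.
have PD := Psi_F xz gx gg'' nth Hd.
have ND := proj2 nD _ _ _ Hh Hhk Ht.
have a1 := G_assoc xy yz erefl hg' Hd.
have a2 := G_assoc xy g'y g'k (erefl (h * g')) Hd.
have a3 := G_assoc gx xy erefl (erefl (h * k)) Hd.
have Hg := T_F gx Hd; have Hg' := T_F g'y Hk; have Hgk := T_F xy Hg.
have N3 := G_nat xy (erefl (h * k)) Hd Hg (n1 _ Hd).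
have aA := proj1 nA _ Hk; have aB := proj1 nB _ Hh; have aD := proj1 nD _ Hh.
have aD' := proj1 nD _ Hhk.
have aY := G_arr yz hg' Hk; have aZ := G_arr xy (erefl (h * g' * k)) Hd.
have [aY' eY _] := iG_arr yz hg' Hk; have [aZ' eZ _] := iG_arr xy (erefl (h * g' * k)) Hd.
have aV := G_arr g'y (erefl (h * g')) Hk; have hA := Fm_arr yz Hk Hg' aA.
have bG := G_arr xy g'k Hd; have hkg : k * g * x * (k * g)^-1 = y.
  by rewrite invMg mulgA -!(mulgA k) gx !mulgA.
have Hkg := T_F hkg Hd.
have hbG := Fm_arr yz Hg' Hkg bG.
have aR := G_arr hkg (erefl (h * (k * g))) Hd.
have hkgz : h * k * g * x * (h * k * g)^-1 = z.
  by rewrite -yz -[in RHS]hkg !invMg !mulgA.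
have aQ := G_arr gx (erefl (h * k * g)) Hd.
have k1 := Fm_arr xy Hd Hg (n1 _ Hd); have bk := G_arr gx (erefl (k * g)) Hd.
have hk1 := Fm_arr yz Hk (T_F xy Hg) k1; have hbk := Fm_arr yz (T_F xy Hg) Hkg bk.
have aT := G_arr xy (erefl (h * k)) Hg; have f1 := Fm_arr xz Hd Hg (n1 _ Hd).
have g3 := Fm_arr g''z Hh Hhk Ht; have aW := G_arr xz (erefl (g'' * (h * k))) Hd.
(* Two invertible Gammas are appended to both sides so that each occurrence of [Psi] meets the Gamma
   required by [Psi_F]. *)
apply: (vcancel aB aD aY aY' eY).
apply: (vcancel (arrM aB aY) (arrM aD aY) aZ aZ' eZ).
rewrite PB (vAa hA aV aZ) -a2 -(vAa hA hbG aR) -(Fm_comp _ Hk Hg' Hkg aA bG) PA.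
rewrite (Fm_comp _ Hk (T_F xy Hg) Hkg k1 bk) (vAa hk1 hbk aR) a3 -(vAa hk1 aT aQ) N3.
rewrite (vAa aD aY aZ) -a1 -(vAa aD g3 aW) -ND (vAa Ht aD' aW) PD.
by rewrite -(vAa Ht f1 aQ).
Qed.

End Transport.

(** * From a subgroup to a group in its own right *)

Section Subgroup.

Variables (K : fieldType) (gT : finGroupType) (V : lin2cat K) (W : sub3 V).
Hypothesis hW : strict_sub3 W.
Variables (H : {group gT}) (X : rep3 gT (cat3_of W)).
Hypothesis hX : is_rep3 X H.
Local Open Scope group_scope.

(** The preceding parts take a representation of a whole group type; [H] becomes one, and the
    results are read back for elements of the ambient group. *)
Definition subg_rep3 : rep3 (subg_of H) (cat3_of W) :=
  Rep3 (C := cat3_of W) (fun u => rho X (sgval u))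
    (fun u v => phi X (sgval u) (sgval v))
    (fun u v w => Phi X (sgval u) (sgval v) (sgval w)).

Lemma is_rep3_subg : is_rep3 subg_rep3 [set: subg_of H].
Proof.
have sH (u : subg_of H) : sgval u \in H := subgP u.
split.
- by move=> u _; apply: (rho_in1 hX).
- by move=> u _; apply: (rho_equiv hX).
- by move=> u v _ _; apply: (phi_iso2 hX).
- by move=> u v w _ _ _; apply: (Phi_iso3 hX).
- exact: (rho_1 hX).
- by move=> u _; apply: (phi_1l hX).
- by move=> u _; apply: (phi_1r hX).
- by move=> a b c _ _ _ d _; apply: (Phi_cocycle hX).
Qed.

Local Notation arr := (arrow3 (C := cat3_of W)).
Local Notation T := (trace2_ob X).
Local Notation Xs := subg_rep3.
Local Notation hXs := is_rep3_subg.

Lemma subg_psi2 u v w : psi2 Xs u v w = psi2 X (sgval u) (sgval v) w.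
Proof. by []. Qed.
Lemma subg_psi3 u v x : psi3 Xs u v x = psi3 X (sgval u) (sgval v) x.
Proof. by []. Qed.
Lemma subg_Gamma u v t w :
  Gamma Xs u v t w = Gamma X (sgval u) (sgval v) (sgval t) w.
Proof. by []. Qed.
Lemma subg_Psi x y h g th :
  Psi Xs x y h g th = Psi X (sgval x) (sgval y) (sgval h) (sgval g) th.
Proof.
by apply/funext => c; rewrite /Psi /iG !subg_Gamma subg_psi3 !subg_psi2.
Qed.

Section Elements.
Variables (x y h g g' k g'' z : gT).
Hypotheses (xH : x \in H) (yH : y \in H) (hH : h \in H) (gH : g \in H)
  (g'H : g' \in H) (g''H : g'' \in H) (kH : k \in H) (zH : z \in H).
Variables (w w' w'' : trans2 V) (th th' : trans2 V -> modif V).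

Lemma sub_psi2_ob : T x w -> T (g * x * g^-1) (psi2 X x g w).
Proof. exact: (@psi2_ob _ _ _ _ hW Xs hXs (Subg xH) (Subg gH) w). Qed.

Lemma sub_psi3_arrow u : T x w -> T x w' -> arr w w' u ->
  arr (psi2 X x g w) (psi2 X x g w') (psi3 X x g u).
Proof. exact: (@psi3_arrow _ _ _ _ hW Xs hXs (Subg xH) (Subg gH) w). Qed.

Lemma sub_psi3_id : T x w -> psi3 X x g (idM w) = idM (psi2 X x g w).
Proof. by move=> Hw; exact: (@psi3_id _ _ _ _ hW Xs hXs (Subg xH) (Subg gH) w Hw). Qed.

Lemma sub_psi3_scale u a : T x w -> T x w' -> arr w w' u ->
  psi3 X x g (scaleM a u) = scaleM a (psi3 X x g u).
Proof. by move=> Hw Hw'; exact: (@psi3_scale _ _ _ _ hW Xs hXs (Subg xH) (Subg gH) w w' Hw Hw'). Qed.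

Lemma sub_Gamma_arrow : T x w -> arr (psi2 X (g * x * g^-1) h (psi2 X x g w))
  (psi2 X x (h * g) w) (Gamma X x h g w).
Proof. by move=> Hw; exact: (@Gamma_arrow _ _ _ _ hW Xs hXs (Subg xH) w Hw (Subg hH) (Subg gH)). Qed.

Lemma sub_Gamma_iso : T x w -> exists v, inverse3 (C := cat3_of W) (Gamma X x h g w) v.
Proof. by move=> Hw; exact: (@Gamma_iso _ _ _ _ hW Xs hXs (Subg xH) w Hw (Subg hH) (Subg gH)). Qed.

Lemma sub_psi2_1 : T x w -> psi2 X x 1 w = w.
Proof. by move=> Hw; exact: (@psi2_1 _ _ _ _ hW Xs hXs (Subg xH) w Hw). Qed.

Lemma sub_Lam1_iso
    (P := compF (rho X h) (compF (rho X g) (compF (rho X g^-1) (rho X h^-1)))) :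
  [/\ iso2 (C := cat3_of W) P (idF V) (Lft X h g 1),
      iso2 (C := cat3_of W) P (idF V) (Rgt X h g 1)
    & iso3 (C := cat3_of W) (Lft X h g 1) (Rgt X h g 1) (Lam X h g 1)].
Proof. exact: (@Lam1_iso _ _ _ _ hW Xs hXs (Subg hH) (Subg gH)). Qed.

Hypotheses (xy : h * x * h^-1 = y) (gx : g * x * g^-1 = x) (gg' : h * g * h^-1 = g').
Hypotheses (yz : k * y * k^-1 = z) (g'g'' : k * g' * k^-1 = g'').

Let sxy : Subg hH * Subg xH * (Subg hH)^-1 = Subg yH. Proof. exact: val_inj. Qed.
Let syz : Subg kH * Subg yH * (Subg kH)^-1 = Subg zH. Proof. exact: val_inj. Qed.
Let sgx : Subg gH * Subg xH * (Subg gH)^-1 = Subg xH. Proof. exact: val_inj. Qed.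
Let sgg' : Subg hH * Subg gH * (Subg hH)^-1 = Subg g'H. Proof. exact: val_inj. Qed.
Let sg'g'' : Subg kH * Subg g'H * (Subg kH)^-1 = Subg g''H. Proof. exact: val_inj. Qed.

Let EP t : Psi Xs (Subg xH) (Subg yH) (Subg hH) (Subg gH) t = Psi X x y h g t.
Proof. exact: subg_Psi. Qed.
Let EP1 t : Psi Xs (Subg xH) (Subg xH) 1 (Subg gH) t = Psi X x x 1 g t.
Proof. exact: subg_Psi. Qed.
Let EP2 t : Psi Xs (Subg yH) (Subg zH) (Subg kH) (Subg g'H) t = Psi X y z k g' t.
Proof. exact: subg_Psi. Qed.
Let EP3 t : Psi Xs (Subg xH) (Subg zH) (Subg kH * Subg hH) (Subg gH) t = Psi X x z (k * h) g t.
Proof. exact: subg_Psi. Qed.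

Lemma sub_Psi_nat : nat_trans X x g th -> nat_trans X y g' (Psi X x y h g th).
Proof. move=> n; rewrite -EP; exact: (@Psi_nat _ _ _ _ hW Xs hXs _ _ _ _ _ sxy sgx sgg' th n). Qed.

Lemma sub_Psi_add : nat_trans X x g th -> nat_trans X x g th' -> T y w ->
  Psi X x y h g (fun d => addM (th d) (th' d)) w = addM (Psi X x y h g th w) (Psi X x y h g th' w).
Proof. move=> n; rewrite -!EP; exact: (@Psi_add _ _ _ _ hW Xs hXs _ _ _ _ _ sxy sgx sgg' th n th'). Qed.

Lemma sub_Psi_scale a : nat_trans X x g th -> T y w ->
  Psi X x y h g (fun d => scaleM a (th d)) w = scaleM a (Psi X x y h g th w).
Proof. move=> n; rewrite -!EP; exact: (@Psi_scale _ _ _ _ hW Xs hXs _ _ _ _ _ sxy sgx sgg' th n a). Qed.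

Lemma sub_Psi_ext : (forall d, T x d -> th d = th' d) -> T y w ->
  Psi X x y h g th w = Psi X x y h g th' w.
Proof. 
move=> E Hw; rewrite -!EP; apply: (@Psi_ext _ _ _ _ hW Xs hXs (Subg yH) (Subg xH) (Subg hH) (Subg gH) th th' w Hw _ E).
exact: (yx sxy).
Qed.

Lemma sub_Psi_1 : nat_trans X x g th -> T x w -> Psi X x x 1 g th w = th w.
Proof. move=> n; rewrite -EP1; exact: (@Psi_1 _ _ _ _ hW Xs hXs (Subg xH) (Subg gH) th w sgx n). Qed.

Lemma sub_Psi_comp : nat_trans X x g th -> T z w ->
  Psi X y z k g' (Psi X x y h g th) w = Psi X x z (k * h) g th w.
Proof. move=> n; rewrite -EP -EP2 -EP3; exact: (@Psi_comp _ _ _ _ hW Xs hXs (Subg xH) (Subg yH) (Subg zH) (Subg hH) (Subg kH) (Subg gH) (Subg g'H) (Subg g''H) th w sxy syz sgx sgg' sg'g'' n). Qed.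

End Elements.
End Subgroup.

(** * Well-definedness of 2-characters *)

Section Coordinates.

Variables (K : fieldType) (gT : finGroupType).
Implicit Types U : cat_action K gT.

Lemma coords_inj U g n (i : 'rV[K]_n -> Ob U -> Mor U) u v :
  trace_coords g i -> (forall c, is_ob c -> i u c = i v c) -> u = v.
Proof.
case=> Hi _ ex E; have [w [_ uw]] := ex _ (Hi u).
by rewrite -(uw u) // (uw v).
Qed.

(** Serves both for changes of coordinates and for the matrices of the maps [Psi]. *)
Lemma coords_matrix U g n (i : 'rV[K]_n -> Ob U -> Mor U) p
    (q : 'rV[K]_p -> Ob U -> Mor U) :
  trace_coords g i -> (forall v, cat_trace g (q v)) ->
  (forall a u v c, is_ob c ->
    q (a *: u + v) c = addMor (scaleMor a (q u c)) (q v c)) ->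
  exists A : 'M_(p, n), forall v c, is_ob c -> q v c = i (v *m A) c.
Proof.
move=> ci Hq qlin; have [Hi ilin ex] := ci.
have [f Hf] : {f & forall v c, is_ob c -> q v c = i (f v) c}.
  apply: (choice (P := fun v w => forall c, is_ob c -> q v c = i w c)) => v.
  by have [w [Hw _]] := ex _ (Hq v); exists w.
have flin : linear f.
  move=> a u v; apply: (coords_inj ci) => c Hc.
  by rewrite -Hf // qlin // ilin // -!Hf.
pose F : {linear 'rV[K]_p -> 'rV[K]_n} :=
  HB.pack f (GRing.isLinear.Build _ _ _ _ f flin).
by exists (lin1_mx F) => v c Hc; rewrite mul_rV_lin1; exact: Hf.
Qed.

(** Two coordinate systems differ by an invertible S, so the two matrices of the map are similar.
    The hypothesis keeps psi_(k^-1) c among the objects, where transformations that agree on objects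
    may be exchanged. *)
Lemma is_character2_uniq U (g k : gT) t t' :
  (forall c : Ob U, is_ob c -> is_ob (psi_ob k^-1 c)%g) ->
  is_character2 U g k t -> is_character2 U g k t' -> t = t'.
Proof.
move=> Hk [n [i [A [ci iA ->]]]] [n' [i' [A' [ci' iA' ->]]]].
have [Hi ilin _] := ci; have [Hi' ilin' _] := ci'.
have [S HS] := coords_matrix ci' Hi ilin.
have [S' HS'] := coords_matrix ci Hi' ilin'.
have E p q (B C : 'M[K]_(p, q)) : (forall v : 'rV_p, v *m B = v *m C) -> B = C.
  by move=> BC; apply/row_matrixP => j; rewrite !rowE BC.
have SS' : S' *m S = 1%:M.
  by apply: E => v; apply: (coords_inj ci') => c Hc; rewrite mulmxA -HS // -HS' // mulmx1.
have AS : A *m S = S *m A'.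
  apply: E => v; apply: (coords_inj ci') => c Hc.
  rewrite !mulmxA -HS // -iA // -iA' // /trace_map; congr compMor; congr compMor; congr compMor.
  by rewrite HS //; exact: Hk.
have E1 : S *m S' = 1%:M.
  by apply: E => v; apply: (coords_inj ci) => c Hc; rewrite mulmxA -HS' // -HS // mulmx1.
by rewrite -[A]mulmx1 -E1 mulmxA AS mxtrace_mulC mulmxA SS' mul1mx.
Qed.

Lemma is_character2E U (g k : gT) t :
  (forall c : Ob U, is_ob c -> is_ob (psi_ob k^-1 c)%g) ->
  is_character2 U g k t -> character2 U g k = t.
Proof.
move=> Hk Ht; rewrite /character2 /choose_or; case: pselect => [e|[]]; last by exists t.
by case: cid => t' /= Ht'; exact: is_character2_uniq Ht' Ht.
Qed.

End Coordinates.

(** * Conjugation invariance of the 3-character *)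

Section Invariance.

Variables (K : fieldType) (gT : finGroupType) (V : lin2cat K) (W : sub3 V).
Hypothesis hW : strict_sub3 W.
Variables (H : {group gT}) (X : rep3 gT (cat3_of W)).
Hypothesis hX : is_rep3 X H.
Local Open Scope group_scope.

Lemma invMorE (f : gT) c d (u : modif V) : msrc u = c -> mtgt u = d ->
  invMor (U := centralizer_action X f) c d u = inv3 (C := cat3_of W) u.
Proof. by move=> <- <-. Qed.

Lemma conj_fix (x g : gT) : g * x * g^-1 = x -> g^-1 * x * g^-1^-1 = x.
Proof. by move=> E; rewrite -[in LHS]E invgK !mulgA mulVg mul1g mulgKV. Qed.

Lemma trace_mapE x g k th c : x \in H -> k \in H -> k * x * k^-1 = x ->
  trace2_ob X x c ->
  trace_map (U := centralizer_action X x) g k th c = Psi X x x k g th c.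
Proof.
move=> xH kH kx Hc; have V1 := groupVr kH.
have := sub_Gamma_arrow hW hX xH kH V1 Hc; rewrite (conj_fix kx) => -[_ s t].
by rewrite /trace_map (invMorE x s t).
Qed.

Section Conjugation.

Variables x y h g g' : gT.
Hypotheses (xH : x \in H) (yH : y \in H) (hH : h \in H) (gH : g \in H) (g'H : g' \in H).
Hypotheses (xy : h * x * h^-1 = y) (gx : g * x * g^-1 = x) (gg' : h * g * h^-1 = g').
Local Notation U := (centralizer_action X x).
Local Notation U' := (centralizer_action X y).

Lemma nat_trans_scale a th : nat_trans X x g th ->
  nat_trans X x g (fun d => scaleM a (th d)).
Proof.
case=> n1 n2; split=> [c Hc|c d u Hc Hd Hu].
  by have [Wt st tt] := n1 _ Hc; split=> //; exact: (W_scale3 hW).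
have [Wc sc tc] := n1 _ Hc; have [Wd sd td] := n1 _ Hd; have [Wu su tu] := Hu.
have [Wp sp tp] := sub_psi3_arrow hW hX xH gH Hc Hd Hu.
cbn [in3 s3 t3 cat3_of] in *.
have M v : W3 W v -> is_modif v by apply: W3_modif.
have E1 : vcompM u (scaleM a (th d)) = scaleM a (vcompM u (th d)).
  by apply: vcompM_scaler; [exact: M|exact: M|rewrite tu sd].
rewrite E1 (n2 _ _ _ Hc Hd Hu); apply: esym.
by apply: vcompM_scalel; [exact: M|exact: M|rewrite tc sp].
Qed.

Lemma Psi_linear a th th' c : nat_trans X x g th -> nat_trans X x g th' ->
  trace2_ob X y c ->
  Psi X x y h g (fun d => addM (scaleM a (th d)) (th' d)) c =
  addM (scaleM a (Psi X x y h g th c)) (Psi X x y h g th' c).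
Proof.
move=> n n' Hc.
rewrite (@sub_Psi_add _ _ _ _ hW _ _ hX _ _ _ _ _ xH yH hH gH g'H) //; last exact: nat_trans_scale.
by rewrite (@sub_Psi_scale _ _ _ _ hW _ _ hX _ _ _ _ _ xH yH hH gH g'H).
Qed.

Lemma Psi_i_linear n (i : 'rV[K]_n -> trans2 V -> modif V) :
  trace_coords (U := U) g i -> forall a u v c, trace2_ob X y c ->
  Psi X x y h g (i (a *: u + v)%R) c =
  addM (scaleM a (Psi X x y h g (i u) c)) (Psi X x y h g (i v) c).
Proof.
move=> [Hi ilin _] a u v c Hc; rewrite -(Psi_linear a (Hi u) (Hi v) Hc).
by apply: (sub_Psi_ext hW hX xH yH hH gH xy) => // d Hd; exact: ilin.
Qed.

Lemma Psi_matrix n (i : 'rV[K]_n -> trans2 V -> modif V)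
    n' (i' : 'rV[K]_n' -> trans2 V -> modif V) :
  trace_coords (U := U) g i -> trace_coords (U := U') g' i' ->
  exists A : 'M_(n, n'), forall v c, trace2_ob X y c ->
    Psi X x y h g (i v) c = i' (v *m A)%R c.
Proof.
move=> ci ci'.
apply: (coords_matrix (U := U') (q := fun v => Psi X x y h g (i v)) ci').
  by move=> v; case: ci => Hi _ _; exact: (sub_Psi_nat hW hX xH yH hH gH g'H xy gx gg' (Hi v)).
exact: Psi_i_linear.
Qed.

(** [Psi] along h^-1 is the inverse map, by composition and the case h = 1, so coordinates can be
    carried along. *)
Lemma Psi_coords n (i : 'rV[K]_n -> trans2 V -> modif V) :
  trace_coords (U := U) g i ->
  trace_coords (U := U') g' (fun v => Psi X x y h g (i v)).
Proof.
move=> ci; have [Hi ilin ex] := ci.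
have VH := groupVr hH; have yx : h^-1 * y * h^-1^-1 = x.
  by rewrite -xy invgK !mulgA mulVg mul1g mulgKV.
have g'g : h^-1 * g' * h^-1^-1 = g.
  by rewrite -gg' invgK !mulgA mulVg mul1g mulgKV.
have g'y : g' * y * g'^-1 = y := g'y xy gx gg'.
have K1 th c : nat_trans X y g' th -> trace2_ob X y c ->
    Psi X x y h g (Psi X y x h^-1 g' th) c = th c.
  move=> n1 Hc; rewrite (sub_Psi_comp hW hX yH xH VH g'H gH g'H hH yH yx g'y g'g xy gg' n1 Hc).
  by rewrite mulgV; apply: (sub_Psi_1 hW hX yH g'H g'y n1 Hc).
have K2 th c : nat_trans X x g th -> trace2_ob X x c ->
    Psi X y x h^-1 g' (Psi X x y h g th) c = th c.
  move=> n1 Hc; rewrite (sub_Psi_comp hW hX xH yH hH gH g'H gH VH xH xy gx gg' yx g'g n1 Hc).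
  by rewrite mulVg; apply: (sub_Psi_1 hW hX xH gH gx n1 Hc).
split.
- by move=> v; exact: (sub_Psi_nat hW hX xH yH hH gH g'H xy gx gg' (Hi v)).
- exact: Psi_i_linear.
- move=> th nth; have nP := sub_Psi_nat hW hX yH xH VH g'H gH yx g'y g'g nth.
  have [v [Hv uv]] := ex _ nP; exists v; split=> [c Hc|v' Hv'].
    rewrite -(K1 _ _ nth Hc).
    by apply: (sub_Psi_ext hW hX xH yH hH gH xy).
  apply: uv => c Hc; rewrite -(K2 _ _ (Hi v') Hc).
  by apply: (sub_Psi_ext hW hX yH xH VH g'H yx).
Qed.

End Conjugation.

Section Commuting.

Variables x g k : gT.
Hypotheses (xH : x \in H) (gH : g \in H) (kH : k \in H).
Hypotheses (gx : g * x * g^-1 = x) (kx : k * x * k^-1 = x) (kg : k * g * k^-1 = g).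
Local Notation U := (centralizer_action X x).

Lemma psi_ob_cent c : trace2_ob X x c -> trace2_ob X x (psi2 X x k^-1 c).
Proof. by move=> /(sub_psi2_ob hW hX xH (groupVr kH)); rewrite (conj_fix kx). Qed.

Lemma is_character2_ex : trace_findim U g -> exists t, is_character2 U g k t.
Proof.
move=> [n [i ci]]; have [Hi ilin _] := ci.
have [A HA] := Psi_matrix xH xH kH gH gH kx gx kg ci ci.
exists (\tr A); exists n, i, A; split=> // v c Hc.
by rewrite (trace_mapE g _ xH kH kx Hc) HA.
Qed.

Lemma character3E t : is_character2 U g k t -> character3 X x g k = t.
Proof. by apply: is_character2E => c; exact: psi_ob_cent. Qed.

(** In the coordinates transported along h, the map of h k h^-1 has the same matrix as the map of k
    in the original ones. *)
Lemma character3_conj h : h \in H -> trace_findim U g ->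
  character3 X (h * x * h^-1) (h * g * h^-1) (h * k * h^-1) = character3 X x g k.
Proof.
move=> hH fd; have [t Ht] := is_character2_ex fd; rewrite (character3E Ht).
have JH z : z \in H -> h * z * h^-1 \in H by move=> zH; rewrite !groupM ?groupV.
have JM z w : z * w * z^-1 = w ->
    (h * z * h^-1) * (h * w * h^-1) * (h * z * h^-1)^-1 = h * w * h^-1.
  by move=> E; rewrite -[in RHS]E !invMg invgK !mulgA !mulgKV.
apply: is_character2E.
  by move=> c; have := sub_psi2_ob hW hX (JH _ xH) (groupVr (JH _ kH)); rewrite (conj_fix (JM _ _ kx)); exact.
case: Ht => n [i [A [ci iA ->]]]; exists n, (fun v => Psi X x (h * x * h^-1) h g (i v)), A; split=> //.
  exact: (Psi_coords xH (JH _ xH) hH gH (JH _ gH)).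
have [Hi _ _] := ci.
move=> v c Hc; rewrite (trace_mapE _ _ (JH _ xH) (JH _ kH) (JM _ _ kx) Hc).
rewrite (sub_Psi_comp hW hX xH (JH _ xH) hH gH (JH _ gH) (JH _ gH) (JH _ kH) (JH _ xH) erefl gx erefl (JM _ _ kx) (JM _ _ kg) (Hi v) Hc).
(* Since (h k h^-1) h = h k, the composite transport splits again with k acting first. *)
rewrite mulgKV -(sub_Psi_comp hW hX xH xH kH gH gH (JH _ gH) hH (JH _ xH) kx gx kg erefl erefl (Hi v) Hc).
apply: (sub_Psi_ext hW hX xH (JH _ xH) hH gH erefl) => // d Hd.
by rewrite -(trace_mapE _ _ xH kH kx Hd) iA.
Qed.

End Commuting.
End Invariance.

(** * The action on cosets and its cocycle *)

Section CosetAction.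

Variables (gT : finGroupType) (G H : {group gT}) (sHG : H \subset G).
Variables (m : nat) (r : 'I_m -> gT) (hr : left_coset_reps G H r).
Local Open Scope group_scope.

Definition cact (g : gT) (i : 'I_m) : 'I_m :=
  odflt i [pick j | shift r g j i \in H].
Definition sh (g : gT) (i : 'I_m) : gT := shift r g (cact g i) i.

Lemma reps_in i : r i \in G.
Proof.
have [_ E] := hr; have : r i *: H \in lcosets H G by rewrite -E; apply/imsetP; exists i.
case/lcosetsP=> x xG; move/lcoset_eqP => /=.
by case/lcosetP => h hH ->; rewrite groupM // (subsetP sHG).
Qed.

Lemma mem_shift g j i : g \in G -> (shift r g j i \in H) = (j == cact g i).
Proof.
move=> gG; have [inj E] := hr.
have U j' j'' : shift r g j' i \in H -> shift r g j'' i \in H -> j' = j''.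
  rewrite /shift => H1 H2; apply: inj; apply/lcoset_eqP.
  have : (r j')^-1 * (g * r i) * ((r j'')^-1 * (g * r i))^-1 \in H by rewrite groupM ?groupV.
  rewrite !invMg invgK !mulgA !mulgK.
  by rewrite mem_lcoset -groupV invMg invgK.
have [j' Hj'] : exists j', shift r g j' i \in H.
  have : g * r i *: H \in lcosets H G by apply/lcosetsP; exists (g * r i); rewrite ?groupM ?reps_in.
  rewrite -E; case/imsetP => j' _ Ej'; exists j'; rewrite /shift -mem_lcoset.
  by rewrite -Ej' lcoset_refl.
have Ha : shift r g (cact g i) i \in H.
  by rewrite /cact; case: pickP => [//|/(_ j')]; rewrite Hj'.
by apply/idP/eqP => [Hj|->//]; exact: U Hj Ha.
Qed.

Lemma sh_in g i : g \in G -> sh g i \in H.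
Proof. by move=> gG; rewrite mem_shift. Qed.

Lemma cactE g i j : g \in G -> shift r g j i \in H -> cact g i = j.
Proof. by move=> gG; rewrite mem_shift // => /eqP. Qed.

Lemma shift_mul a b k j i : shift r (a * b) k i = shift r a k j * shift r b j i.
Proof. by rewrite /shift !mulgA mulgK. Qed.

Lemma cactM a b i : a \in G -> b \in G -> cact (a * b) i = cact a (cact b i).
Proof.
move=> aG bG; apply: cactE; first exact: groupM.
by rewrite (shift_mul _ _ _ (cact b i)) groupM // sh_in.
Qed.

(** The cocycle identity, which turns products of entries of induced matrices into entries for the
    product. *)
Lemma shM a b i : a \in G -> b \in G -> sh (a * b) i = sh a (cact b i) * sh b i.
Proof. by move=> aG bG; rewrite /sh cactM // (shift_mul _ _ _ (cact b i)). Qed.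

Lemma cact1 i : cact 1 i = i.
Proof. by apply: cactE => //; rewrite /shift mul1g mulVg. Qed.

Lemma sh1 i : sh 1 i = 1.
Proof. by rewrite /sh cact1 /shift mul1g mulVg. Qed.

Lemma cactVK a i : a \in G -> cact a^-1 (cact a i) = i.
Proof. by move=> aG; rewrite -cactM ?groupV // mulVg cact1. Qed.

Lemma cactKV a i : a \in G -> cact a (cact a^-1 i) = i.
Proof. by move=> aG; rewrite -cactM ?groupV // mulgV cact1. Qed.

Lemma shV a i : a \in G -> sh a^-1 (cact a i) = (sh a i)^-1.
Proof.
move=> aG; apply: (mulIg (sh a i)).
by rewrite -shM ?groupV // !mulVg sh1.
Qed.

Lemma cact_inj a i j : a \in G -> cact a i = cact a j -> i = j.
Proof. by move=> aG E; rewrite -(cactVK i aG) E cactVK. Qed.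

Lemma sh_conj g i : g \in G -> cact g i = i -> sh g i = g ^ r i.
Proof. by rewrite /sh => _ ->; rewrite /shift /conjg. Qed.

Section Matrices.
Variables (A B D : Type).
Implicit Types (c : 'I_m -> A) (d : 'I_m -> B).

(** Supported where the permutation matrices of a and b agree: the shape of an arrow from a matrix
    with support a to one with support b. For a = b it has one entry in each column. *)
Definition dmx T (a b : gT) (c : 'I_m -> T) : 'M[option T]_m :=
  \matrix_(j, i) if (j == cact a i) && (j == cact b i) then Some (c i) else None.

Lemma dmx_ext T a b a' b' (c c' : 'I_m -> T) : a = a' -> b = b' ->
  (forall i, cact a i = cact b i -> c i = c' i) -> dmx a b c = dmx a' b' c'.
Proof.
move=> -> -> E; apply/matrixP => j i; rewrite !mxE.
by case: ifP => // /andP[/eqP e1 /eqP e2]; rewrite E // -e1 -e2.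
Qed.

Lemma dmx_prodl (op : A -> B -> D) a b b' c d : a \in G -> b \in G -> b' \in G ->
  mx_prod op (dmx a a c) (dmx b b' d) =
  dmx (a * b) (a * b') (fun i => op (c (cact b i)) (d i)).
Proof.
move=> aG bG b'G; apply/matrixP => j i; rewrite !mxE !cactM //.
case: pickP => [k|N].
  rewrite !mxE !andbb; case: eqP => //= ->; case: eqP => //= ->; case: eqP => //= <-.
  by rewrite !eqxx.
case: eqP => //= Ej; case: eqP => //= Ej'.
have E := cact_inj aG (etrans (esym Ej) Ej').
by have := N (cact b i); rewrite !mxE !andbb -E -Ej !eqxx.
Qed.

Lemma dmx_prodr (op : A -> B -> D) a a' b c d : a \in G -> a' \in G -> b \in G ->
  mx_prod op (dmx a a' c) (dmx b b d) =
  dmx (a * b) (a' * b) (fun i => op (c (cact b i)) (d i)).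
Proof.
move=> aG a'G bG; apply/matrixP => j i; rewrite !mxE !cactM //.
case: pickP => [k|N].
  rewrite !mxE !andbb; case: (k =P cact b i) => [->|]; last by rewrite andbF.
  by case: ifP.
case: ifP => // E.
by have := N (cact b i); rewrite !mxE !andbb E !eqxx /=.
Qed.

Lemma dmx_zipl (op : A -> B -> D) a a' b c d : a = a' ->
  mx_zip op (dmx a a c) (dmx a' b d) = dmx a b (fun i => op (c i) (d i)).
Proof.
move=> <-; apply/matrixP => j i; rewrite !mxE andbb.
by case: eqP => //= _; case: eqP.
Qed.

Lemma dmx_zipr (op : A -> B -> D) a b b' c d : b = b' ->
  mx_zip op (dmx a b c) (dmx b' b' d) = dmx a b (fun i => op (c i) (d i)).
Proof.
move=> <-; apply/matrixP => j i; rewrite !mxE andbb.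
by case: eqP => //= _; case: eqP.
Qed.

Lemma dmx_zip (op : A -> B -> D) a b c d :
  mx_zip op (dmx a b c) (dmx a b d) = dmx a b (fun i => op (c i) (d i)).
Proof. by apply/matrixP => j i; rewrite !mxE; case: ifP. Qed.

Lemma dmx_omap (op : A -> D) a b c :
  mx_omap op (dmx a b c) = dmx a b (fun i => op (c i)).
Proof. by apply/matrixP => j i; rewrite !mxE; case: ifP. Qed.

End Matrices.
End CosetAction.

(** * The induced representation, column by column *)

Section InducedTrace.

Variables (K : fieldType) (gT : finGroupType) (V : lin2cat K) (W : sub3 V).
Hypothesis hW : strict_sub3 W.
Variables (G H : {group gT}) (sHG : H \subset G) (X : rep3 gT (cat3_of W)).
Hypothesis hX : is_rep3 X H.
Variables (m : nat) (r : 'I_m -> gT).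
Hypothesis hr : left_coset_reps G H r.
Local Open Scope group_scope.

Local Notation C := (cat3_of W).
Local Notation M := (mx_cat3 C m).
Local Notation cact := (cact H r).
Local Notation sh := (sh H r).
Local Notation dmx := (dmx H r).
Local Notation Xi := (ind_rep3 H X r).

Ltac ing := rewrite ?groupM ?groupV ?group1 //.

(** All arrows in the induced action have supports given by group elements and entries given by
    families over the columns; in this form the matrix operations are computed columnwise. *)
Definition A1m a (F : 'I_m -> A1 C) : A1 M := dmx a a F.
Definition A2m a b (F F' : 'I_m -> A1 C) (c : 'I_m -> A2 C) : A2 M :=
  @MA2 K C m (A1m a F) (A1m b F') (dmx a b c).
Definition A3m a b (F F' E E' : 'I_m -> A1 C) (u : 'I_m -> A3 C) : A3 M :=
  @MA3 K C m (A2m a b F F' (fun i => s3 (u i))) (A2m a b E E' (fun i => t3 (u i)))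
    (dmx a b u).

Section Operations.
Variables a b b' : gT.
Hypotheses (aG : a \in G) (bG : b \in G) (b'G : b' \in G).

Lemma A1m_mul F F' : op0_11 M (A1m a F) (A1m b F') =
  A1m (a * b) (fun i => op0_11 C (F (cact b i)) (F' i)).
Proof. by rewrite /A1m /= /mop0_11 (dmx_prodl sHG hr). Qed.

Lemma A2m_wl F P Q c : op0_12 M (A1m a F) (A2m b b' P Q c) =
  A2m (a * b) (a * b') (fun i => op0_11 C (F (cact b i)) (P i))
    (fun i => op0_11 C (F (cact b' i)) (Q i)) (fun i => op0_12 C (F (cact b i)) (c i)).
Proof. by rewrite /A2m /A1m /= /mop0_12 /= /mop0_11 !(dmx_prodl sHG hr). Qed.

Lemma A2m_wr F P Q c : op0_21 M (A2m b b' P Q c) (A1m a F) =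
  A2m (b * a) (b' * a) (fun i => op0_11 C (P (cact a i)) (F i))
    (fun i => op0_11 C (Q (cact a i)) (F i)) (fun i => op0_21 C (c (cact a i)) (F i)).
Proof. by rewrite /A2m /A1m /= /mop0_21 /= /mop0_11 !(dmx_prodr sHG hr). Qed.

Lemma A3m_wl F P Q P' Q' c : op0_13 M (A1m a F) (A3m b b' P Q P' Q' c) =
  A3m (a * b) (a * b') (fun i => op0_11 C (F (cact b i)) (P i))
    (fun i => op0_11 C (F (cact b' i)) (Q i))
    (fun i => op0_11 C (F (cact b i)) (P' i))
    (fun i => op0_11 C (F (cact b' i)) (Q' i)) (fun i => op0_13 C (F (cact b i)) (c i)).
Proof.
rewrite /A3m /= /mop0_13 [mx3 _]/= !(dmx_prodl sHG hr) //.
by congr MA3; exact: A2m_wl.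
Qed.

Lemma A3m_wr F P Q P' Q' c : op0_31 M (A3m b b' P Q P' Q' c) (A1m a F) =
  A3m (b * a) (b' * a) (fun i => op0_11 C (P (cact a i)) (F i))
    (fun i => op0_11 C (Q (cact a i)) (F i))
    (fun i => op0_11 C (P' (cact a i)) (F i))
    (fun i => op0_11 C (Q' (cact a i)) (F i)) (fun i => op0_31 C (c (cact a i)) (F i)).
Proof.
rewrite /A3m /= /mop0_31 [mx3 _]/= !(dmx_prodr sHG hr) //.
by congr MA3; exact: A2m_wr.
Qed.
End Operations.

Lemma A2m_compl a a' b P Q P' Q' c d : a = a' ->
  op1_22 M (A2m a a P Q c) (A2m a' b P' Q' d) =
  A2m a b P Q' (fun i => op1_22 C (c i) (d i)).
Proof. by move=> E; rewrite /A2m /= /mop1_22 /= (dmx_zipl _ _ _ _ _ _ E). Qed.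

Lemma A2m_compr a b b' P Q P' Q' c d : b = b' ->
  op1_22 M (A2m a b P Q c) (A2m b' b' P' Q' d) =
  A2m a b' P Q' (fun i => op1_22 C (c i) (d i)).
Proof. by move=> <-; rewrite /A2m /= /mop1_22 /= (dmx_zipr _ _ _ _ _ _ erefl). Qed.

Lemma A3m_compl a a' b P Q R S P' Q' R' S' c d : a = a' ->
  op1_33 M (A3m a a P Q R S c) (A3m a' b P' Q' R' S' d) =
  A3m a b P Q' R S' (fun i => op1_33 C (c i) (d i)).
Proof.
move=> E; rewrite /A3m /= /mop1_33 /= (dmx_zipl _ _ _ _ _ _ E); congr MA3;
exact: A2m_compl.
Qed.

Lemma A3m_compr a b b' P Q R S P' Q' R' S' c d : b = b' ->
  op1_33 M (A3m a b P Q R S c) (A3m b' b' P' Q' R' S' d) =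
  A3m a b' P Q' R S' (fun i => op1_33 C (c i) (d i)).
Proof.
move=> E; rewrite /A3m /= /mop1_33 /= -E (dmx_zipr _ _ _ _ _ _ erefl); congr MA3;
exact: A2m_compr.
Qed.

Lemma A3m_one a b P Q c : one3 (c := M) (A2m a b P Q c) =
  A3m a b P Q P Q (fun i => one3 (c := C) (c i)).
Proof. by rewrite /A3m /A2m /= /mone3 /= dmx_omap. Qed.

Lemma A3m_vcomp a b a' b' P Q P' Q' R S R' S' c d : a = a' -> b = b' ->
  op2_33 M (A3m a b P Q R S c) (A3m a' b' R' S' P' Q' d) =
  A3m a b P Q P' Q' (fun i => op2_33 C (c i) (d i)).
Proof. by move=> <- <-; rewrite /A3m /A2m /= /mop2_33 /= dmx_zip. Qed.

Lemma A2m_ext a b a' b' P Q c d : a = a' -> b = b' ->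
  (forall i, cact a i = cact b i -> c i = d i) -> A2m a b P Q c = A2m a' b' P Q d.
Proof. by move=> Ea Eb E; rewrite /A2m /A1m (dmx_ext Ea Eb E) Ea Eb. Qed.

Lemma A3m_ext a b a' b' P Q R S c d : a = a' -> b = b' ->
  (forall i, cact a i = cact b i -> c i = d i) -> A3m a b P Q R S c = A3m a' b' P Q R S d.
Proof.
move=> Ea Eb E; rewrite /A3m (dmx_ext Ea Eb E).
by congr MA3; apply: A2m_ext => // i Ei; rewrite E.
Qed.

Lemma ind_rhoE g : g \in G -> rho Xi g = A1m g (fun i => rho X (sh g i)).
Proof.
move=> gG; apply/matrixP => j i; rewrite !mxE andbb (mem_shift sHG hr) //.
by case: eqP => [->|].
Qed.

Lemma ind_one : one1 M = A1m 1 (fun=> one1 C).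
Proof. by apply/matrixP => j i; rewrite !mxE andbb (cact1 sHG hr). Qed.

Lemma ind_phiE g2 g1 : g2 \in G -> g1 \in G -> phi Xi g2 g1 =
  A2m (g2 * g1) (g2 * g1)
    (fun i => op0_11 C (rho X (sh g2 (cact g1 i))) (rho X (sh g1 i)))
    (fun i => rho X (sh (g2 * g1) i))
    (fun i => phi X (sh g2 (cact g1 i)) (sh g1 i)).
Proof.
move=> G2 G1; rewrite /A2m -ind_rhoE ?groupM // -(A1m_mul G2 G1 (fun i => rho X (sh g2 i))).
rewrite -!ind_rhoE //; congr MA2; apply/matrixP => j i; rewrite !mxE (cactM sHG hr) // andbb.
case: pickP => [k|N].
  rewrite !(mem_shift sHG hr) //; case: eqP => //= ->; case: eqP => //= ->.
  by rewrite ?eqxx.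
case: eqP => // E; have := N (cact g1 i).
by rewrite !(mem_shift sHG hr) // E !eqxx.
Qed.

Lemma ind_PhiE g3 g2 g1 : g3 \in G -> g2 \in G -> g1 \in G -> Phi Xi g3 g2 g1 =
  A3m (g3 * (g2 * g1)) (g3 * (g2 * g1))
    (fun i => op0_11 C (rho X (sh g3 (cact (g2 * g1) i)))
       (op0_11 C (rho X (sh g2 (cact g1 i))) (rho X (sh g1 i))))
    (fun i => rho X (sh (g3 * (g2 * g1)) i))
    (fun i => op0_11 C (op0_11 C (rho X (sh g3 (cact g2 (cact g1 i))))
       (rho X (sh g2 (cact g1 i)))) (rho X (sh g1 i)))
    (fun i => rho X (sh (g3 * g2 * g1) i))
    (fun i => Phi X (sh g3 (cact (g2 * g1) i)) (sh g2 (cact g1 i)) (sh g1 i)).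
Proof.
move=> G3 G2 G1; have S g i : g \in G -> sh g i \in H by move=> gG; exact: (sh_in sHG hr).
have P i := Phi_iso3 hX (S g3 (cact (g2 * g1) i) G3) (S g2 (cact g1 i) G2) (S g1 i G1).
rewrite /A3m; congr MA3.
- rewrite -[LHS]/(op1_22 M (op0_12 M (rho Xi g3) (phi Xi g2 g1)) (phi Xi g3 (g2 * g1))).
  rewrite ind_rhoE // !ind_phiE ?groupM // A2m_wl ?groupM // A2m_compl //.
  apply: A2m_ext => // i _; case: (P i) => -[_ E _] _.
  by rewrite [RHS]E (shM sHG hr).
- rewrite -[LHS]/(op1_22 M (op0_21 M (phi Xi g3 g2) (rho Xi g1)) (phi Xi (g3 * g2) g1)).
  rewrite ind_rhoE // !ind_phiE ?groupM // A2m_wr ?groupM // A2m_compl //.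
  apply: A2m_ext; rewrite ?mulgA // => i _; case: (P i) => -[_ _ E] _.
  by rewrite [RHS]E (shM sHG hr) // (cactM sHG hr).
apply/matrixP => j i; rewrite !mxE !(cactM sHG hr) ?groupM // andbb.
case: pickP => [[k l]|N] /=.
  rewrite !(mem_shift sHG hr) //.
  case: eqP => //= ->; case: eqP => //= ->; case: eqP => //= -> _.
  by rewrite ?eqxx.
case: eqP => // E; have := N (cact g1 i, cact g2 (cact g1 i)).
by rewrite /= !(mem_shift sHG hr) // E !eqxx.
Qed.

Lemma dmx_inj T a b (c c' : 'I_m -> T) i : dmx a b c = dmx a b c' ->
  cact a i = cact b i -> c i = c' i.
Proof.
by move=> /matrixP/(_ (cact a i) i); rewrite !mxE eqxx /= => + /eqP E; rewrite E => -[].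
Qed.

Lemma A1m_in a F : a \in G -> (forall i, in1 (F i)) -> in1 (A1m a F).
Proof.
move=> aG HF; split=> [j k|j k k'|j j' k]; rewrite !mxE !andbb.
- by case: eqP.
- case: (j =P cact a k) => // E _; case: (j =P cact a k') => // E' _.
  exact: (cact_inj sHG hr aG (etrans (esym E) E')).
- by case: (j =P cact a k) => // -> _; case: (j' =P cact a k).
Qed.

Lemma A2m_arrow a b F F' c : a \in G -> b \in G -> (forall i, in1 (F i)) ->
  (forall i, in1 (F' i)) ->
  (forall i, cact a i = cact b i -> arrow2 (F i) (F' i) (c i)) ->
  arrow2 (A1m a F) (A1m b F') (A2m a b F F' c).
Proof.
move=> aG bG HF HF' Hc; split=> //; split; [exact: A1m_in|exact: A1m_in|].
move=> j i; rewrite /= !mxE !andbb.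
case: (j =P cact a i) => [->|_] /=; last by do ?case: ifP.
by case: eqP => // /Hc.
Qed.

Lemma A2m_arrowP a b F F' w : arrow2 (A1m a F) (A1m b F') w ->
  exists c, w = A2m a b F F' c /\
    forall i, cact a i = cact b i -> arrow2 (F i) (F' i) (c i).
Proof.
case: w => p q x [[_ _ /= Hx] /= Ep Eq]; subst p q.
(* The default is taken only in a column where a and b disagree, and there [dmx] does not read
   it. *)
exists (fun i => odflt (one2 (F i)) (x (cact a i) i)).
have E j i : x j i = if (j == cact a i) && (j == cact b i)
    then Some (odflt (one2 (F i)) (x (cact a i) i)) else None.
  have := Hx j i; rewrite !mxE !andbb.
  case: (j =P cact a i) => [->|_] /=; last by case: (x j i) => [?|]; do ?case: ifP.
  by case: ifP => _; case: (x _ i).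
split=> [|i Ei].
  by rewrite /A2m; congr MA2; apply/matrixP => j i; rewrite E mxE.
have := Hx (cact a i) i; rewrite !mxE !andbb eqxx -Ei eqxx.
by case: (x _ i).
Qed.

Lemma A3m_arrow a b P Q c d u : a \in G -> b \in G -> 
  arrow2 (A1m a P) (A1m b Q) (A2m a b P Q c) ->
  arrow2 (A1m a P) (A1m b Q) (A2m a b P Q d) ->
  (forall i, cact a i = cact b i -> arrow3 (c i) (d i) (u i)) ->
  arrow3 (A2m a b P Q c) (A2m a b P Q d) (A3m a b P Q P Q u).
Proof.
move=> aG bG [Hc _ _] [Hd _ _] Hu.
have Es : A2m a b P Q (fun i => s3 (u i)) = A2m a b P Q c.
  by apply: A2m_ext => // i /Hu [].
have Et : A2m a b P Q (fun i => t3 (u i)) = A2m a b P Q d.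
  by apply: A2m_ext => // i /Hu [].
split; [|exact: Es|exact: Et].
split; rewrite /= ?Es ?Et //.
move=> j i; rewrite /= !mxE.
by case: (j =P cact a i) => [->|_] //=; case: eqP => // /Hu [].
Qed.

Lemma A3m_arrowP a b P Q c d x : arrow3 (A2m a b P Q c) (A2m a b P Q d) x ->
  exists u, x = A3m a b P Q P Q u /\
    forall i, cact a i = cact b i -> arrow3 (c i) (d i) (u i).
Proof.
case: x => p q x [[_ _ _ _ /= Hx] /= Ep Eq]; subst p q; rewrite /= in Hx.
exists (fun i => odflt (one3 (c i)) (x (cact a i) i)).
have E j i : x j i = if (j == cact a i) && (j == cact b i)
    then Some (odflt (one3 (c i)) (x (cact a i) i)) else None.
  have := Hx j i; rewrite !mxE.
  case: (j =P cact a i) => [->|_] /=; last by case: (x j i).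
  by case: ifP => _; case: (x _ i).
have Hu i : cact a i = cact b i ->
    arrow3 (c i) (d i) (odflt (one3 (c i)) (x (cact a i) i)).
  move=> Ei; have := Hx (cact a i) i; rewrite !mxE -Ei !eqxx /=.
  by case: (x _ i).
split=> //; rewrite /A3m; congr MA3.
- by apply: A2m_ext => // i /Hu [].
- by apply: A2m_ext => // i /Hu [].
- by apply/matrixP => j i; rewrite E mxE.
Qed.

Lemma choose_orE T (x0 : T) (Q : T -> Prop) y : Q y ->
  (forall y', Q y' -> y' = y) -> choose_or x0 Q = y.
Proof.
move=> Qy U; rewrite /choose_or; case: pselect => [e|[]]; last by exists y.
by case: cid => y' /= /U.
Qed.

(** The entrywise inverse is an inverse, and uniqueness of inverses in each column identifies it
    with the chosen one. *)
Lemma inv2_A2m a F F' c d : a \in G -> (forall i, in1 (F i)) ->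
  (forall i, in1 (F' i)) -> (forall i, arrow2 (F i) (F' i) (c i)) ->
  (forall i, inverse2 (C := C) (c i) (d i)) ->
  inv2 (A2m a a F F' c) = A2m a a F' F d.
Proof.
move=> aG HF HF' Hc Hd.
have one F0 : A2m a a F0 F0 (fun i => one2 (F0 i)) = one2 (A1m a F0).
  by rewrite /A2m /= /mone2 /A1m dmx_omap.
apply: choose_orE => [|y'].
  split; first by apply: A2m_arrow => // i _; case: (Hd i) => + _ _; case: (Hc i) => _ -> ->.
  - rewrite [_ #1 _]A2m_compl // -[RHS]/(one2 (A1m a F)) -one; apply: A2m_ext => // i _.
    by case: (Hd i) => _ + _; case: (Hc i) => _ -> _.
  - rewrite [_ #1 _]A2m_compl // -[RHS]/(one2 (A1m a F')) -one; apply: A2m_ext => // i _.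
    by case: (Hd i) => _ _; case: (Hc i) => _ _ ->.
case=> /A2m_arrowP [e [-> He]] E1 E2.
apply: A2m_ext => // i _; have [Wc sc tc] := Hc i.
apply: (inverse_uniq hW Wc) (Hd i).
move: E1 E2; rewrite [_ #1 _]A2m_compl // [_ #1 _]A2m_compl //.
rewrite -[one2 (s2 _)]/(one2 (A1m a F)) -[one2 (t2 _)]/(one2 (A1m a F')) -!one.
move=> /(congr1 (@mx2 _ _ _)) /= E1 /(congr1 (@mx2 _ _ _)) /= E2.
split; first by rewrite sc tc; exact: He.
- by rewrite sc; apply: (dmx_inj E1).
- by rewrite tc; apply: (dmx_inj E2).
Qed.

Lemma inv3_A3m a b P Q u v : a \in G -> b \in G -> (forall i, in1 (P i)) ->
  (forall i, in1 (Q i)) ->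
  (forall i, cact a i = cact b i -> [/\ in3 (u i), arrow2 (P i) (Q i) (s3 (u i)),
     arrow2 (P i) (Q i) (t3 (u i)) & inverse3 (C := C) (u i) (v i)]) ->
  inv3 (A3m a b P Q P Q u) = A3m a b P Q P Q v.
Proof.
move=> aG bG HP HQ Huv.
have Hs : arrow2 (A1m a P) (A1m b Q) (A2m a b P Q (fun i => s3 (u i))).
  by apply: A2m_arrow => // i /Huv [].
have Ht : arrow2 (A1m a P) (A1m b Q) (A2m a b P Q (fun i => t3 (u i))).
  by apply: A2m_arrow => // i /Huv [].
apply: choose_orE => [|y'].
  split; first by apply: A3m_arrow => // i /Huv [_ _ _ []].
  - rewrite A3m_vcomp // -[RHS]/(one3 (A2m a b P Q (fun i => s3 (u i)))) A3m_one.
    by apply: A3m_ext => // i /Huv [_ _ _ []].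
  - rewrite A3m_vcomp // -[RHS]/(one3 (A2m a b P Q (fun i => t3 (u i)))) A3m_one.
    by apply: A3m_ext => // i /Huv [_ _ _ []].
case=> /A3m_arrowP [e [-> He]] E1 E2.
apply: A3m_ext => // i Ei; have [Wu _ _ iv] := Huv i Ei.
apply: (inverse3_uniq hW Wu) iv.
move: E1 E2; rewrite !A3m_vcomp //.
rewrite -[one3 (s3 _)]/(one3 (A2m a b P Q (fun i => s3 (u i)))).
rewrite -[one3 (t3 _)]/(one3 (A2m a b P Q (fun i => t3 (u i)))) !A3m_one.
move=> /(congr1 (@mx3 _ _ _)) /= E1 /(congr1 (@mx3 _ _ _)) /= E2.
split; first exact: He.
- exact: (dmx_inj E1).
- exact: (dmx_inj E2).
Qed.

Lemma A2m_eq a b a' b' P Q P' Q' c d : a = a' -> b = b' ->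
  (forall i, P i = P' i) -> (forall i, Q i = Q' i) ->
  (forall i, cact a i = cact b i -> c i = d i) ->
  A2m a b P Q c = A2m a' b' P' Q' d.
Proof. by move=> Ea Eb /funext -> /funext ->; exact: A2m_ext. Qed.

Lemma A3m_eq a b a' b' P Q R S P' Q' R' S' c d : a = a' -> b = b' ->
  (forall i, P i = P' i) -> (forall i, Q i = Q' i) ->
  (forall i, R i = R' i) -> (forall i, S i = S' i) ->
  (forall i, cact a i = cact b i -> c i = d i) ->
  A3m a b P Q R S c = A3m a' b' P' Q' R' S' d.
Proof.
by move=> Ea Eb /funext -> /funext -> /funext -> /funext ->; exact: A3m_ext.
Qed.

Let S_in g i : g \in G -> sh g i \in H. Proof. exact: (sh_in sHG hr). Qed.
Let rho_in g i : g \in G -> in1 (rho X (sh g i)).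
Proof. by move=> gG; apply: (rho_in1 hX); exact: S_in. Qed.
Let one_in (i : 'I_m) : in1 (one1 C). Proof. exact: (W_one1 hW). Qed.

Lemma inv2P (a : A2 C) : (exists b, inverse2 a b) -> inverse2 a (inv2 a).
Proof.
by move=> e; rewrite /inv2 /choose_or; case: pselect => // e'; case: cid.
Qed.

Lemma inv3P (x : A3 C) : (exists y, inverse3 x y) -> inverse3 x (inv3 x).
Proof.
by move=> e; rewrite /inv3 /choose_or; case: pselect => // e'; case: cid.
Qed.

Lemma sh_V g i : g \in G -> sh g^-1 i = (sh g (cact g^-1 i))^-1.
Proof. by move=> gG; rewrite -{1}(cactKV sHG hr i gG) (shV sHG hr). Qed.

Lemma unit2_ind g : g \in G -> unit2 Xi g =
  A2m 1 1 (fun=> one1 C)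
    (fun i => op0_11 C (rho X (sh g (cact g^-1 i))) (rho X (sh g^-1 i)))
    (fun i => unit2 X (sh g (cact g^-1 i))).
Proof.
move=> gG; rewrite /unit2 ind_phiE ?groupV //.
have -> : A2m (g * g^-1) (g * g^-1)
    (fun i => op0_11 C (rho X (sh g (cact g^-1 i))) (rho X (sh g^-1 i)))
    (fun i => rho X (sh (g * g^-1) i))
    (fun i => phi X (sh g (cact g^-1 i)) (sh g^-1 i)) =
  A2m 1 1 (fun i => op0_11 C (rho X (sh g (cact g^-1 i))) (rho X (sh g^-1 i)))
    (fun=> one1 C) (fun i => phi X (sh g (cact g^-1 i)) (sh g (cact g^-1 i))^-1).
  apply: A2m_eq; rewrite ?mulgV // => i; first by rewrite (sh1 sHG hr) (rho_1 hX).
  by rewrite -sh_V.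
have HI i := phi_iso2 hX (S_in (cact g^-1 i) gG) (groupVr (S_in (cact g^-1 i) gG)).
apply: inv2_A2m => // i.
- by apply: (W_op0_11 hW); apply: rho_in; rewrite ?groupV.
- by have [+ _] := HI i; rewrite mulgV (rho_1 hX) -sh_V.
- by apply: inv2P; have [_ ?] := HI i.
Qed.

(** The source is the identity matrix and the target the induced rho_f, so only the diagonal entries
    at i fixed by f exist; the values of c elsewhere are not read. *)
Definition iob f c : A2 M :=
  A2m 1 f (fun=> one1 C) (fun i => rho X (sh f i)) c.
Definition imor f u : A3 M :=
  A3m 1 f (fun=> one1 C) (fun i => rho X (sh f i)) (fun=> one1 C) (fun i => rho X (sh f i)) u.

Section Conjugate.
Variables f g : gT.
Hypotheses (fG : f \in G) (gG : g \in G).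

Lemma cact_conj l : cact 1 l = cact (g * f * g^-1) l ->
  cact f (cact g^-1 l) = cact g^-1 l.
Proof.
rewrite (cact1 sHG hr) !(cactM sHG hr) ?groupM ?groupV // => E.
by rewrite {2}E (cactVK sHG hr).
Qed.

(** The component at l is made from the component at g^-1 l by the local element of [H] that g
    contributes there: psi_g permutes the components. *)
Lemma psi2_ind c : psi2 Xi f g (iob f c) =
  iob (g * f * g^-1) (fun l => psi2 X (sh f (cact g^-1 l)) (sh g (cact g^-1 l)) (c (cact g^-1 l))).
Proof.
have VG := groupVr gG; have gfG : g * f \in G by rewrite groupM.
rewrite -[LHS]/(op1_22 M (op1_22 M (op1_22 M (unit2 Xi g)
   (op0_21 M (op0_12 M (rho Xi g) (iob f c)) (rho Xi g^-1)))
   (op0_21 M (phi Xi g f) (rho Xi g^-1))) (phi Xi (g * f) g^-1)).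
rewrite unit2_ind // !ind_rhoE // !ind_phiE // /iob.
rewrite !(A2m_wl, A2m_wr) ?groupM //.
rewrite A2m_compl; last by rewrite mulg1 mulgV.
rewrite A2m_compr // A2m_compr //.
apply: A2m_eq => // l /cact_conj El.
by rewrite !(cact1 sHG hr) El (shM sHG hr) // El sh_V.
Qed.

Lemma psi3_ind u : psi3 Xi f g (imor f u) =
  imor (g * f * g^-1) (fun l => psi3 X (sh f (cact g^-1 l)) (sh g (cact g^-1 l)) (u (cact g^-1 l))).
Proof.
have VG := groupVr gG; have gfG : g * f \in G by rewrite groupM.
rewrite -[LHS]/(op1_33 M (op1_33 M (op1_33 M (one3 (unit2 Xi g))
   (op0_31 M (op0_13 M (rho Xi g) (imor f u)) (rho Xi g^-1)))
   (one3 (op0_21 M (phi Xi g f) (rho Xi g^-1)))) (one3 (phi Xi (g * f) g^-1))).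
rewrite unit2_ind // !ind_rhoE // !ind_phiE // /imor.
rewrite !(A3m_wl, A3m_wr, A2m_wr) ?groupM // !A3m_one.
rewrite A3m_compl; last by rewrite mulg1 mulgV.
rewrite A3m_compr // A3m_compr //.
apply: A3m_eq => // l /cact_conj El.
by rewrite !(cact1 sHG hr) El (shM sHG hr) // El sh_V.
Qed.
End Conjugate.

Lemma inv3_PhiE g3 g2 g1 : g3 \in G -> g2 \in G -> g1 \in G ->
  inv3 (Phi Xi g3 g2 g1) =
  A3m (g3 * (g2 * g1)) (g3 * (g2 * g1))
    (fun i => op0_11 C (rho X (sh g3 (cact (g2 * g1) i)))
       (op0_11 C (rho X (sh g2 (cact g1 i))) (rho X (sh g1 i))))
    (fun i => rho X (sh (g3 * (g2 * g1)) i))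
    (fun i => op0_11 C (rho X (sh g3 (cact (g2 * g1) i)))
       (op0_11 C (rho X (sh g2 (cact g1 i))) (rho X (sh g1 i))))
    (fun i => rho X (sh (g3 * (g2 * g1)) i))
    (fun i => inv3 (Phi X (sh g3 (cact (g2 * g1) i)) (sh g2 (cact g1 i)) (sh g1 i))).
Proof.
move=> G3 G2 G1; rewrite ind_PhiE //.
set P := fun i => op0_11 C (rho X (sh g3 (cact (g2 * g1) i))) _.
set Q := fun i => rho X (sh (g3 * (g2 * g1)) i).
(* [ind_PhiE] writes the boundary functors of source and target in two equal ways; [inv3_A3m] needs
   them written alike. *)
rewrite (@A3m_eq _ _ (g3 * (g2 * g1)) (g3 * (g2 * g1)) _ _ _ _ P Q P Q _ _ erefl erefl
  (fun=> erefl) (fun=> erefl) _ _ (fun _ _ => erefl)); last 2 first.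
- by move=> i; rewrite /P (cactM sHG hr).
- by move=> i; rewrite /Q mulgA.
apply: inv3_A3m; rewrite ?groupM //.
- move=> i; apply: (W_op0_11 hW); last apply: (W_op0_11 hW); apply: rho_in; rewrite ?groupM //.
- by move=> i; apply: rho_in; rewrite ?groupM.
move=> i _.
have [[W3 s t] ex] := Phi_iso3 hX (S_in (cact (g2 * g1) i) G3) (S_in (cact g1 i) G2) (S_in i G1).
have [Ws Wt] := (W3_src hW W3, W3_tgt hW W3); have [ss tt] := (modif_tsrc (W3_modif hW W3), modif_ttgt (W3_modif hW W3)).
have [[W21 s21 t21] _] := phi_iso2 hX (S_in (cact g1 i) G2) (S_in i G1).
have [[W31 s31 t31] _] := phi_iso2 hX (S_in (cact (g2 * g1) i) G3) (S_in i (groupM G2 G1)).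
have A : arrow2 (C := C) (P i) (Q i) (s3 (Phi X (sh g3 (cact (g2 * g1) i)) (sh g2 (cact g1 i)) (sh g1 i))).
  split=> //; first by rewrite s; exact: (congr1 (compF _) s21).
  by rewrite s -(shM sHG hr) //; apply: (etrans t31); rewrite /Q -(shM sHG hr) ?groupM.
split=> //; last exact: inv3P.
by case: A => _ As At; split=> //; [rewrite -As; exact: esym | rewrite -At; exact: esym].
Qed.

Section Composite.
Variables h g : gT.
Hypotheses (hG : h \in G) (gG : g \in G).
Local Notation j l := (cact (g^-1 * h^-1) l).

(** The entries u are left existential: they take the form of a local Lambda only in columns l whose
    index [j l] is fixed by e, and the later arguments read only those. *)
Lemma Lam_ind e : e \in G -> exists u,
  let P l := op0_11 C (rho X (sh h (cact (g * e) (j l)))) (op0_11 C (rho X (sh g (cact e (j l))))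
     (op0_11 C (rho X (sh e (j l))) (op0_11 C (rho X (sh g^-1 (cact h^-1 l))) (rho X (sh h^-1 l))))) in
  let k := h * g * e * (g^-1 * h^-1) in
  let Q l := rho X (sh k l) in
  Lam Xi h g e = A3m k k P Q P Q u /\
  forall l, cact e (j l) = j l -> u l = Lam X (sh h (cact g (j l))) (sh g (j l)) (sh e (j l)).
Proof.
move=> eG; have [VG VH] := (groupVr gG, groupVr hG).
eexists; cbv zeta; split.
  rewrite /Lam /comp1c /comp0c /comp1_22 /comp1_23 /comp1_32 /comp1_33.
  rewrite /comp0_11 /comp0_12 /comp0_21 /comp0_13 /comp0_31.
  rewrite inv3_PhiE ?groupM // !ind_PhiE ?groupM // !ind_phiE ?groupM // !ind_rhoE //.
  rewrite !A1m_mul ?groupM // !(A2m_wl, A2m_wr) ?groupM // !(A3m_wl, A3m_wr) ?groupM //.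
  rewrite A2m_compl ?mulgA // !A3m_one.
  rewrite !A3m_compl ?mulgA // !A3m_vcomp ?mulgA //.
  have cM a b i : a \in G -> b \in G -> cact (a * b) i = cact a (cact b i) by exact: (cactM sHG hr).
  apply: A3m_eq; rewrite ?mulgA //.
  by move=> l; rewrite !cM ?groupM.
move=> l El; rewrite (cactM sHG hr) // in El.
have E1 : cact h^-1 l = cact g (cact g^-1 (cact h^-1 l)) by rewrite (cactKV sHG hr).
have Eg : sh g^-1 (cact h^-1 l) = (sh g (cact g^-1 (cact h^-1 l)))^-1 by rewrite -sh_V.
have Eh : sh h^-1 l = (sh h (cact g (cact g^-1 (cact h^-1 l))))^-1 by rewrite -E1 -sh_V.
rewrite Eg Eh !(cactM sHG hr) ?groupM // !(shM sHG hr) ?groupM //.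
rewrite !El ?Eg.
by [].
Qed.

Let a l := sh h (cact g (j l)).
Let b l := sh g (j l).
Let P1 l := compF (rho X (a l)) (compF (rho X (b l)) (compF (rho X (b l)^-1) (rho X (a l)^-1))).

Let aH l : a l \in H. Proof. exact: S_in. Qed.
Let bH l : b l \in H. Proof. exact: S_in. Qed.

Let gV l : sh g^-1 (cact h^-1 l) = (b l)^-1.
Proof. by rewrite sh_V // /b (cactM sHG hr) ?groupV. Qed.
Let hV l : sh h^-1 l = (a l)^-1.
Proof. by rewrite sh_V // /a (cactM sHG hr) ?groupV // (cactKV sHG hr). Qed.
Let cg l : cact h^-1 l = cact g (j l).
Proof. by rewrite (cactM sHG hr) ?groupV // (cactKV sHG hr). Qed.

Let nf := (cactM sHG hr, shM sHG hr, cact1 sHG hr, sh1 sHG hr, cactVK sHG hr, shV sHG hr).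

Lemma Lft1_ind : Lft Xi h g 1 = A2m 1 1 P1 (fun=> one1 C) (fun l => Lft X (a l) (b l) 1).
Proof.
have [VG VH] := (groupVr gG, groupVr hG).
rewrite /Lft /comp1c /comp0c /comp1_22 /comp0_11 /comp0_12 /comp0_21.
rewrite !ind_phiE ?groupM // !ind_rhoE //.
rewrite !A1m_mul ?groupM // !(A2m_wl, A2m_wr) ?groupM //.
do 3 (rewrite A2m_compl ?mulgA //).
have k1 : h * g * 1 * g^-1 * h^-1 = 1 by rewrite mulg1 mulgK mulgV.
apply: A2m_eq; rewrite ?mulgA // => l.
- by rewrite !(sh1 sHG hr) !(cact1 sHG hr) (rho_1 hX) gV hV mulg1 /= compF_idr.
- by rewrite k1 (sh1 sHG hr) (rho_1 hX).
move=> _; rewrite gV hV cg /a /b; move: (j l) => i.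
rewrite !nf ?groupM // !nf ?groupM // !mulg1; by [].
Qed.

Lemma Rgt1_ind : Rgt Xi h g 1 = A2m 1 1 P1 (fun=> one1 C) (fun l => Rgt X (a l) (b l) 1).
Proof.
have [VG VH] := (groupVr gG, groupVr hG).
rewrite /Rgt /comp1c /comp0c /comp1_22 /comp0_11 /comp0_12 /comp0_21.
rewrite !ind_phiE ?groupM // !ind_rhoE ?groupM //.
rewrite !A1m_mul ?groupM // !(A2m_wl, A2m_wr) ?groupM //.
do 3 (rewrite A2m_compl ?mulgA //).
have k1 : h * g * 1 * g^-1 * h^-1 = 1 by rewrite mulg1 mulgK mulgV.
apply: A2m_eq; rewrite ?mulgA // => l.
- by rewrite mul1g (sh1 sHG hr) (rho_1 hX) /P1 gV hV.
- by rewrite k1 (sh1 sHG hr) (rho_1 hX).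
move=> _; rewrite mul1g (shM sHG hr _ VG VH) gV hV cg /a /b; move: (j l) => i.
rewrite !nf ?groupM // !mulg1; by [].
Qed.

Lemma Lam1_ind : Lam Xi h g 1 = A3m 1 1 P1 (fun=> one1 C) P1 (fun=> one1 C)
  (fun l => Lam X (a l) (b l) 1).
Proof.
have [u [E Eu]] := Lam_ind (group1 G); rewrite E.
have k1 : h * g * 1 * (g^-1 * h^-1) = 1 by rewrite mulg1 -invMg mulgV.
have P1E l : op0_11 C (rho X (sh h (cact (g * 1) (j l))))
   (op0_11 C (rho X (sh g (cact 1 (j l)))) (op0_11 C (rho X (sh 1 (j l)))
   (op0_11 C (rho X (sh g^-1 (cact h^-1 l))) (rho X (sh h^-1 l))))) = P1 l.
  by rewrite (sh1 sHG hr) mulg1 (cact1 sHG hr) (rho_1 hX) gV hV.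
have Q1E l : rho X (sh (h * g * 1 * (g^-1 * h^-1)) l) = one1 C.
  by rewrite k1 (sh1 sHG hr) (rho_1 hX).
apply: A3m_eq => // l _; rewrite Eu ?(cact1 sHG hr) //.
by rewrite (sh1 sHG hr).
Qed.

(** For e = 1 every index is fixed, so L^1, R^1 and Lambda^1 have full columns and are inverted
    entrywise. The support of the whole composite consists of columns where f fixes [j l], which is
    where [Lam_ind] gives Lambda^f. *)
Lemma Gamma_ind f c : f \in G ->
  Gamma Xi f h g (iob f c) =
  imor (h * g * f * (g^-1 * h^-1))
    (fun l => Gamma X (sh f (j l)) (a l) (b l) (c (j l))).
Proof.
move=> fG; have [VG VH] := (groupVr gG, groupVr hG).
have I1 l : in1 (c := C) (P1 l).
  by do !apply: (W_op0_11 hW); apply: (rho_in1 hX); rewrite ?groupV.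
have HL l := sub_Lam1_iso hW hX (aH l) (bH l).
have iL : inv2 (Lft Xi h g 1) = A2m 1 1 (fun=> one1 C) P1 (fun l => inv2 (Lft X (a l) (b l) 1)).
  rewrite Lft1_ind; apply: inv2_A2m => // l; first by case: (HL l) => -[].
  by apply: inv2P; case: (HL l) => -[].
have iR : inv2 (Rgt Xi h g 1) = A2m 1 1 (fun=> one1 C) P1 (fun l => inv2 (Rgt X (a l) (b l) 1)).
  rewrite Rgt1_ind; apply: inv2_A2m => // l; first by case: (HL l) => _ -[].
  by apply: inv2P; case: (HL l) => _ -[].
have iLa : inv3 (Lam Xi h g 1) = A3m 1 1 P1 (fun=> one1 C) P1 (fun=> one1 C)
    (fun l => inv3 (Lam X (a l) (b l) 1)).
  rewrite Lam1_ind; apply: inv3_A3m => // l _.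
  have [[AL _] [AR _] [[W3L sL tL] iso]] := HL l.
  by rewrite sL tL; split=> //; exact: inv3P.
rewrite /Gamma iL iR iLa.
rewrite /comp1c /comp0c /comp1_22 /comp1_23 /comp1_32 /comp1_33.
rewrite /comp0_11 /comp0_12 /comp0_21 /comp0_13 /comp0_31.
have [u [-> Eu]] := Lam_ind fG.
rewrite !ind_rhoE // !A1m_mul ?groupM // /iob !(A2m_wl, A2m_wr) ?groupM // !A3m_one.
do 2 (rewrite A3m_compl //).
rewrite A3m_compl; last by rewrite mulg1 -invMg mulgV.
rewrite A3m_compr //.
apply: A3m_eq => // l El; have Ef : cact f (j l) = j l.
  move: El; rewrite ?invMg (cact1 sHG hr) !(cactM sHG hr) ?groupM // => El.
  by rewrite {2}El !(cactVK sHG hr).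
by rewrite !(cact1 sHG hr) gV hV Eu.
Qed.

End Composite.

Lemma zeroM_arr x a b : trace2_ob X x a -> trace2_ob X x b ->
  arrow3 (C := C) a b (zeroM a b).
Proof.
move=> [Wa sa ta] [Wb sb tb]; split=> //.
by apply: (W_zero3 hW) => //; [exact: etrans sa (esym sb)|exact: etrans ta (esym tb)].
Qed.

Lemma zeroME x a b u : trace2_ob X x a -> trace2_ob X x b ->
  arrow3 (C := C) a b u -> scaleM 0 u = zeroM a b.
Proof.
move=> [Wa sa ta] [Wb sb tb] [Wu su tu].
apply: scaleM0 su tu; [exact: (W2_pseudonat hW)|exact: (W2_pseudonat hW)| | |exact: (W3_modif hW)].
- exact: etrans sa (esym sb).
- exact: etrans ta (esym tb).
Qed.

Lemma zero_comp x a b c u : trace2_ob X x a -> trace2_ob X x b -> trace2_ob X x c ->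
  arrow3 (C := C) b c u -> vcompM (zeroM a b) u = zeroM a c.
Proof.
move=> Ha Hb Hc Hu; have [Wu su tu] := Hu; have Hz := zeroM_arr Ha Hb.
have [Wz _ _] := Hz; rewrite -(zeroME Ha Hb Hz) vcompM_scalel //; try exact: (W3_modif hW).
by apply: (zeroME Ha Hc); split=> //; apply: (W_op2_33 hW).
Qed.

Lemma comp_zero x a b c u : trace2_ob X x a -> trace2_ob X x b -> trace2_ob X x c ->
  arrow3 (C := C) a b u -> vcompM u (zeroM b c) = zeroM a c.
Proof.
move=> Ha Hb Hc Hu; have [Wu su tu] := Hu; have Hz := zeroM_arr Hb Hc.
have [Wz _ _] := Hz; rewrite -(zeroME Hb Hc Hz) vcompM_scaler //; try exact: (W3_modif hW).
by apply: (zeroME Ha Hc); split=> //; apply: (W_op2_33 hW).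
Qed.

Lemma psi3_zero x g a b : x \in H -> g \in H -> trace2_ob X x a -> trace2_ob X x b ->
  psi3 X x g (zeroM a b) = zeroM (psi2 X x g a) (psi2 X x g b).
Proof.
move=> xH gH Ha Hb; have Hz := zeroM_arr Ha Hb.
rewrite -{1}(zeroME Ha Hb Hz) (sub_psi3_scale hW hX xH gH 0%R Ha Hb Hz).
apply: (zeroME (sub_psi2_ob hW hX xH gH Ha) (sub_psi2_ob hW hX xH gH Hb)).
exact: (sub_psi3_arrow hW hX xH gH Ha Hb Hz).
Qed.

(** Zero transformations supply objects to fill the components that are not under study. *)
Lemma trace2_ob_ex x : x \in H -> exists z, trace2_ob X x z.
Proof.
move=> xH; have [z [Wz sz tz _]] := W_zero2 hW (W_one1 hW) (rho_in1 hX xH).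
by exists z.
Qed.

(** * The 2-categorical trace as a product of local ones *)

Section Fixed.
Variable f : gT.
Hypothesis fG : f \in G.
Local Notation fixed i := (cact f i = i).
Local Notation T := (trace2_ob X).
Local Notation arr := (arrow3 (C := C)).

Lemma fixedE i : cact 1 i = cact f i -> fixed i.
Proof. by rewrite (cact1 sHG hr) => <-. Qed.

Lemma iob_ob c : (forall i, fixed i -> T (sh f i) (c i)) ->
  trace2_ob Xi f (iob f c).
Proof.
move=> Hc; rewrite /trace2_ob ind_one ind_rhoE //.
by apply: A2m_arrow => // [i|i /fixedE]; [exact: rho_in | exact: Hc].
Qed.

Lemma iobP w : trace2_ob Xi f w ->
  exists c, w = iob f c /\ forall i, fixed i -> T (sh f i) (c i).
Proof.
rewrite /trace2_ob ind_one ind_rhoE // => /A2m_arrowP [c [-> Hc]].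
by exists c; split=> // i E; apply: Hc; rewrite (cact1 sHG hr).
Qed.

Lemma iob_arrow c : (forall i, fixed i -> T (sh f i) (c i)) ->
  arrow2 (A1m 1 (fun=> one1 C)) (A1m f (fun i => rho X (sh f i))) (iob f c).
Proof.
by move=> Hc; apply: A2m_arrow => // [i|i /fixedE]; [exact: rho_in | exact: Hc].
Qed.

Lemma imor_arrow c d u : (forall i, fixed i -> T (sh f i) (c i)) ->
  (forall i, fixed i -> T (sh f i) (d i)) ->
  (forall i, fixed i -> arr (c i) (d i) (u i)) ->
  arrow3 (iob f c) (iob f d) (imor f u).
Proof.
move=> Hc Hd Hu; apply: A3m_arrow => //; try exact: iob_arrow.
by move=> i /fixedE; exact: Hu.
Qed.

Lemma imorP c d x : arrow3 (iob f c) (iob f d) x ->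
  exists u, x = imor f u /\ forall i, fixed i -> arr (c i) (d i) (u i).
Proof.
move=> /A3m_arrowP [u [-> Hu]]; exists u; split=> // i E.
by apply: Hu; rewrite (cact1 sHG hr).
Qed.

Lemma iob_ext c d : (forall i, fixed i -> c i = d i) -> iob f c = iob f d.
Proof. by move=> E; apply: A2m_ext => // i /fixedE; exact: E. Qed.

Lemma imor_ext u v : (forall i, fixed i -> u i = v i) -> imor f u = imor f v.
Proof. by move=> E; apply: A3m_ext => // i /fixedE; exact: E. Qed.

Lemma iob_inj c d i : iob f c = iob f d -> fixed i -> c i = d i.
Proof.
move=> E Ei; apply: (dmx_inj (a := 1) (b := f)); last by rewrite (cact1 sHG hr).
exact: (congr1 (@mx2 _ _ _) E).
Qed.

Lemma imor_inj u v i : imor f u = imor f v -> fixed i -> u i = v i.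
Proof.
move=> E Ei; apply: (dmx_inj (a := 1) (b := f)); last by rewrite (cact1 sHG hr).
exact: (congr1 (@mx3 _ _ _) E).
Qed.

Lemma imor_comp u v : op2_33 M (imor f u) (imor f v) = imor f (fun i => vcompM (u i) (v i)).
Proof. exact: A3m_vcomp. Qed.

Lemma imor_add u v : add3 (imor f u) (imor f v) = imor f (fun i => addM (u i) (v i)).
Proof. by rewrite /imor /A3m /= /madd3 /= dmx_zip. Qed.

Lemma imor_scale e u : scale3 e (imor f u) = imor f (fun i => scaleM e (u i)).
Proof. by rewrite /imor /A3m /= /mscale3 /= dmx_omap. Qed.

Lemma imor_inv3 c d u : (forall i, fixed i -> T (sh f i) (c i)) ->
  (forall i, fixed i -> T (sh f i) (d i)) ->
  (forall i, fixed i -> arr (c i) (d i) (u i) /\ exists v, inverse3 (C := C) (u i) v) ->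
  inv3 (imor f u) = imor f (fun i => inv3 (u i)).
Proof.
move=> Hc Hd Hu; apply: inv3_A3m => // [i|i /fixedE Ei]; first exact: rho_in.
have [[Wu su tu] iu] := Hu i Ei; split=> //; last exact: inv3P.
- by rewrite su; exact: Hc.
- by rewrite tu; exact: Hd.
Qed.

End Fixed.

Definition entry2 (w : A2 M) i : trans2 V := odflt (idT (idF V)) (mx2 w i i).
Definition entry3 (x : A3 M) i : modif V := odflt (idM (idT (idF V))) (mx3 x i i).

(** * The categorical trace as a direct sum of local ones *)

Section Trace.
Variable f : gT.
Hypothesis fG : f \in G.
Local Notation fixed i := (cact f i = i).
Local Notation T := (trace2_ob X).
Local Notation arr := (arrow3 (C := C)).
Local Notation Uf := (centralizer_action Xi f).
Local Notation good c := (forall i, fixed i -> T (sh f i) (c i)).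

Lemma entry2E c i : fixed i -> entry2 (iob f c) i = c i.
Proof. by move=> E; rewrite /entry2 mxE (cact1 sHG hr) E eqxx. Qed.

Lemma entry3E u i : fixed i -> entry3 (imor f u) i = u i.
Proof. by move=> E; rewrite /entry3 mxE (cact1 sHG hr) E eqxx. Qed.

Definition base_ob i : trans2 V := sval (cid (trace2_ob_ex (S_in i fG))).
Lemma base_obP i : T (sh f i) (base_ob i).
Proof. exact: svalP (cid (trace2_ob_ex (S_in i fG))). Qed.

(** The object on which the i-th component of a transformation is tested. *)
Definition base_with i d j : trans2 V := if j == i then d else base_ob j.
Lemma base_with_good i d : T (sh f i) d -> good (base_with i d).
Proof.
by move=> Hd j _; rewrite /base_with; case: eqP => [->|_] //; exact: base_obP.
Qed.
Lemma base_with_id i d : base_with i d i = d.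
Proof. by rewrite /base_with eqxx. Qed.

Section Degree.
Variable g : gT.
Hypotheses (gG : g \in G) (gf : g * f * g^-1 = f).
Local Notation p i := (cact g^-1 i).

Lemma fixed_pre i : fixed i -> fixed (p i).
Proof.
move=> Ei; rewrite -(cactM sHG hr) ?groupV //.
have -> : f * g^-1 = g^-1 * f by apply: (mulgI g); rewrite !mulgA gf mulgV mul1g.
by rewrite (cactM sHG hr) ?groupV // Ei.
Qed.

Lemma sh_pre i : fixed i -> sh g (p i) * sh f (p i) * (sh g (p i))^-1 = sh f i.
Proof.
move=> Ei; rewrite -[in RHS]gf !(shM sHG hr) ?groupM ?groupV //.
by rewrite (fixed_pre Ei) (sh_V i gG).
Qed.

Definition tgt_ob (c : 'I_m -> trans2 V) i : trans2 V :=
  psi2 X (sh f (p i)) (sh g (p i)) (c (p i)).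
Definition tgt_mor (u : 'I_m -> modif V) i : modif V :=
  psi3 X (sh f (p i)) (sh g (p i)) (u (p i)).

Lemma psi2_iob c : psi2 Xi f g (iob f c) = iob f (tgt_ob c).
Proof. by rewrite psi2_ind // gf. Qed.
Lemma psi3_imor u : psi3 Xi f g (imor f u) = imor f (tgt_mor u).
Proof. by rewrite psi3_ind // gf. Qed.

Lemma tgt_good c : good c -> good (tgt_ob c).
Proof.
move=> Hc i Ei; rewrite -(sh_pre Ei).
by apply: (sub_psi2_ob hW hX (S_in _ fG) (S_in _ gG)); apply: Hc; exact: fixed_pre.
Qed.

Lemma pre_fix i : cact g i = i -> p i = i.
Proof. by move=> E; rewrite -{1}E (cactVK sHG hr). Qed.

Variable th : A2 M -> A3 M.
Hypothesis Hth : cat_trace (U := Uf) g th.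

Definition tr_entry c i : modif V := entry3 (th (iob f c)) i.

Lemma tr_entryP c : good c -> th (iob f c) = imor f (tr_entry c) /\
  forall i, fixed i -> arr (c i) (tgt_ob c i) (tr_entry c i).
Proof.
move=> Hc.
have : arrow3 (iob f c) (psi2 Xi f g (iob f c)) (th (iob f c)).
  exact: (proj1 Hth _ (iob_ob fG Hc)).
rewrite psi2_iob => /imorP [u [E Hu]].
have Eu i : fixed i -> tr_entry c i = u i by move=> Ei; rewrite /tr_entry E entry3E.
split; first by rewrite E; apply: imor_ext => i Ei; rewrite -/(tr_entry c i) Eu.
by move=> i Ei; rewrite Eu //; exact: Hu.
Qed.

Lemma tr_entry_nat c d u i : good c -> good d ->
  (forall i, fixed i -> arr (c i) (d i) (u i)) -> fixed i ->
  vcompM (u i) (tr_entry d i) = vcompM (tr_entry c i) (tgt_mor u i).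
Proof.
move=> Hc Hd Hu Ei.
have : op2_33 M (imor f u) (th (iob f d)) =
    op2_33 M (th (iob f c)) (psi3 Xi f g (imor f u)).
  exact: (proj2 Hth _ _ _ (iob_ob fG Hc) (iob_ob fG Hd) (imor_arrow fG Hc Hd Hu)).
rewrite (proj1 (tr_entryP Hc)) (proj1 (tr_entryP Hd)) psi3_imor !imor_comp => E.
exact: (imor_inj E Ei).
Qed.

Definition restr i d : modif V := tr_entry (base_with i d) i.

(** A morphism of the i-th component is extended by zero to the other components; naturality of
    [th], read at i, is then naturality of the restriction. *)
Lemma restr_nat i : fixed i -> cact g i = i -> nat_trans X (sh f i) (sh g i) (restr i).
Proof.
move=> Ei Eg; have Ep := pre_fix Eg; split=> [d Hd|c d u Hc Hd Hu].
  have [_ /(_ i Ei)] := tr_entryP (base_with_good Hd).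
  by rewrite /tgt_ob Ep base_with_id.
pose v j := if j == i then u else zeroM (base_with i c j) (base_with i d j).
have Hv j : fixed j -> arr (base_with i c j) (base_with i d j) (v j).
  move=> Ej; rewrite /v; case: eqP => [->|_]; first by rewrite !base_with_id.
  by apply: zeroM_arr; apply: base_with_good.
have := tr_entry_nat (base_with_good Hc) (base_with_good Hd) Hv Ei.
by rewrite /tgt_mor Ep /v eqxx.
Qed.

(** Naturality along the morphism, from c to the test object with the same i-th component, that is
    the identity at i and zero elsewhere. *)
Lemma tr_entry_restr c i : good c -> fixed i -> cact g i = i ->
  tr_entry c i = restr i (c i).
Proof.
move=> Hc Ei Eg; have Ep := pre_fix Eg; have Hb := base_with_good (Hc i Ei).
pose v j := if j == i then idM (c i) else zeroM (c j) (base_with i (c i) j).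
have Hv j : fixed j -> arr (c j) (base_with i (c i) j) (v j).
  move=> Ej; rewrite /v; case: (j =P i) => [->|_].
    rewrite base_with_id; split=> //; apply: (W_one3 hW).
    by have [] := Hc i Ei.
  by apply: zeroM_arr; [apply: Hc | apply: Hb].
have := tr_entry_nat Hc Hb Hv Ei; rewrite /tgt_mor Ep /v eqxx -/(restr i (c i)).
have [W1' s1 t1] := proj2 (tr_entryP Hc) i Ei.
have [W2' s2' t2'] := proj2 (tr_entryP Hb) i Ei; rewrite base_with_id in s2'.
rewrite (sub_psi3_id hW hX (S_in i fG) (S_in i gG) (Hc i Ei)).
have El : vcompM (idM (c i)) (restr i (c i)) = restr i (c i).
  by rewrite -[X in idM X]s2'; exact: (vcompM_idl (W3_modif hW W2')).
have -> : psi2 X (sh f i) (sh g i) (c i) = tgt_ob c i by rewrite /tgt_ob Ep.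
by rewrite El => ->; rewrite -t1; apply: esym; exact: (vcompM_idr (W3_modif hW W1')).
Qed.

(** Naturality along the endomorphism of c that is the identity at i and zero elsewhere: psi_g
    brings the zero at g^-1 i to the place i. *)
Lemma tr_entry_zero c i : good c -> fixed i -> cact g i <> i ->
  tr_entry c i = zeroM (c i) (tgt_ob c i).
Proof.
move=> Hc Ei Eg.
have Ep : p i <> i by move=> E; apply: Eg; rewrite -{1}E (cactKV sHG hr).
pose v j := if j == i then idM (c i) else zeroM (c j) (c j).
have Hv j : fixed j -> arr (c j) (c j) (v j).
  move=> Ej; rewrite /v; case: (j =P i) => [->|_].
    by split=> //; apply: (W_one3 hW); have [] := Hc i Ei.
  by apply: zeroM_arr; apply: Hc.
have := tr_entry_nat Hc Hc Hv Ei; rewrite /tgt_mor /v eqxx.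
case: (p i =P i) => // _; have A := proj2 (tr_entryP Hc) i Ei.
have Hp := Hc _ (fixed_pre Ei).
rewrite (psi3_zero (S_in _ fG) (S_in _ gG) Hp Hp) -/(tgt_ob c i).
rewrite (comp_zero (Hc i Ei) (tgt_good Hc Ei) (tgt_good Hc Ei) A) => <-.
have [W1' s1 _] := A.
by rewrite -[X in idM X]s1; apply: esym; exact: (vcompM_idl (W3_modif hW W1')).
Qed.
End Degree.

Section Coordinates.
Variable g : gT.
Hypotheses (gG : g \in G) (gf : g * f * g^-1 = f).
Implicit Type t : 'I_m -> trans2 V -> modif V.

Definition ext_entry t c i : modif V :=
  if cact g i == i then t i (c i) else zeroM (c i) (tgt_ob g c i).
Definition extend t (w : A2 M) : A3 M := imor f (ext_entry t (entry2 w)).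
Local Notation nats t := (forall i, fixed i -> cact g i = i ->
  nat_trans X (sh f i) (sh g i) (t i)).

Lemma extend_iob t c : extend t (iob f c) = imor f (ext_entry t c).
Proof.
apply: imor_ext => // i Ei; rewrite /ext_entry entry2E //; case: eqP => // _.
by rewrite /tgt_ob entry2E //; exact: fixed_pre.
Qed.

Lemma ext_entry_arr t c i : nats t -> good c -> fixed i ->
  arr (c i) (tgt_ob g c i) (ext_entry t c i).
Proof.
move=> ht Hc Ei; rewrite /ext_entry; case: eqP => [Eg|_]; last first.
  by apply: zeroM_arr; [exact: Hc | exact: tgt_good].
by rewrite /tgt_ob (pre_fix gG Eg); apply: (proj1 (ht i Ei Eg)); exact: Hc.
Qed.

Lemma extend_nat t : nats t -> cat_trace (U := Uf) g (extend t).
Proof.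
move=> ht; split=> [w /(iobP fG) [c [-> Hc]]|w w' x /(iobP fG) [c [-> Hc]] /(iobP fG) [d [-> Hd]]].
  suff : arrow3 (iob f c) (psi2 Xi f g (iob f c)) (extend t (iob f c)) by [].
  rewrite psi2_iob // extend_iob.
  by apply: imor_arrow => //; [exact: tgt_good | move=> i; exact: ext_entry_arr].
move=> /imorP [u [-> Hu]].
suff : op2_33 M (imor f u) (extend t (iob f d)) =
    op2_33 M (extend t (iob f c)) (psi3 Xi f g (imor f u)) by [].
rewrite !extend_iob psi3_imor // !imor_comp; apply: imor_ext => // i Ei.
have Ep := fixed_pre gG gf Ei.
rewrite /ext_entry; case: eqP => [Eg|_].
  rewrite /tgt_mor (pre_fix gG Eg); apply: (proj2 (ht i Ei Eg)); by [apply: Hc|apply: Hd|apply: Hu].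
rewrite (comp_zero (Hc i Ei) (Hd i Ei) (tgt_good gG gf Hd Ei) (Hu i Ei)).
rewrite (zero_comp (Hc i Ei) (tgt_good gG gf Hc Ei) (tgt_good gG gf Hd Ei)) //.
exact: (sub_psi3_arrow hW hX (S_in _ fG) (S_in _ gG) (Hc _ Ep) (Hd _ Ep) (Hu _ Ep)).
Qed.

Lemma tr_entry_extend t c i : fixed i -> tr_entry (extend t) c i = ext_entry t c i.
Proof. by move=> Ei; rewrite /tr_entry extend_iob entry3E. Qed.

Lemma extend_restr th c : cat_trace (U := Uf) g th -> good c ->
  th (iob f c) = extend (restr th) (iob f c).
Proof.
move=> Hth Hc; rewrite (proj1 (tr_entryP gG gf Hth Hc)) extend_iob.
apply: imor_ext => // i Ei; rewrite /ext_entry; case: eqP => Eg.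
  exact: (tr_entry_restr gG gf Hth Hc Ei Eg).
exact: (tr_entry_zero gG gf Hth Hc Ei Eg).
Qed.

Variables (n : 'I_m -> nat) (co : forall i, 'rV[K]_(n i) -> trans2 V -> modif V).
Hypothesis n0 : forall i, ~~ [&& cact f i == i & cact g i == i] -> n i = 0%N.
Hypothesis hco : forall i, fixed i -> cact g i = i ->
  trace_coords (U := centralizer_action X (sh f i)) (sh g i) (co (i := i)).

Definition ind_co (v : 'rV[K]_(\sum_i n i)) : A2 M -> A3 M :=
  extend (fun i => co (submxrow v i)).

Lemma co_nat (v : forall i, 'rV_(n i)) : nats (fun i => co (v i)).
Proof. by move=> i Ei Eg; have [Hi _ _] := hco Ei Eg; exact: Hi. Qed.

(** Restriction to the components and extension by zero are mutually inverse, so the local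
    coordinates over the i fixed by f and g are concatenated; by [n0] every other index has
    dimension 0. *)
Lemma ind_coords : trace_coords (U := Uf) g ind_co.
Proof.
split.
- by move=> v; apply: extend_nat; exact: co_nat.
- move=> a u v w /(iobP fG) [c [-> Hc]].
  rewrite /ind_co !extend_iob -[RHS]/(add3 (scale3 (c := M) a _) _) imor_scale imor_add.
  apply: imor_ext => // i Ei; rewrite /ext_entry; case: eqP => [Eg|_].
    have [_ lin _] := hco Ei Eg; apply: etrans (lin a (submxrow u i) (submxrow v i) (c i) (Hc i Ei)).
    by congr (co _ _); apply/rowP => k; rewrite !mxE.
  have [Wa sa ta] := Hc i Ei; have [Wb sb tb] := tgt_good gG gf Hc Ei.
  have [sab tab] : tsrc (c i) = tsrc (tgt_ob g c i) /\ ttgt (c i) = ttgt (tgt_ob g c i).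
    by split; [exact: etrans sa (esym sb) | exact: etrans ta (esym tb)].
  (* At an i moved by g all entries are zero modifications and the claim is a 0 + 0 = 0. *)
  rewrite scaleMr0 // ?addM00 //; exact: (W2_pseudonat hW).
- move=> th Hth.
  have Hr i : exists v : 'rV[K]_(n i), fixed i -> cact g i = i ->
      forall d, T (sh f i) d -> restr th i d = co v d.
    case: (boolP [&& cact f i == i & cact g i == i]) => [/andP[/eqP Ei /eqP Eg]|N].
      have [_ _ ex] := hco Ei Eg; have [v [Hv _]] := ex _ (restr_nat gG gf Hth Ei Eg).
      by exists v => _ _; exact: Hv.
    by exists 0 => Ei Eg; move: N; rewrite Ei Eg !eqxx.
  pose v := \mxrow_i sval (cid (Hr i)); exists v; split=> [w /(iobP fG) [c [-> Hc]]|v' Hv'].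
    rewrite extend_restr // /ind_co !extend_iob; apply: imor_ext => // i Ei.
    rewrite /ext_entry; case: eqP => // Eg.
    rewrite mxrowK; exact: (svalP (cid (Hr i)) Ei Eg _ (Hc i Ei)).
  rewrite -[v']submxrowK; apply/eq_mxrow => i; apply/esym.
  case: (boolP [&& cact f i == i & cact g i == i]) => [/andP[/eqP Ei /eqP Eg]|N]; last first.
    by move: (submxrow v' i) (sval _); rewrite (n0 N) => x y; rewrite [x]thinmx0 [y]thinmx0.
  apply: (coords_inj (hco Ei Eg)) => d Hd.
  (* The agreement of the two transformations is evaluated at the test object with d in place i,
     which isolates the i-th coordinates. *)
  have Hb := base_with_good Hd.
  rewrite -(svalP (cid (Hr i)) Ei Eg d Hd) /restr /tr_entry (Hv' _ (iob_ob fG Hb)).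
  by rewrite /ind_co extend_iob entry3E // /ext_entry Eg eqxx base_with_id.
Qed.

End Coordinates.

Definition gam h g c l : modif V :=
  let q := cact (g^-1 * h^-1) l in
  Gamma X (sh f q) (sh h (cact g q)) (sh g q) (c q).

Section GammaEntries.
Variables h g : gT.
Hypotheses (hG : h \in G) (gG : g \in G).
Hypotheses (hf : h * f * h^-1 = f) (gf : g * f * g^-1 = f).

Lemma Gamma_iob c : Gamma Xi f h g (iob f c) = imor f (gam h g c).
Proof.
rewrite Gamma_ind //; have -> : h * g * f * (g^-1 * h^-1) = f by rewrite -{2}hf -{2}gf !mulgA.
by [].
Qed.

Lemma gam_arr c l : good c -> fixed l ->
  arr (tgt_ob h (tgt_ob g c) l) (tgt_ob (h * g) c l) (gam h g c l).
Proof.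
move=> Hc El; rewrite /gam /tgt_ob invMg !(cactM sHG hr) ?groupV //.
have Ep := fixed_pre hG hf El; have Eq := fixed_pre gG gf Ep.
rewrite (shM sHG hr) // (cactKV sHG hr) // -[in sh f (cact h^-1 l)](sh_pre gG gf Ep).
have := sub_Gamma_arrow hW hX (S_in (cact g^-1 (cact h^-1 l)) fG) (S_in (cact h^-1 l) hG)
  (S_in (cact g^-1 (cact h^-1 l)) gG) (Hc _ Eq).
by rewrite (sh_pre gG gf Ep).
Qed.

Lemma gam_iso c l : good c -> fixed l ->
  exists v, inverse3 (C := C) (gam h g c l) v.
Proof.
move=> Hc El; rewrite /gam (cactM sHG hr) ?groupV //.
have Eq := fixed_pre gG gf (fixed_pre hG hf El).
exact: (sub_Gamma_iso hW hX (S_in _ fG) (S_in _ hG) (S_in _ gG) (Hc _ Eq)).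
Qed.

Lemma gam_inv c l : good c -> fixed l ->
  arr (tgt_ob (h * g) c l) (tgt_ob h (tgt_ob g c) l) (inv3 (C := C) (gam h g c l)).
Proof.
move=> Hc El; have [_ s t] := gam_arr Hc El.
by have [+ _ _] := inv3P (gam_iso Hc El); rewrite s t.
Qed.

Lemma inv3_gam c : good c -> inv3 (imor f (gam h g c)) = imor f (fun l => inv3 (C := C) (gam h g c l)).
Proof.
move=> Hc; have hgG := groupM hG gG.
have hgf : h * g * f * (h * g)^-1 = f by rewrite invMg -{2}hf -{2}gf !mulgA.
apply: (imor_inv3 fG (c := tgt_ob h (tgt_ob g c)) (d := tgt_ob (h * g) c)).
- by do 2 apply: tgt_good => //.
- exact: tgt_good.
- by move=> i Ei; split; [exact: gam_arr | exact: gam_iso].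
Qed.

End GammaEntries.

Lemma tgt_ob1 c l : good c -> fixed l -> tgt_ob 1 c l = c l.
Proof.
move=> Hc El; rewrite /tgt_ob invg1 (cact1 sHG hr) (sh1 sHG hr).
exact: (sub_psi2_1 hW hX (S_in _ fG) (Hc _ El)).
Qed.

Section TraceMap.
Variables g k : gT.
Hypotheses (gG : g \in G) (kG : k \in G).
Hypotheses (gf : g * f * g^-1 = f) (kf : k * f * k^-1 = f) (kg : k * g * k^-1 = g).
Variable th : A2 M -> A3 M.
Hypothesis Hth : cat_trace (U := Uf) g th.
Local Notation p l := (cact k^-1 l).

Definition transport l : trans2 V -> modif V :=
  Psi X (sh f (p l)) (sh f l) (sh k (p l)) (sh g (p l)) (restr th (p l)).

(** The entry at l comes from the restriction at k^-1 l, transported along the local element of k;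
    hence k moves the summands as it moves the cosets. *)
Lemma trace_map_ind c : good c ->
  trace_map (U := Uf) g k th (iob f c) = extend g transport (iob f c).
Proof.
move=> Hc; have VG := groupVr kG; have kgG := groupM kG gG.
have Vf := conj_fix kf; have kgf : k * g * f * (k * g)^-1 = f by rewrite invMg -{2}kf -{2}gf !mulgA.
have f1 : 1 * f * 1^-1 = f by rewrite invg1 mul1g mulg1.
have kV1 : k * k^-1 = 1 := mulgV k.
set c' := tgt_ob k^-1 c; have Hc' : good c' := tgt_good VG Vf Hc.
have [Eth Ath] := tr_entryP gG gf Hth Hc'.
have -> : trace_map (U := Uf) g k th (iob f c) =
  op2_33 M (op2_33 M (op2_33 M (op2_33 M (inv3 (Gamma Xi f 1 1 (iob f c)))
    (inv3 (Gamma Xi f k k^-1 (iob f c)))) (psi3 Xi f k (th (psi2 Xi f k^-1 (iob f c)))))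
    (Gamma Xi f k g (psi2 Xi f k^-1 (iob f c)))) (Gamma Xi f (k * g) k^-1 (iob f c)).
  have -> : inv3 (Gamma Xi f k k^-1 (iob f c)) =
    invMor (U := Uf) (psi2 Xi f k (psi2 Xi f k^-1 (iob f c)))
      (psi2 Xi f (k * k^-1) (iob f c)) (Gamma Xi f k k^-1 (iob f c)); last by [].
  have invMor_s x y (u : A3 M) : s3 u = x -> t3 u = y -> inv3 u = invMor (U := Uf) x y u.
    by move=> <- <-.
  apply: invMor_s; rewrite Gamma_iob // !psi2_iob ?kV1 ?groupM //.
  - by apply: iob_ext => // i Ei; have [_ -> _] := gam_arr kG VG kf Vf Hc Ei.
  - by apply: iob_ext => // i Ei; have [_ _ ->] := gam_arr kG VG kf Vf Hc Ei; rewrite kV1.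
rewrite !psi2_iob // -/c' Eth psi3_imor // !Gamma_iob // !inv3_gam //.
rewrite !imor_comp extend_iob //.
apply: imor_ext => // l El.
have Ei := fixed_pre kG kf El.
have gV : k * (k * g)^-1 = g^-1 by rewrite -[in RHS]kg !invMg invgK !mulgA.
rewrite /ext_entry; case: eqP => El'.
  (* As g and k commute, g fixes k^-1 l together with l, and all indices in the composite match
     those of [Psi]. *)
  have Eg : cact g (p l) = p l.
    rewrite -(cactM sHG hr) //.
    have -> : g * k^-1 = k^-1 * g by apply: (mulgI k); rewrite !mulgA kg mulgV mul1g.
    by rewrite (cactM sHG hr) // El'.
  have q1 : cact g^-1 l = l by rewrite -{1}El' (cactVK sHG hr).
  have q2 : cact g^-1 (p l) = p l by rewrite -{1}Eg (cactVK sHG hr).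
  have Ec : c' (p l) = psi2 X (sh f l) (sh k (p l))^-1 (c l).
    by rewrite /c' /tgt_ob invgK (cactKV sHG hr) // sh_V.
  rewrite /transport /Psi /iG -Ec -(tr_entry_restr gG gf Hth Hc' Ei Eg).
  rewrite /gam invgK !invg1 mulg1 mulgV gV !(cact1 sHG hr) !(sh1 sHG hr) q1.
  rewrite (cactM sHG hr) ?groupV // q2 Eg -sh_V // (shM sHG hr) // Eg.
  by [].
(* In the other case g also moves k^-1 l, so the middle factor is zero and the structure arrows
   around it are absorbed. *)
have Ngi : cact g (p l) <> p l.
  move=> E; apply: El'; rewrite -[in LHS]kg (cactM sHG hr) ?groupM // (cactM sHG hr) // E.
  by rewrite (cactKV sHG hr).
have f1G := group1 G.
have k2 : k * g * k^-1 = g := kg.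
have HA : arr (c l) (c l) (inv3 (C := C) (gam 1 1 c l)).
  have := gam_inv f1G f1G f1 f1 Hc El; rewrite mulg1.
  by rewrite (tgt_ob1 Hc El) (tgt_ob1 (tgt_good f1G f1 Hc) El) (tgt_ob1 Hc El).
have HB := gam_inv kG VG kf Vf Hc El; rewrite kV1 (tgt_ob1 Hc El) in HB.
have HD := gam_arr kG gG kf gf Hc' El.
have HE := gam_arr kgG VG kgf Vf Hc El; rewrite k2 -/c' in HE.
have Hgc := tgt_good gG gf Hc'; have Hkgc := tgt_good kG kf Hgc; have Hkc := tgt_good kG kf Hc'.
rewrite /tgt_mor (tr_entry_zero gG gf Hth Hc' Ei Ngi).
rewrite (psi3_zero (S_in _ fG) (S_in _ kG) (Hc' _ Ei) (Hgc _ Ei)).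
rewrite -!/(tgt_ob k _ l).
rewrite (comp_zero (Hc l El) (Hkc l El) (Hkgc l El) (arrM hW HA HB)).
rewrite (zero_comp (Hc l El) (Hkgc l El) (tgt_good kgG kgf Hc' El) HD).
by rewrite (zero_comp (Hc l El) (tgt_good kgG kgf Hc' El) (tgt_good gG gf Hc El) HE).
Qed.
End TraceMap.

(** * The induced 3-character as the trace of a block matrix *)

Section Character.
Variables g k : gT.
Hypotheses (gG : g \in G) (kG : k \in G).
Hypotheses (gf : g * f * g^-1 = f) (kf : k * f * k^-1 = f) (kg : k * g * k^-1 = g).
Hypothesis findim : forall u h, u \in H -> h \in 'C_H[u] ->
  trace_findim (centralizer_action X u) h.
Local Notation J i := [&& cact f i == i & cact g i == i].

Lemma sh_comm a b i : a \in G -> b \in G -> a * b * a^-1 = b ->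
  cact a i = i -> cact b i = i -> sh a i * sh b i * (sh a i)^-1 = sh b i.
Proof.
move=> aG bG ab Ea Eb; have ab' : a * b = b * a by rewrite -[in RHS]ab mulgKV.
have := congr1 (sh^~ i) ab'; rewrite /= !(shM sHG hr) // Ea Eb => ->.
by rewrite mulgK.
Qed.

Lemma J_act i : J i -> J (cact k i).
Proof.
have E a : a \in G -> k * a * k^-1 = a -> cact a i = i -> cact a (cact k i) = cact k i.
  move=> aG ka Ea; have ak : a * k = k * a by rewrite -[in LHS]ka mulgKV.
  by rewrite -(cactM sHG hr) // ak (cactM sHG hr) // Ea.
by case/andP=> /eqP /(E f fG kf) -> /eqP /(E g gG kg) ->; rewrite !eqxx.
Qed.

(** Indices not fixed by both f and g get dimension 0 and dummy coordinates, so that one block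
    matrix can be indexed by all i. *)
Lemma local_coords i : exists s : {n & 'rV[K]_n -> trans2 V -> modif V},
  (J i -> trace_coords (U := centralizer_action X (sh f i)) (sh g i) (projT2 s)) /\
  (~~ J i -> projT1 s = 0%N).
Proof.
case: (boolP (J i)) => [/andP[/eqP Ef /eqP Eg]|N]; last first.
  by exists (existT _ 0%N (fun _ _ => idM (idT (idF V)))).
have C1 : sh g i \in 'C_H[sh f i].
  rewrite inE S_in //=; apply/cent1P.
  have E : sh g i * sh f i = sh f i * sh g i.
    by rewrite -[in RHS](sh_comm gG fG gf Eg Ef) mulgKV.
  by first [exact: E | exact: esym E].
have [n [co Hco]] := findim (S_in i fG) C1.
by exists (existT _ n co).
Qed.

Let n i := projT1 (sval (cid (local_coords i))).
Let co i : 'rV[K]_(n i) -> trans2 V -> modif V := projT2 (sval (cid (local_coords i))).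
Let hco i : J i ->
  trace_coords (U := centralizer_action X (sh f i)) (sh g i) (co (i := i)).
Proof. by case: (svalP (cid (local_coords i))). Qed.
Let n0 i : ~~ J i -> n i = 0%N.
Proof. by case: (svalP (cid (local_coords i))). Qed.

(** The block is the matrix of [Psi] along k when k sends i to l, and is zero when it does not. *)
Lemma local_mx i l : exists B : 'M[K]_(n i, n l),
  (J i -> cact k i = l -> forall v c, T (sh f l) c ->
     Psi X (sh f i) (sh f l) (sh k i) (sh g i) (co v) c = co (v *m B)%R c) /\
  (cact k i <> l -> B = 0%R).
Proof.
case: (cact k i =P l) => [El|N]; last by exists 0%R; split.
case: (boolP (J i)) => [Ji|N]; last by exists 0%R; split=> // Ji; rewrite Ji in N.
have Jl := J_act Ji; rewrite El in Jl.
have [/andP[/eqP Ef /eqP Eg] /andP[/eqP Ef' /eqP Eg']] := (Ji, Jl).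
have shK a : a \in G -> k * a * k^-1 = a -> cact a i = i -> sh k i * sh a i * (sh k i)^-1 = sh a l.
  move=> aG ka Ea; have ak : a * k = k * a by rewrite -[in LHS]ka mulgKV.
  have := congr1 (sh^~ i) ak; rewrite /= !(shM sHG hr) // El Ea => <-.
  by rewrite mulgK.
have [B HB] := Psi_matrix hW hX (S_in i fG) (S_in l fG) (S_in i kG) (S_in i gG) (S_in l gG)
  (shK f fG kf Ef) (sh_comm gG fG gf Eg Ef) (shK g gG kg Eg) (hco Ji) (hco Jl).
by exists B; split=> // _ _; exact: HB.
Qed.

Let B i l := sval (cid (local_mx i l)).
Let A := \mxblock_(i, l) B i l.

Lemma trace_ind_co v w : trace2_ob Xi f w ->
  trace_map (U := Uf) g k (ind_co g co v) w = ind_co g co (v *m A)%R w.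
Proof.
have hc i : fixed i -> cact g i = i -> trace_coords (U := centralizer_action X (sh f i)) (sh g i) (co (i := i)).
  by move=> Ef Eg; apply: hco; rewrite Ef Eg !eqxx.
have [ic _ _] := ind_coords gG gf n0 hc.
move=> /(iobP fG) [c [-> Hc]]; rewrite (trace_map_ind gG kG gf kf kg (ic v) Hc).
rewrite /ind_co !extend_iob //; apply: imor_ext => // l El.
rewrite /ext_entry; case: eqP => // Egl; rewrite /transport.
set i := cact k^-1 l; have ki : cact k i = l by rewrite (cactKV sHG hr).
have Ei : fixed i := fixed_pre kG kf El.
have Egi : cact g i = i.
  rewrite -(cactM sHG hr) ?groupV //.
  have -> : g * k^-1 = k^-1 * g by apply: (mulgI k); rewrite !mulgA kg mulgV mul1g.
  by rewrite (cactM sHG hr) ?groupV // Egl.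
have Ji : J i by rewrite Ei Egi !eqxx.
have kfi : sh k i * sh f i * (sh k i)^-1 = sh f l := sh_pre kG kf El.
rewrite (sub_Psi_ext hW hX (S_in i fG) (S_in l fG) (S_in i kG) (S_in i gG) kfi
  (th' := co (submxrow v i))) //; last 2 first.
- move=> d Hd; rewrite /restr /tr_entry /ind_co extend_iob // entry3E //.
  by rewrite /ext_entry Egi eqxx base_with_id.
- exact: Hc.
rewrite (proj1 (svalP (cid (local_mx i l))) Ji ki _ _ (Hc l El)); congr (co _ _).
(* In block column l only the block of i = k^-1 l can be nonzero, by injectivity of the action of
   k. *)
rewrite -[in RHS](submxrowK v) mul_mxrow_mxblock mxrowK (bigD1 i) //= big1 ?addr0 //.
move=> j Nj; have -> : B j l = 0%R; last by rewrite mulmx0.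
apply: (proj2 (svalP (cid (local_mx j l)))) => kj; move/eqP: Nj; apply.
by apply: (cact_inj sHG hr kG); rewrite kj.
Qed.

Lemma ind_character3 : trace_findim Uf g /\
  character3 Xi f g k =
    (\sum_(i | [&& cact f i == i, cact g i == i & cact k i == i])
       character3 X (sh f i) (sh g i) (sh k i))%R.
Proof.
have hc i : fixed i -> cact g i = i -> trace_coords (U := centralizer_action X (sh f i)) (sh g i) (co (i := i)).
  by move=> Ef Eg; apply: hco; rewrite Ef Eg !eqxx.
have ic := ind_coords gG gf n0 hc.
split; first by exists (\sum_i n i)%N, (ind_co g co).
have Ht : is_character2 Uf g k (\tr A)%R.
  by exists (\sum_i n i)%N, (ind_co g co), A; split=> //; exact: trace_ind_co.
have -> : character3 Xi f g k = (\tr A)%R.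
  apply: is_character2E Ht => w /(iobP fG) [c [-> Hc]].
  suff : trace2_ob Xi f (psi2 Xi f k^-1 (iob f c)) by [].
  have VG := groupVr kG; have Vf := conj_fix kf.
  by rewrite psi2_iob //; apply: iob_ob => //; exact: tgt_good.
(* The trace is the sum over the diagonal blocks. A block with k i different from i is zero, and one
   whose index is not fixed by f and g has size 0; the others compute the local 3-characters. *)
rewrite mxtrace_mxblock (bigID (fun i => [&& cact f i == i, cact g i == i & cact k i == i])) /=.
rewrite [X in (_ + X)%R]big1 ?addr0 => [|i].
  apply: eq_bigr => i /and3P[/eqP Ef /eqP Eg /eqP Ek].
  have Ji : J i by rewrite Ef Eg !eqxx.
  have skf := sh_comm kG fG kf Ek Ef.
  apply/esym; apply: (character3E hW hX (S_in i fG) (S_in i kG) skf).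
  exists (n i), (co (i := i)), (B i i); split=> //; first exact: hco.
  move=> v c Hc; rewrite (trace_mapE hW hX _ _ (S_in i fG) (S_in i kG) skf Hc).
  exact: (proj1 (svalP (cid (local_mx i i))) Ji Ek).
case: (cact k i =P i) => [Ek|Nk _]; last first.
  by rewrite [B i i](proj2 (svalP (cid (local_mx i i))) Nk) mxtrace0.
rewrite andbT => NJ; move: (B i i); rewrite (n0 NJ) => Z.
by rewrite [Z]flatmx0 mxtrace0.
Qed.

End Character.

End Trace.
End InducedTrace.

(** * Summation over cosets and the character formula *)

Section CosetSum.

Variables (gT : finGroupType) (G H : {group gT}) (sHG : H \subset G).
Variables (m : nat) (r : 'I_m -> gT) (hr : left_coset_reps G H r).
Local Open Scope group_scope.

Lemma coset_of_rep s : s \in G -> exists i, forall j, ((r j)^-1 * s \in H) = (j == i).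
Proof.
move=> sG; have [inj E] := hr.
have : s *: H \in lcosets H G by apply/lcosetsP; exists s.
rewrite -E => /imsetP [i _ Ei]; exists i => j; rewrite -mem_lcoset.
apply/idP/eqP => [/lcoset_eqP Ej|->]; last by rewrite -Ei lcoset_refl.
by apply: inj; rewrite -Ei -Ej.
Qed.

(** Each s in [G] lies in r_i H for exactly one i ([coset_of_rep]), and left multiplication by r_i
    reindexes the inner sum by [H]. *)
Lemma sum_left_cosets (R : zmodType) (P : pred gT) (F : gT -> R) :
  (\sum_(s in G | P s) F s = \sum_i \sum_(h in H | P (r i * h)%g) F (r i * h)%g)%R.
Proof.
transitivity (\sum_(s in G | P s) \sum_(i | ((r i)^-1 * s)%g \in H) F s)%R.
  apply: eq_bigr => s /andP[sG _]; have [i Hi] := coset_of_rep sG.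
  by rewrite (eq_bigl (pred1 i)) ?big_pred1_eq // => j; rewrite Hi.
rewrite (exchange_big_dep predT) //=; apply: eq_bigr => i _.
rewrite (reindex_inj (mulgI (r i))) /=; apply: eq_bigl => h.
rewrite mulKg; case hH : (h \in H); rewrite ?andbF // andbT.
by rewrite groupM ?(reps_in sHG hr) // (subsetP sHG).
Qed.

End CosetSum.

Theorem theorem5p3
  (K : fieldType)
  (charK : has_pchar0 K)
  (rootsK : forall n : nat, (0 < n)%N -> exists z : K, n.-primitive_root z)
  (gT : finGroupType) (G H : {group gT}) (sHG : H \subset G)
  (V : lin2cat K) (W : sub3 V) (W_strict : strict_sub3 W)
  (rho : rep3 gT (cat3_of W)) (rho_rep : is_rep3 rho H)
  (rho_findim : forall u h : gT, u \in H -> h \in 'C_H[u]%g ->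
     trace_findim (centralizer_action rho u) h)
  (m : nat) (r : 'I_m -> gT) (r_reps : left_coset_reps G H r)
  (f g k : gT) (fG : f \in G) (gG : g \in G) (kG : k \in G)
  (cfg : commute f g) (cfk : commute f k) (cgk : commute g k) :
  trace_findim (centralizer_action (ind_rep3 H rho r) f) g /\
  character3 (ind_rep3 H rho r) f g k =
    #|H|%:R^-1 *
    \sum_(s in G | [&& (f ^ s \in H)%g, (g ^ s \in H)%g & (k ^ s \in H)%g])
       character3 rho (f ^ s)%g (g ^ s)%g (k ^ s)%g.
Proof.
have cE (a b : gT) : commute a b -> (b * a * b^-1 = a)%g.
  by move=> ab; rewrite -ab mulgK.
have [fd ->] := ind_character3 W_strict sHG rho_rep r_reps fG gG kG (cE _ _ cfg)
  (cE _ _ cfk) (cE _ _ cgk) rho_findim.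
split=> //; rewrite (sum_left_cosets sHG r_reps).
have H0 : #|H|%:R != 0 :> K.
  by have /pcharf0P -> := charK; rewrite -lt0n cardG_gt0.
(* After multiplication by |H| the sums are compared coset by coset: the inner sum over r_i H must
   be |H| times the local character, or 0 when i is not fixed by all three elements. *)
apply: (mulfI H0); rewrite mulrA divff // mul1r mulr_sumr big_mkcond /=.
apply: eq_bigr => i _.
have mem a : a \in G -> (a ^ r i \in H)%g = (cact H r a i == i).
  by move=> aG; rewrite eq_sym -(mem_shift sHG r_reps i i aG).
have shE a : a \in G -> cact H r a i = i -> sh H r a i = (a ^ r i)%g.
  by move=> aG; rewrite /sh => ->.
case: ifP => [J|N]; last first.
  rewrite big_pred0 // => h; apply/andP => -[hH].
  by rewrite !conjgM !(groupJr _ hH) !mem // N.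
have /and3P[/eqP Ef /eqP Eg /eqP Ek] := J.
(* Conjugation by h in [H] preserves membership in [H], so the condition on s = r_i h depends on i
   only. *)
rewrite (eq_bigl [in H]); last first.
  move=> h /=; case hH : (h \in H) => //=.
  by rewrite !conjgM !(groupJr _ hH) !mem // J.
rewrite !shE // mulr_natl -sumr_const; apply: eq_bigr => h hH.
have cJ (a b : gT) : commute a b -> (b ^ r i * a ^ r i * (b ^ r i)^-1 = a ^ r i)%g.
  by move=> ab; rewrite -conjVg -!conjMg cE.
have Hi a : a \in G -> cact H r a i = i -> (a ^ r i)%g \in H.
  by move=> aG Ea; rewrite mem // Ea.
have C1 : (g ^ r i)%g \in 'C_H[(f ^ r i)]%g.
  rewrite inE Hi //=; apply/cent1P.
  by rewrite /commute -!conjMg cfg.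
have hV := groupVr hH.
(* Conjugation by r_i h is conjugation by r_i followed by that by h; invariance is applied to h^-1,
   because [x ^ h] is h^-1 x h. *)
rewrite !conjgM -(character3_conj W_strict rho_rep (Hi f fG Ef) (Hi g gG Eg) (Hi k kG Ek)
  (cJ _ _ cfg) (cJ _ _ cfk) (cJ _ _ cgk) hV (rho_findim _ _ (Hi f fG Ef) C1)).
by rewrite invgK !conjgE !mulgA.
Qed.
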